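(* Let $1<p<\infty$ and $\alpha>1$. Suppose $f=g\circ\phi$, where $g\in H^p$, $\phi:\mathbb D\to\mathbb D$ is quasiconformal, and the boundary map $\psi=\phi|_{\mathbb T}$ has boundary weight $w_\psi\in A_p(\mathbb T)$. Assume also that $g^*\in L^p(w_\psi|d\zeta|)$ and that, for some $\beta>1$, $$\phi(\Gamma_\alpha(\xi))\subset\Gamma_\beta(\psi(\xi))\qquad(\xi\in\mathbb T).$$ Then $f$ has non-tangential boundary values $$f^*(\xi)=g^*(\psi(\xi))$$ for a.e. $\xi\in\mathbb T$, and every convex curve $\Gamma\subset\mathbb D$ satisfies $$\int_\Gamma|f(z)|^p\,ds(z)\le B_\alpha\,C_{p,\beta}([w_\psi]_{A_p})\int_{\mathbb T}|f^*(\xi)|^p\,|d\xi|,$$ where $B_\alpha<\infty$ is a constant depending only on $\alpha$ and $C_{p,\beta}([w_\psi]_{A_p})<\infty$ is a constant depending only on $p$, $\beta$ and $[w_\psi]_{A_p}$.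
   Context: $\mathbb D=\{z\in\mathbb C:|z|<1\}$, $\mathbb T=\partial\mathbb D$, $|d\xi|$ (or $|d\zeta|$, $|d\eta|$) is arclength measure on $\mathbb T$, and $ds$ is arclength. The analytic Hardy space $H^p$ consists of all analytic $g$ in $\mathbb D$ with $\sup_{0<r<1}\int_{\mathbb T}|g(r\zeta)|^p\,|d\zeta|<\infty$; $g^*$ is its boundary function (radial limits a.e.). For $\alpha>1$, $\xi\in\mathbb T$, the Stolz cone is $\Gamma_\alpha(\xi)=\{z\in\mathbb D:|z-\xi|<\alpha(1-|z|)\}$. The non-tangential boundary value of $f$ is $f^*(\xi)=\lim_{z\to\xi,\,z\in\Gamma_\alpha(\xi)}f(z)$. $\psi=\phi|_{\mathbb T}:\mathbb T\to\mathbb T$ denotes the boundary extension of $\phi$, an orientation-preserving homeomorphism. To say that $\psi$ has boundary weight $w_\psi$ means that the push-forward measure $\psi_*(|d\xi|)$ is absolutely continuous with respect to arclength, with density $w_\psi$ defined by $\int_{\mathbb T}H(\eta)w_\psi(\eta)\,|d\eta|=\int_{\mathbb T}H(\psi(\xi))\,|d\xi|$ for all non-negative Borel functions $H$ on $\mathbb T$. For $1<p<\infty$, $w_\psi\in A_p(\mathbb T)$ means $$[w_\psi]_{A_p}:=\sup_{I\subset\mathbb T}\left(\frac1{|I|}\int_I w_\psi\,|d\xi|\right)\left(\frac1{|I|}\int_I w_\psi^{-1/(p-1)}\,|d\xi|\right)^{p-1}<\infty,$$ the supremum being over arcs $I$ with arclength $|I|$. A convex curve means a simple rectifiable arc, or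 a closed rectifiable curve, contained in the boundary of a convex subset of $\mathbb D$; line segments are allowed. Repeated parametrizations are excluded: the relevant measure is arclength on the trace. *)

(* Defs.v *)
From HB Require Import structures.
From mathcomp Require Import all_boot all_order all_algebra.
From mathcomp Require Export complex.
From mathcomp Require Export all_classical all_reals all_analysis.
From mathcomp Require Export measurable_realfun.

Set Implicit Arguments.
Unset Strict Implicit.
Unset Printing Implicit Defensive.

Import Order.TTheory GRing.Theory Num.Theory.
Import numFieldNormedType.Exports.

Local Open Scope classical_set_scope.
Local Open Scope complex_scope.
Local Open Scope ring_scope.

Section Definitions.
Context {R : realType}.
(* MathComp-Analysis puts the topology of a concrete field K on K^o. *)
Local Notation C := R[i]^o.
Local Notation mu := (@lebesgue_measure R).
(* The norm of R[i] takes its values in R[i]; normc is the real-valued one. *)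
Local Notation normc := (@Normc.normc R).

Implicit Types (f g phi psi : C -> C) (w : C -> R) (p : R).

Definition disk : set C := [set z | normc z < 1].

Definition circle : set C := [set z | normc z = 1].

Definition expi (t : R) : C := cos t +i* sin t.

(* Arclength on the circle is the image under expi of Lebesgue measure on an
   interval of length 2 pi. *)
Definition circle_int (F : C -> \bar R) : \bar R :=
  (\int[mu]_(t in `[0%R, (2 * pi)%R]) F (expi t))%E.

Definition circle_ae (P : C -> Prop) : Prop :=
  {ae mu, forall t : R, t \in `[0, 2 * pi] -> P (expi t)}.

Definition borel_on_circle (F : C -> \bar R) : Prop :=
  measurable_fun (T := g_sigma_algebraType (@open C)) circle F.

(* C is a normed module over R[i], so this is complex differentiability. *)
Definition analytic_disk g : Prop :=
  forall z, disk z -> derivable g z 1.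

Definition hardy p g : Prop :=
  analytic_disk g /\
  (ereal_sup [set circle_int (fun zeta => (normc (g ((r%:C : C) * zeta)) `^ p)%:E)
             | r in `]0%R, 1%R[ ] < +oo)%E.

Definition radial (zeta : C) : set_system C :=
  (fun r : R => (r%:C : C) * zeta) @ 1^'-.

(* lim is 0 at the points where the limit does not exist. *)
Definition radial_lim g (zeta : C) : C := lim (g @ radial zeta).

Definition stolz (alpha : R) (xi : C) : set C :=
  [set z | disk z /\ normc (z - xi) < alpha * (1 - normc z)].

Definition nontangential (alpha : R) (xi : C) : set_system C :=
  within (stolz alpha xi) (nbhs xi).

Definition nontangential_lim (alpha : R) f (xi : C) : C :=
  lim (f @ nontangential alpha xi).

Definition homeo_on (A B : set C) f : Prop :=
  exists g : C -> C,
    [/\ (forall x, A x -> B (f x) /\ g (f x) = x),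
        (forall y, B y -> A (g y) /\ f (g y) = y),
        {within A, continuous f} & {within B, continuous g}].

(* limsup_{r -> 0} (max_{|a-z|=r} |phi(a)-phi(z)|) /
                   (min_{|b-z|=r} |phi(b)-phi(z)|) *)
Definition dilatation phi (z : C) : \bar R :=
  limf_esup (fun r : R =>
    ereal_sup [set (normc (phi ab.1 - phi z) / normc (phi ab.2 - phi z))%:E
              | ab in [set ab : C * C | normc (ab.1 - z) = r /\
                                        normc (ab.2 - z) = r]])
    (0^'+ : set_system R).

(* Metric definition. The sense of phi is fixed by that of its boundary map. *)
Definition quasiconformal_disk phi : Prop :=
  homeo_on disk disk phi /\
  exists K : R, forall z, disk z -> (dilatation phi z <= K%:E)%E.

Definition boundary_map phi psi : Prop :=
  forall xi, circle xi -> phi @ within disk (nbhs xi) --> psi xi.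

(* The orientation is expressed by an increasing lift to the real line. *)
Definition circle_homeo_op psi : Prop :=
  homeo_on circle circle psi /\
  exists h : R -> R,
    [/\ continuous h, {homo h : s t / s < t} &
        forall t, psi (expi t) = expi (h t)].

Definition boundary_weight psi w : Prop :=
  [/\ borel_on_circle (EFin \o w),
      (forall eta, circle eta -> 0 <= w eta) &
      forall H : C -> \bar R, borel_on_circle H ->
        (forall eta, circle eta -> (0 <= H eta)%E) ->
        circle_int (fun eta => (H eta * (w eta)%:E)%E) =
        circle_int (H \o psi)].

(* Mean over the arc {e^{it} : a <= t <= b}, for a < b <= a + 2 pi. *)
Definition arc_mean (F : C -> \bar R) (a b : R) : \bar R :=
  ((b - a)^-1%:E * \int[mu]_(t in `[a, b]) F (expi t))%E.

(* w^{-1/(p-1)}, infinite where w vanishes (whereas powR 0 r = 0, r <> 0). *)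
Definition dual_weight p w (xi : C) : \bar R :=
  if w xi == 0 then +oo%E else (w xi `^ (- (p - 1)^-1))%:E.

Definition Ap_char p w : \bar R :=
  ereal_sup [set (arc_mean (EFin \o w) ab.1 ab.2 *
                  poweR (arc_mean (dual_weight p w) ab.1 ab.2) (p - 1))%E
            | ab in [set ab : R * R | ab.1 < ab.2 <= ab.1 + 2 * pi]].

Definition polygonal_length (gam : R -> C) (a b : R) (s : seq R) : R :=
  let F := gam \o nth b (a :: s) in
  \sum_(0 <= n < size s) normc (F n.+1 - F n).

Definition polygonal_lengths (gam : R -> C) (a b : R) : set R :=
  [set polygonal_length gam a b s | s in itv_partition a b].

Definition rectifiable (gam : R -> C) (a b : R) : Prop :=
  has_ubound (polygonal_lengths gam a b).

Definition arclength (gam : R -> C) (a b : R) : R :=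
  sup (polygonal_lengths gam a b).

(* The point of the curve at arclength s from its origin. *)
Definition arclength_param (gam : R -> C) (a b s : R) : C :=
  gam (sup [set t | t \in `[a, b] /\ arclength gam a t <= s]).

Definition curve_int (gam : R -> C) (a b : R) (F : C -> \bar R) : \bar R :=
  (\int[mu]_(s in `[0%R, arclength gam a b])
     F (arclength_param gam a b s))%E.

Definition boundary (K : set C) : set C := closure K `\` K°.

(* A simple arc, or a closed curve run through once, so that curve_int is the
   integral with respect to arclength on the trace. *)
Definition convex_curve (gam : R -> C) (a b : R) : Prop :=
  [/\ a < b,
      {within `[a, b], continuous gam},
      rectifiable gam a b,
      {in `[a, b] &, injective gam} \/
        gam a = gam b /\ {in `[a, b[ &, injective gam} &
      exists K : set C,
        [/\ convex_set (K : set (convex_lmodType C)), K `<=` disk &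
            forall t, t \in `[a, b] -> boundary K (gam t)]].

End Definitions.

(* Main.v *)
Require Import Defs.
From HB Require Import structures.
From mathcomp Require Import all_boot all_order all_algebra.
From mathcomp Require Import complex.
From mathcomp Require Import all_classical all_reals all_analysis.
From mathcomp Require Import measurable_realfun.
From mathcomp Require Import ring lra.

Set Implicit Arguments.
Unset Strict Implicit.
Unset Printing Implicit Defensive.

Import Order.TTheory GRing.Theory Num.Theory.
Import numFieldNormedType.Exports.

Local Open Scope classical_set_scope.
Local Open Scope complex_scope.
Local Open Scope ring_scope.


(** The value of [f = g o phi] in the Stolz cone at [xi] is a value of [g] in
    the Stolz cone at [psi xi], so everything reduces to bounding [g] in cones
    by a maximal function of its boundary values, and a curve integral by an
    integral over the circle of suprema over cones.

    Boundary values. The real and imaginary parts of [g] satisfy the Poisson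
    formula on each circle of radius less than one ([poisson_formula], from
    Goursat's theorem in logarithmic coordinates). Instead of weak compactness
    in [L^p], strict convexity gives the boundary function: the mean over the
    circle of radius [r] of [sqrt (1 + u^2)] increases with [r] and is bounded,
    so the traces of [u] on these circles form a Cauchy family in mean
    ([mean_cauchy]; the bound of order [p > 1] controls the large values). Hence
    [u] is the Poisson integral of an integrable function ([boundary_function]).
    Fatou's theorem ([fatou]) gives nontangential limits of [g] at its Lebesgue
    points, in cones of every aperture. The push-forward of arclength by [psi]
    has a density, so null sets pull back to null sets ([null_preimage]), and
    the inclusion of cones transfers the limits to [f].

    The maximal function. In the cone of aperture [beta] at a point, [g] is at
    most a constant times the averages of its boundary values over the arcs
    centred there ([poisson_maximal]), and hence times the larger of two dyadic
    maximal functions, by the one-third trick ([one_third]). These are bounded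
    on [L^p(w)] with a constant that depends only on [p] and on the
    characteristic of [w]: following Lerner, the dyadic maximal function is
    dominated by a composition of two weighted ones ([lerner_tree]), for which
    Doob's inequality has a constant independent of the weight ([doob_tree]).
    All of this takes place on finite binary trees; the depth tends to infinity
    at the very end, by monotone convergence. The change of variables by [psi]
    turns the norm in [L^p(w)] of the maximal function into the norm in [L^p] of
    its composition with [psi], and that of [g^*] into the norm of [f^*].

    Convex curves. If [H] dominates [F] in the sense that [F z <= H xi] whenever
    [z] lies in the cone at [xi], then the arclength integral of [F] over a
    convex curve is at most a constant, depending on the aperture alone, times
    the integral of [H] over the circle ([crofton]). This is Crofton's formula:
    a line separates the endpoints of at most two edges of a polygon inscribed
    in the curve ([line_crosses_twice]). Moreover, a line through [z] whose
    direction is close to that of [z] leaves the disk at a point [xi] whose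
    cone contains [z] ([stolz_near]). Finitely many directions suffice for
    this, and two of them are available at each [z], which control the lengths
    of all edges ([two_directions]). *)

(** * The complex plane and the circle *)

Section Modulus.
Context {R : realType}.
Local Notation C := R[i]^o.
Local Notation normc := (@Normc.normc R).
Local Notation Re := (@complex.Re R).
Local Notation Im := (@complex.Im R).
Implicit Types (z w : R[i]).

Lemma normc_sqr z : normc z ^+ 2 = Re z ^+ 2 + Im z ^+ 2.
Proof. by case: z => a b /=; rewrite sqr_sqrtr// addr_ge0 ?sqr_ge0. Qed.

Lemma normc_ge0 z : 0 <= normc z.
Proof. by case: z => a b /=; exact: sqrtr_ge0. Qed.

Lemma normc_eq0 z : (normc z == 0) = (z == 0).
Proof.
by apply/eqP/eqP => [/Normc.eq0_normc //|->]; exact: Normc.normc0.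
Qed.

Lemma normc_gt0 z : (0 < normc z) = (z != 0).
Proof. by rewrite lt0r normc_eq0 normc_ge0 andbT. Qed.

Lemma normcC z w : normc (z - w) = normc (w - z).
Proof. by rewrite -normcN opprB. Qed.

Lemma normc_tri z w u : normc (z - u) <= normc (z - w) + normc (w - u).
Proof. by have := @le_normcD R (z - w) (w - u); rewrite addrA subrK. Qed.

Lemma normc_subr z w : normc z - normc w <= normc (z - w).
Proof. by rewrite lerBlDr; have := @le_normcD R (z - w) w; rewrite subrK. Qed.

Lemma ler_Re z : `|Re z| <= normc z.
Proof.
rewrite -(@ler_pXn2r _ 2) ?nnegrE ?normc_ge0// normc_sqr real_normK ?num_real//.
by rewrite lerDl sqr_ge0.
Qed.

Lemma ler_Im z : `|Im z| <= normc z.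
Proof.
rewrite -(@ler_pXn2r _ 2) ?nnegrE ?normc_ge0// normc_sqr real_normK ?num_real//.
by rewrite lerDr sqr_ge0.
Qed.

Lemma normc_le_ReIm z : normc z <= `|Re z| + `|Im z|.
Proof.
rewrite -(@ler_pXn2r _ 2) ?nnegrE ?normc_ge0 ?addr_ge0// normc_sqr sqrrD.
by rewrite !real_normK ?num_real// -addrA addrCA -subr_ge0 addrK -mulr_natr !mulr_ge0.
Qed.

Lemma normc_real (x : R) : normc x%:C = `|x|.
Proof. by rewrite /= expr0n addr0 sqrtr_sqr. Qed.

Lemma normc_norm (z : C) : `|z| = (normc z)%:C.
Proof. by rewrite normc_def; case: z. Qed.

(** The norm of the complex plane takes its values in the plane itself; all
    estimates below are made with the real-valued modulus instead, to which
    this lemma reduces the topology. *)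
Lemma nbhs_normcP (z : C) (A : set C) :
  nbhs z A <-> exists2 e : R, 0 < e & forall w, normc (w - z) < e -> A w.
Proof.
split=> [/nbhs_ballP[[e e'] /=]|[e e0 eA]].
  rewrite ltcE /= => /andP[/eqP -> e0] eA; exists e => // w wz.
  by apply: eA; rewrite -ball_normE /ball_/= normc_norm ltcE/= eqxx normcC.
apply/nbhs_ballP; exists e%:C => /=; first by rewrite ltcE/= eqxx.
move=> w; rewrite -ball_normE /ball_/= normc_norm ltcE/= eqxx/= => wz.
by apply: eA; rewrite normcC.
Qed.

Lemma cvg_normcP (T : Type) (F : set_system T) {FF : Filter F} (f : T -> C)
    (l : C) :
  f @ F --> l <-> forall e : R, 0 < e -> \forall t \near F, normc (f t - l) < e.
Proof.
split=> [fl e e0|fl A /nbhs_normcP[e e0 eA]].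
  have := fl [set w | normc (w - l) < e]; apply; apply/nbhs_normcP.
  by exists e.
by apply: (filterS _ (fl _ e0)) => t ft; exact: eA.
Qed.

Lemma continuous_Re : continuous (Re : C -> R).
Proof.
move=> z; apply/(@cvgrPdist_lt _ _ _ _ (nbhs_filter z)) => e e0; apply/nbhs_normcP; exists e => // w.
rewrite normcC; apply: le_lt_trans; rewrite -raddfB/=; exact: ler_Re.
Qed.

Lemma continuous_Im : continuous (Im : C -> R).
Proof.
move=> z; apply/(@cvgrPdist_lt _ _ _ _ (nbhs_filter z)) => e e0; apply/nbhs_normcP; exists e => // w.
rewrite normcC; apply: le_lt_trans; rewrite -raddfB/=; exact: ler_Im.
Qed.

Lemma cvg_ReIm (T : Type) (F : set_system T) {FF : Filter F} (f : T -> C)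
    (l : C) :
  Re (f t) @[t --> F] --> Re l -> Im (f t) @[t --> F] --> Im l -> f @ F --> l.
Proof.
move=> /cvgrPdist_lt fR /cvgrPdist_lt fI; apply/cvg_normcP => e e0.
have e20 : 0 < e / 2 by rewrite divr_gt0.
near=> t; apply: (le_lt_trans (normc_le_ReIm _)).
rewrite (splitr e) 2!raddfB/= -[ltLHS]/(_ + _) ltrD//.
  by rewrite distrC; near: t; exact: fR.
by rewrite distrC; near: t; exact: fI.
Unshelve. all: by end_near. Qed.

Lemma continuous_normc : continuous (normc : C -> R).
Proof.
move=> z; apply/(@cvgrPdist_lt _ _ _ _ (nbhs_filter z)) => e e0; apply/nbhs_normcP; exists e => // w.
apply: le_lt_trans; rewrite ler_norml (normcC w) normc_subr lerNl opprB.
by rewrite normcC normc_subr.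
Qed.

Lemma normc_expi (t : R) : normc (expi t) = 1.
Proof. by rewrite /= cos2Dsin2 sqrtr1. Qed.

Lemma circle_expi (t : R) : circle (expi t).
Proof. exact: normc_expi. Qed.

Lemma expiD (s t : R) : expi (s + t) = expi s * expi t.
Proof. by rewrite /expi cosD sinD; congr (_ +i* _); rewrite addrC. Qed.

Lemma expi_2pi (t : R) : expi (t + 2 * pi) = expi t.
Proof. by rewrite /expi mulr_natl cosD2pi sinD2pi. Qed.

Lemma expi_neq0 (t : R) : expi t != 0 :> R[i].
Proof. by rewrite -normc_gt0 normc_expi. Qed.

Lemma continuous_expi : continuous (expi : R -> C).
Proof.
by move=> t; apply: cvg_ReIm => /=; [exact: continuous_cos|exact: continuous_sin].
Qed.

Lemma normc_polar (r t : R) : 0 <= r -> normc (r%:C * expi t) = r.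
Proof. by move=> r0; rewrite Normc.normcM normc_expi mulr1 normc_real ger0_norm. Qed.

(** The inverse of [expi] on [0, 2 pi[; the arc cosine only sees the real
    part, whence the two cases. *)
Definition arg (z : C) : R :=
  if 0 <= Im z then acos (Re z) else 2 * pi - acos (Re z).

Lemma circle_Re z : circle z -> -1 <= Re z <= 1.
Proof. by rewrite /circle/= => z1; rewrite -ler_norml -z1 ler_Re. Qed.

Lemma expi_arg z : circle z -> expi (arg z) = z.
Proof.
move=> Cz; have zR := circle_Re Cz.
have z2 : Im z ^+ 2 = 1 - Re z ^+ 2.
  by move: (normc_sqr z); rewrite Cz expr1n => ->; rewrite addrAC subrr add0r.
rewrite /arg; case: ifPn => [Iz|/negbTE]; rewrite /expi.
  rewrite acosK ?in_itv//= sin_acos// -z2 sqrtr_sqr ger0_norm//; by case: (z).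
move/negbT; rewrite -ltNge => Iz.
rewrite mulr_natl addrC cosD2pi sinD2pi cosN sinN acosK ?in_itv//= sin_acos//.
by rewrite -z2 sqrtr_sqr ltr0_norm// opprK; case: (z).
Qed.

Lemma arg_expi (t : R) : 0 <= t < 2 * pi -> arg (expi t) = t.
Proof.
move=> /andP[t0 t2]; rewrite /arg/=; have [tp|pt] := leP t pi.
  by rewrite sin_ge0_pi ?t0// cosK// in_itv/= t0.
have E : sin t < 0.
  rewrite -(subrK pi t) sinDpi oppr_lt0 sin_gt0_pi// subr_gt0 pt/=.
  by rewrite ltrBlDr -mulr2n -mulr_natl.
rewrite leNgt E/= -[cos t]cosN -cosD2pi cosK ?in_itv/=.
  by rewrite -mulr_natl; ring.
rewrite -mulr_natl addrC subr_ge0 ltW//= lerBlDr.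
by rewrite mulr_natl mulr2n lerD2l ltW.
Qed.

Lemma arg_ge0_lt2pi (z : C) : circle z -> 0 <= arg z < 2 * pi.
Proof.
move=> Cz; have zR := circle_Re Cz; rewrite /arg; case: ifPn => Iz.
  rewrite acos_ge0//= (le_lt_trans (acos_lepi zR))//.
  by rewrite mulr_natl mulr2n ltrDl pi_gt0.
have p0 := @pi_gt0 R; have := acos_lepi zR; have a0 := acos_ge0 zR.
rewrite subr_ge0 ltrBlDr ltrDl => api; apply/andP; split; first by lra.
rewrite lt_neqAle a0 andbT eq_sym; apply/eqP => a0'.
move: Iz (normc_sqr z); rewrite Cz -ltNge => Iz.
have -> : Re z = 1 by rewrite -(acosK (x := Re z)) ?in_itv//= a0' cos0.
by rewrite expr1n => /eqP; rewrite addrC -subr_eq subrr eq_sym sqrf_eq0 lt_eqF.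
Qed.

Lemma normc_expiB (s t : R) : normc (expi s - expi t) ^+ 2 = 2 - 2 * cos (s - t).
Proof.
rewrite normc_sqr /= cosB; move: (cos2Dsin2 s) (cos2Dsin2 t).
move: (cos s) (sin s) (cos t) (sin t) => a b c d; move=> ab cd.
rewrite (_ : _ + _ = (a ^+ 2 + b ^+ 2) + (c ^+ 2 + d ^+ 2) - 2 * (a * c + b * d)).
  by rewrite ab cd.
by ring.
Qed.

Lemma sin_lipschitz (x y : R) : x <= y -> `|sin y - sin x| <= y - x.
Proof.
move=> xy.
have [|c _ ->] := @MVT_segment R sin cos x y xy.
  by apply: continuous_subspaceT; exact: continuous_sin.
rewrite normrM (ger0_norm (_ : 0 <= y - x)) ?subr_ge0//.
by rewrite ler_piMl ?subr_ge0// ler_norml cos_geN1 cos_le1.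
Qed.

Lemma sin_ge_half (y : R) : 0 <= y <= pi / 2 -> y / 2 <= sin y.
Proof.
move=> /andP[y0 yp]; have p0 := @pi_gt0 R.
have y20 : 0 <= y / 2 by lra.
have cy : 0 <= cos y by apply: cos_ge0_pihalf; rewrite ?(le_trans _ y0)//; lra.
have [|c] := @MVT_segment R sin cos 0 (y / 2) y20.
  by apply: continuous_subspaceT; exact: continuous_sin.
rewrite in_itv/= => /andP[c0 c1]; rewrite sin0 !subr0 => E.
have Ey : y = y / 2 + y / 2 by rewrite -splitr.
have cc : cos (y / 2) <= cos c.
  rewrite leNgt; apply/negP => H; move: (c1); rewrite leNgt => /negP; apply.
  by rewrite -ltr_cos// ?in_itv/=; apply/andP; split; lra.
have cy2 : 0 <= cos (y / 2) by apply: cos_ge0_pihalf; lra.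
have E2 : cos y = 2 * cos (y / 2) ^+ 2 - 1.
  have := cos2Dsin2 (y / 2); move=> H.
  rewrite [in cos y]Ey cosD; lra.
have E3 : sin y = 2 * sin (y / 2) * cos (y / 2).
  by rewrite {1}Ey sinD; ring.
have h1 : cos (y / 2) ^+ 2 <= cos c * cos (y / 2) by rewrite expr2 ler_wpM2r.
have h2 : 2^-1 <= cos c * cos (y / 2) by lra.
rewrite E3 E (_ : _ * _ * _ = y * (cos c * cos (y / 2))); first by rewrite ler_wpM2l.
by field.
Qed.

(** A chord is comparable to the arc it subtends: its length is twice the sine
    of half the arc. The constant is not sharp. *)
Lemma normc_expiB_ge (s t : R) : `|s - t| <= pi ->
  `|s - t| / 2 <= normc (expi s - expi t).
Proof.
move=> st; set x := `|s - t| in st *.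
have x0 : 0 <= x by exact: normr_ge0.
have Ec : cos (s - t) = cos x by rewrite /x; case: ler0P => // _; rewrite cosN.
rewrite -(@ler_pXn2r _ 2) ?nnegrE ?normc_ge0 ?divr_ge0// normc_expiB Ec.
have : x / 2 / 2 <= sin (x / 2) by apply: sin_ge_half; lra.
have Ex : x = x / 2 + x / 2 by rewrite -splitr.
have := cos2Dsin2 (x / 2); rewrite [in cos x]Ex cosD -!expr2.
move: (cos (x / 2)) (sin (x / 2)) => a b ab bx; nra.
Qed.

Lemma expi_periodic_int (t : R) (n : nat) : expi (t + n%:R * (2 * pi)) = expi t.
Proof.
elim: n => [|n IH]; first by rewrite mul0r addr0.
by rewrite -natr1 mulrDl mul1r addrA expi_2pi.
Qed.

End Modulus.

(** * Goursat's theorem *)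

Section Goursat.
Context {R : realType}.
Local Notation mu := (@lebesgue_measure R).

Lemma integrable_within_continuous (f : R -> R) (a b : R) :
  {within `[a, b], continuous f} -> mu.-integrable `[a, b] (EFin \o f).
Proof. by move=> cf; apply: continuous_compact_integrable => //; exact: segment_compact. Qed.

Lemma RintegralD_itv (f g : R -> R) (a b : R) :
  mu.-integrable `[a, b] (EFin \o f) -> mu.-integrable `[a, b] (EFin \o g) ->
  \int[mu]_(t in `[a, b]) (f t + g t) =
  \int[mu]_(t in `[a, b]) f t + \int[mu]_(t in `[a, b]) g t.
Proof. by move=> fi gi; rewrite RintegralD. Qed.

Lemma Rintegral_split (f : R -> R) (a c b : R) : a <= c <= b ->
  mu.-integrable `[a, b] (EFin \o f) ->
  \int[mu]_(t in `[a, b]) f t =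
  \int[mu]_(t in `[a, c]) f t + \int[mu]_(t in `[c, b]) f t.
Proof.
move=> /andP[ac cb] fi.
have := @Rintegral_itvB R f (BLeft a) (BRight b) c fi.
rewrite !bnd_simp => /(_ ac cb) E.
rewrite -(Rintegral_itv_obnd_cbnd (r := c)); first by rewrite -E addrC subrK.
by apply: integrableS fi => //; apply: subset_itv; rewrite bnd_simp.
Qed.

Lemma Rintegral_near_cst (f : R -> R) (a b c M : R) : a <= b ->
  mu.-integrable `[a, b] (EFin \o f) ->
  (forall t, a <= t <= b -> `|f t - c| <= M) ->
  `|\int[mu]_(t in `[a, b]) f t - c * (b - a)| <= M * (b - a).
Proof.
move=> ab fi fc.
have cstE (k : R) : \int[mu]_(t in `[a, b]) k = k * (b - a).
  rewrite Rintegral_cst//= lebesgue_measure_itv/= lte_fin.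
  by move: ab; rewrite le_eqVlt => /predU1P[->|->]; rewrite ?ltxx ?subrr ?mulr0.
have ci (k : R) : mu.-integrable `[a, b] (EFin \o cst k).
  by apply: integrable_within_continuous; apply: continuous_subspaceT => x; exact: cvg_cst.
have fci : mu.-integrable `[a, b] (EFin \o (fun t => f t - c)).
  by apply: (integrableB _ fi (ci c)); exact: measurable_itv.
rewrite -(cstE c) -(cstE M) -RintegralB//; last exact: ci.
apply: (le_trans (le_normr_Rintegral _ fci)) => //.
apply: le_Rintegral => //.
  by have := integrable_norm fci.
exact: ci.
Qed.

Lemma nested_intervals (x a : nat -> R) :
  (forall n, 0 <= a n) -> (forall n, x n <= x n.+1) ->
  (forall n, x n.+1 + a n.+1 <= x n + a n) ->
  exists X, forall n, x n <= X <= x n + a n.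
Proof.
move=> a0 xS xaS.
have mono m n : (m <= n)%N -> x m <= x n /\ x n + a n <= x m + a m.
  move=> /subnK <-; elim: (n - m)%N => [|k [h1 h2]]; first by [].
  by rewrite addSn; split; [exact: le_trans h1 (xS _)|exact: le_trans (xaS _) h2].
have ub m n : x m <= x n + a n.
  have [mn|/ltnW nm] := leqP m n.
    by have [h _] := mono _ _ mn; rewrite (le_trans h)// lerDl.
  by have [_ h] := mono _ _ nm; rewrite (le_trans _ h)// lerDl.
have hs : has_sup (range x).
  by split; [exists (x 0%N), 0%N|exists (x 0%N + a 0%N) => _ [m _ <-]].
exists (sup (range x)) => n; apply/andP; split.
  by apply: (ub_le_sup hs.2); exists n.
by apply: ge_sup; [exists (x 0%N), 0%N|move=> _ [m _ <-]].
Qed.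

Variables u v : R -> R -> R.

(** With [f = u + i v], this is the integral of [Im (f dz)] along the boundary
    of a rectangle. The real part of the integral is the same form for [i f],
    and the imaginary part suffices for the mean value property. *)
Definition boundary_form (x1 x2 y1 y2 : R) : R :=
  \int[mu]_(t in `[x1, x2]) (v t y1 - v t y2) +
  \int[mu]_(t in `[y1, y2]) (u x2 t - u x1 t).

(** Complex differentiability of [u + i v] at [x0 + i y0], with derivative [p
    + i q], in real coordinates. *)
Definition cdiff_at (x0 y0 : R) : Prop :=
  exists p q : R, forall e : R, 0 < e -> exists2 d : R, 0 < d &
  forall x y, `|x - x0| < d -> `|y - y0| < d ->
    `|u x y - u x0 y0 - (p * (x - x0) - q * (y - y0))| <=
      e * (`|x - x0| + `|y - y0|) /\
    `|v x y - v x0 y0 - (q * (x - x0) + p * (y - y0))| <=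
      e * (`|x - x0| + `|y - y0|).

Lemma cdiff_lip x0 y0 : cdiff_at x0 y0 ->
  exists M d : R, [/\ 0 < d, 0 < M & forall x y, `|x - x0| < d -> `|y - y0| < d ->
    `|u x y - u x0 y0| <= M * (`|x - x0| + `|y - y0|) /\
    `|v x y - v x0 y0| <= M * (`|x - x0| + `|y - y0|)].
Proof.
move=> [p [q H]]; have [d d0 Hd] := H 1 ltr01.
exists (`|p| + `|q| + 1), d; split => //.
move=> x y xd yd; have [h1 h2] := Hd _ _ xd yd.
set X := `|x - x0| in h1 h2 *; set Y := `|y - y0| in h1 h2 *.
have X0 : 0 <= X by exact: normr_ge0.
have Y0 : 0 <= Y by exact: normr_ge0.
have p0 := normr_ge0 p; have q0 := normr_ge0 q.
have px : `|p * (x - x0)| = `|p| * X by rewrite normrM.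
have qy : `|q * (y - y0)| = `|q| * Y by rewrite normrM.
have py : `|p * (y - y0)| = `|p| * Y by rewrite normrM.
have qx : `|q * (x - x0)| = `|q| * X by rewrite normrM.
split.
  rewrite -(subrK (p * (x - x0) - q * (y - y0)) (u x y - u x0 y0)).
  apply: (le_trans (ler_normD _ _)).
  have := ler_normB (p * (x - x0)) (q * (y - y0)); rewrite px qy; nra.
rewrite -(subrK (q * (x - x0) + p * (y - y0)) (v x y - v x0 y0)).
apply: (le_trans (ler_normD _ _)).
have := ler_normD (q * (x - x0)) (p * (y - y0)); rewrite qx py; nra.
Qed.

Lemma cdiff_continuous x0 y0 : cdiff_at x0 y0 ->
  [/\ {for x0, continuous (fun x => u x y0)}, {for x0, continuous (fun x => v x y0)},
      {for y0, continuous (u x0)} & {for y0, continuous (v x0)}].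
Proof.
move=> /cdiff_lip[M [d [d0 M0 H]]].
have near_lt (z e : R) : 0 < e -> \forall w \near z, `|w - z| < Num.min d (e / M).
  move=> e0; near=> w; rewrite distrC; near: w.
  apply: (@cvgr_dist_lt _ _ _ (nbhs z) _ id z) => //.
  by rewrite lt_min d0 divr_gt0.
have kill : `|x0 - x0| < d /\ `|y0 - y0| < d by rewrite !subrr normr0.
have Z (a : R) : `|a - a| = 0 by rewrite subrr normr0.
split; apply/cvgrPdist_lt => e e0; have := near_lt _ _ e0.
- move=> /(_ x0); apply: filterS => w; rewrite lt_min ltr_pdivlMr// => /andP[w1 w2].
  have [h _] := H _ _ w1 kill.2; rewrite distrC (le_lt_trans h)//.
  by rewrite Z addr0 mulrC.
- move=> /(_ x0); apply: filterS => w; rewrite lt_min ltr_pdivlMr// => /andP[w1 w2].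
  have [_ h] := H _ _ w1 kill.2; rewrite distrC (le_lt_trans h)//.
  by rewrite Z addr0 mulrC.
- move=> /(_ y0); apply: filterS => w; rewrite lt_min ltr_pdivlMr// => /andP[w1 w2].
  have [h _] := H _ _ kill.1 w1; rewrite distrC (le_lt_trans h)//.
  by rewrite Z add0r mulrC.
- move=> /(_ y0); apply: filterS => w; rewrite lt_min ltr_pdivlMr// => /andP[w1 w2].
  have [_ h] := H _ _ kill.1 w1; rewrite distrC (le_lt_trans h)//.
  by rewrite Z add0r mulrC.
Unshelve. all: by end_near. Qed.

Section Rectangle.
Variables X1 X2 Y1 Y2 : R.
Hypothesis cd : forall x y, X1 <= x <= X2 -> Y1 <= y <= Y2 -> cdiff_at x y.

Lemma rect_integrable_h (x1 x2 y y' : R) : X1 <= x1 -> x2 <= X2 ->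
  Y1 <= y <= Y2 -> Y1 <= y' <= Y2 ->
  mu.-integrable `[x1, x2] (EFin \o (fun t => v t y - v t y')).
Proof.
move=> h1 h2 hy hy'; apply: integrable_within_continuous.
apply: continuous_in_subspaceT => t; rewrite inE/= in_itv/= => /andP[t1 t2].
have tX : X1 <= t <= X2 by rewrite (le_trans h1 t1) (le_trans t2 h2).
have [_ c1 _ _] := cdiff_continuous (cd tX hy).
have [_ c2 _ _] := cdiff_continuous (cd tX hy').
exact: cvgB.
Qed.

Lemma rect_integrable_v (y1 y2 x x' : R) : Y1 <= y1 -> y2 <= Y2 ->
  X1 <= x <= X2 -> X1 <= x' <= X2 ->
  mu.-integrable `[y1, y2] (EFin \o (fun t => u x t - u x' t)).
Proof.
move=> h1 h2 hx hx'; apply: integrable_within_continuous.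
apply: continuous_in_subspaceT => t; rewrite inE/= in_itv/= => /andP[t1 t2].
have tY : Y1 <= t <= Y2 by rewrite (le_trans h1 t1) (le_trans t2 h2).
have [_ _ c1 _] := cdiff_continuous (cd hx tY).
have [_ _ c2 _] := cdiff_continuous (cd hx' tY).
exact: cvgB.
Qed.

Lemma boundary_form_split (x1 xm x2 y1 ym y2 : R) :
  X1 <= x1 -> x1 <= xm -> xm <= x2 -> x2 <= X2 ->
  Y1 <= y1 -> y1 <= ym -> ym <= y2 -> y2 <= Y2 ->
  boundary_form x1 x2 y1 y2 =
    boundary_form x1 xm y1 ym + boundary_form xm x2 y1 ym +
    (boundary_form x1 xm ym y2 + boundary_form xm x2 ym y2).
Proof.
move=> a1 a2 a3 a4 b1 b2 b3 b4.
have hX z : x1 <= z <= x2 -> X1 <= z <= X2.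
  by move=> /andP[z1 z2]; rewrite (le_trans a1 z1) (le_trans z2 a4).
have hY z : y1 <= z <= y2 -> Y1 <= z <= Y2.
  by move=> /andP[z1 z2]; rewrite (le_trans b1 z1) (le_trans z2 b4).
have x1x2 := le_trans a2 a3; have y1y2 := le_trans b2 b3.
have hx1 : X1 <= x1 <= X2 by rewrite hX// lexx.
have hx2 : X1 <= x2 <= X2 by rewrite hX// lexx andbT.
have hxm : X1 <= xm <= X2 by rewrite hX// a2.
have hy1 : Y1 <= y1 <= Y2 by rewrite hY// lexx.
have hy2 : Y1 <= y2 <= Y2 by rewrite hY// lexx andbT.
have hym : Y1 <= ym <= Y2 by rewrite hY// b2.
have addH p q : X1 <= p -> p <= q -> q <= X2 ->
    \int[mu]_(t in `[p, q]) (v t y1 - v t y2) =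
    \int[mu]_(t in `[p, q]) (v t y1 - v t ym) +
    \int[mu]_(t in `[p, q]) (v t ym - v t y2).
  move=> p1 pq q2; rewrite -RintegralD//; try exact: rect_integrable_h.
  by apply: eq_Rintegral => t _; rewrite addrA subrK.
have addV p q : Y1 <= p -> p <= q -> q <= Y2 ->
    \int[mu]_(t in `[p, q]) (u x2 t - u x1 t) =
    \int[mu]_(t in `[p, q]) (u x2 t - u xm t) +
    \int[mu]_(t in `[p, q]) (u xm t - u x1 t).
  move=> p1 pq q2; rewrite -RintegralD//; try exact: rect_integrable_v.
  by apply: eq_Rintegral => t _; rewrite addrA subrK.
rewrite /boundary_form.
rewrite (@Rintegral_split _ x1 xm x2) ?a2//; last exact: rect_integrable_h.
rewrite (@Rintegral_split _ y1 ym y2) ?b2//; last exact: rect_integrable_v.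
rewrite (addH x1 xm) ?(andP hxm).2// (addH xm x2) ?(andP hxm).1//.
rewrite (addV y1 ym) ?(andP hym).2// (addV ym y2) ?(andP hym).1//.
ring.
Qed.

(** The boundary integral of an affine function vanishes, so only the
    remainder of the first-order expansion contributes: at most a small
    multiple of the diameter, times the perimeter. *)
Lemma boundary_form_local (x0 y0 e : R) : 0 < e ->
  X1 <= x0 <= X2 -> Y1 <= y0 <= Y2 -> exists2 d : R, 0 < d &
  forall x y a b, X1 <= x -> x + a <= X2 -> Y1 <= y -> y + b <= Y2 ->
    x <= x0 <= x + a -> y <= y0 <= y + b -> a < d -> b < d ->
    `|boundary_form x (x + a) y (y + b)| <= e * (a + b) ^+ 2.
Proof.
move=> e0 hx0 hy0; have [p [q H]] := cd hx0 hy0.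
have e20 : 0 < e / 2 by rewrite divr_gt0.
have [d d0 Hd] := H _ e20; exists d => // x y a b xX aX yY bY.
move=> /andP[xx0 x0a] /andP[yy0 y0b] ad bd.
have a0 : 0 <= a by rewrite -(lerDl x) (le_trans xx0).
have b0 : 0 <= b by rewrite -(lerDl y) (le_trans yy0).
have bx t : x <= t <= x + a -> `|t - x0| <= a.
  by move=> /andP[t1 t2]; rewrite ler_norml; lra.
have by' t : y <= t <= y + b -> `|t - y0| <= b.
  by move=> /andP[t1 t2]; rewrite ler_norml; lra.
have est s t : x <= s <= x + a -> y <= t <= y + b ->
   `|u s t - u x0 y0 - (p * (s - x0) - q * (t - y0))| <= e / 2 * (a + b) /\
   `|v s t - v x0 y0 - (q * (s - x0) + p * (t - y0))| <= e / 2 * (a + b).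
  move=> hs ht; have [h1 h2] := Hd _ _ (le_lt_trans (bx _ hs) ad) (le_lt_trans (by' _ ht) bd).
  by split; [apply: (le_trans h1)|apply: (le_trans h2)];
    rewrite ler_wpM2l ?(ltW e20)// lerD ?bx ?by'.
have xa : x <= x + a by rewrite lerDl.
have yb : y <= y + b by rewrite lerDl.
have tri (A B c M : R) : `|A| <= M -> `|B| <= M -> A - B = c -> `|c| <= 2 * M.
  by move=> hA hB <-; rewrite (le_trans (ler_normB _ _))// mulr_natl mulr2n lerD.
have hx : X1 <= x <= X2 by rewrite xX (le_trans xa).
have hxa : X1 <= x + a <= X2 by rewrite (le_trans xX).
have hy : Y1 <= y <= Y2 by rewrite yY (le_trans yb).
have hyb : Y1 <= y + b <= Y2 by rewrite (le_trans yY).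
have xin : x <= x <= x + a by rewrite lexx.
have xain : x <= x + a <= x + a by rewrite lexx andbT.
have yin : y <= y <= y + b by rewrite lexx.
have ybin : y <= y + b <= y + b by rewrite lexx andbT.
(* Along opposite sides the affine parts differ by a constant, [- p b]
   horizontally and [p a] vertically, and the contributions cancel. *)
have I1 := @Rintegral_near_cst (fun t => v t y - v t (y + b)) x (x + a) (- (p * b))
  (2 * (e / 2 * (a + b))) xa (rect_integrable_h xX aX hy hyb).
have I2 := @Rintegral_near_cst (fun t => u (x + a) t - u x t) y (y + b) (p * a)
  (2 * (e / 2 * (a + b))) yb (rect_integrable_v yY bY hxa hx).

have {}I1 : `|\int[mu]_(t in `[x, x + a]) (v t y - v t (y + b)) - - (p * b) * (x + a - x)|
    <= 2 * (e / 2 * (a + b)) * (x + a - x).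
  apply: I1 => t ht; apply: (tri _ _ _ _ (est t y ht yin).2 (est t (y + b) ht ybin).2).
  ring.
have {}I2 : `|\int[mu]_(t in `[y, y + b]) (u (x + a) t - u x t) - p * a * (y + b - y)|
    <= 2 * (e / 2 * (a + b)) * (y + b - y).
  apply: I2 => t ht; apply: (tri _ _ _ _ (est (x + a) t xain ht).1 (est x t xin ht).1).
  ring.
rewrite /boundary_form.
move: I1 I2; rewrite !(addrC _ a) !(addrC _ b) !addrK.
set I := Rintegral _ _ _; set J := Rintegral _ _ _ => I1 I2.
have -> : I + J = (I - - (p * b) * a) + (J - p * a * b) by ring.
apply: (le_trans (ler_normD _ _)); apply: (le_trans (lerD I1 I2)).
by rewrite le_eqVlt; apply/orP; left; apply/eqP; field.
Qed.

(** Goursat's theorem: were the integral nonzero, repeated quartering would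
    produce rectangles shrinking to a point of differentiability along which it
    exceeds a fixed multiple of the squared perimeter. *)
Lemma goursat_rectangle : X1 <= X2 -> Y1 <= Y2 ->
  boundary_form X1 X2 Y1 Y2 = 0.
Proof.
move=> X12 Y12; pose A := X2 - X1; pose B := Y2 - Y1.
have A0 : 0 <= A by rewrite subr_ge0.
have B0 : 0 <= B by rewrite subr_ge0.
suff small e : 0 < e -> `|boundary_form X1 X2 Y1 Y2| <= e * (A + B) ^+ 2.
  apply/eqP; rewrite -normr_le0; apply/ler_addgt0Pl => e e0; rewrite addr0.
  have k0 : 0 < (A + B) ^+ 2 + 1 by rewrite ltr_wpDl// sqr_ge0.
  apply: (le_trans (small (e / ((A + B) ^+ 2 + 1)) _)); first by rewrite divr_gt0.
  by rewrite -mulrA ler_piMr ?(ltW e0)// mulrC ler_pdivrMr// mul1r lerDl.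
move=> e0; apply: contrapT => /negP; rewrite -ltNge => bad0.
pose a n := A / 2 ^+ n; pose b n := B / 2 ^+ n.
have p2 n : 0 < (2 : R) ^+ n by rewrite exprn_gt0.
have a0 n : 0 <= a n by rewrite divr_ge0// ltW.
have b0 n : 0 <= b n by rewrite divr_ge0// ltW.
have aS n : a n.+1 = a n / 2 by rewrite /a exprS invfM mulrCA mulrC.
have bS n : b n.+1 = b n / 2 by rewrite /b exprS invfM mulrCA mulrC.
pose inside n (c : R * R) := [/\ X1 <= c.1, c.1 + a n <= X2, Y1 <= c.2 & c.2 + b n <= Y2].
pose bad n (c : R * R) := inside n c /\
  e * (a n + b n) ^+ 2 < `|boundary_form c.1 (c.1 + a n) c.2 (c.2 + b n)|.
pose sub n (c c' : R * R) := [/\ c.1 <= c'.1, c'.1 + a n.+1 <= c.1 + a n,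
   c.2 <= c'.2 & c'.2 + b n.+1 <= c.2 + b n].
have step n c : bad n c -> exists c', sub n c c' /\ bad n.+1 c'.
  case: c => x y [[/= h1 h2 h3 h4] hb]; apply: contrapT => no.
  have good x' y' : x <= x' -> x' + a n.+1 <= x + a n ->
      y <= y' -> y' + b n.+1 <= y + b n ->
      `|boundary_form x' (x' + a n.+1) y' (y' + b n.+1)| <= e * (a n.+1 + b n.+1) ^+ 2.
    move=> g1 g2 g3 g4; rewrite leNgt; apply/negP => hlt; apply: no.
    exists (x', y'); split; first by [].
    by split => //; split => /=; [exact: le_trans g1|exact: le_trans h2|
      exact: le_trans g3|exact: le_trans h4].
  have an := a0 n; have bn := b0 n; have aSn := aS n; have bSn := bS n.
  have Exa : x + a n.+1 + a n.+1 = x + a n by rewrite aSn; field.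
  have Eyb : y + b n.+1 + b n.+1 = y + b n by rewrite bSn; field.
  have an1 := a0 n.+1; have bn1 := b0 n.+1.
  have g1 := good x y; have g2 := good (x + a n.+1) y.
  have g3 := good x (y + b n.+1); have g4 := good (x + a n.+1) (y + b n.+1).
  move: hb; apply/negP; rewrite -leNgt.
  rewrite (@boundary_form_split x (x + a n.+1) (x + a n) y (y + b n.+1) (y + b n))//;
    try lra.
  rewrite Exa Eyb in g1 g2 g3 g4.
  have {}g1 := g1 ltac:(lra) ltac:(lra) ltac:(lra) ltac:(lra).
  have {}g2 := g2 ltac:(lra) ltac:(lra) ltac:(lra) ltac:(lra).
  have {}g3 := g3 ltac:(lra) ltac:(lra) ltac:(lra) ltac:(lra).
  have {}g4 := g4 ltac:(lra) ltac:(lra) ltac:(lra) ltac:(lra).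
  have -> : e * (a n + b n) ^+ 2 = (e * (a n.+1 + b n.+1) ^+ 2 + e * (a n.+1 + b n.+1) ^+ 2)
     + (e * (a n.+1 + b n.+1) ^+ 2 + e * (a n.+1 + b n.+1) ^+ 2) by rewrite aSn bSn; field.
  by apply: (le_trans (ler_normD _ _)); apply: lerD; apply: (le_trans (ler_normD _ _));
     apply: lerD.
have a0E : a 0%N = A by rewrite /a expr0 divr1.
have b0E : b 0%N = B by rewrite /b expr0 divr1.
have bad00 : bad 0%N (X1, Y1).
  have XA : X1 + A = X2 by rewrite /A addrC subrK.
  have YB : Y1 + B = Y2 by rewrite /B addrC subrK.
  by rewrite /bad /inside /= a0E b0E XA YB.
pose nxt n c := if pselect (bad n c) is left H then projT1 (cid (step n c H)) else c.
have nxtP n c : bad n c -> sub n c (nxt n c) /\ bad n.+1 (nxt n c).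
  by move=> H; rewrite /nxt; case: pselect => // H'; case: (cid _).
pose c := fix c n := if n is n'.+1 then nxt n' (c n') else (X1, Y1).
have cbad n : bad n (c n).
  by elim: n => [//|n IH]; have [_ ?] := nxtP _ _ IH.
have csub n : sub n (c n) (c n.+1) by have [? _] := nxtP _ _ (cbad n).
have [x0 Hx0] : exists X, forall n, (c n).1 <= X <= (c n).1 + a n.
  by apply: nested_intervals => // n; have [] := csub n.
have [y0 Hy0] : exists X, forall n, (c n).2 <= X <= (c n).2 + b n.
  by apply: nested_intervals => // n; have [] := csub n.
have [[/= i1 i2 i3 i4] _] := cbad 0%N.
have hx0 : X1 <= x0 <= X2.
  by have /andP[? h] := Hx0 0%N; apply/andP; split => //; exact: le_trans h i2.
have hy0 : Y1 <= y0 <= Y2.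
  by have /andP[? h] := Hy0 0%N; apply/andP; split => //; exact: le_trans h i4.
have [d d0 Hd] := boundary_form_local e0 hx0 hy0.
have smallseq (Z : R) : 0 <= Z -> \forall n \near \oo, Z / 2 ^+ n < d.
  move=> Z0; have : (fun n => Z / 2 ^+ n) @ \oo --> (0 : R).
    rewrite -(mulr0 Z); apply: cvgMr.
    have -> : (fun n => (2 ^+ n)^-1) = (fun n => (2^-1) ^+ n) :> (nat -> R).
      by apply/funext => n; rewrite exprVn.
    by apply: cvg_expr; rewrite ger0_norm ?invr_ge0// invf_lt1// ltr1n.
  move=> /cvgrPdist_lt/(_ _ d0); apply: filterS => n; rewrite sub0r normrN.
  by rewrite ger0_norm// divr_ge0// ltW.
have [n _ /(_ _ (leqnn n)) [an bn]] : \forall n \near \oo, a n < d /\ b n < d.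
  by near=> n; split; near: n; exact: smallseq.
have [[h1 h2 h3 h4]] := cbad n; rewrite ltNge => /negP; apply.
exact: Hd.
Unshelve. all: by end_near. Qed.

End Rectangle.
End Goursat.

(** * The mean value property and the Poisson formula *)

Section MeanValue.
Context {R : realType}.
Local Notation C := R[i]^o.
Local Notation normc := (@Normc.normc R).
Local Notation Re := (@complex.Re R).
Local Notation Im := (@complex.Im R).
Local Notation mu := (@lebesgue_measure R).
Implicit Types k : C -> C.

Lemma derivable_epsilon k (z : C) : derivable k z 1 ->
  exists L : C, forall e : R, 0 < e -> exists2 d : R, 0 < d &
    forall w : C, normc (w - z) < d ->
      normc (k w - k z - L * (w - z)) <= e * normc (w - z).
Proof.
move=> /cvg_ex[/= L kL]; exists L => e e0.
have /cvg_normcP /(_ _ e0) := kL.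
rewrite near_withinE => /nbhs_normcP[d d0 H]; exists d => // w wz.
have [->|wz0] := eqVneq w z; first by rewrite !subrr mulr0 subr0 Normc.normc0 mulr0.
have hz : w - z != 0 by rewrite subr_eq0.
have := H (w - z); rewrite subr0 => /(_ wz hz).
rewrite -[(w - z) *: 1]/((w - z) * 1) mulr1 subrK.
rewrite -[_ *: _]/((w - z)^-1 * _) => /ltW h.
have -> : k w - k z - L * (w - z) = (w - z) * ((w - z)^-1 * (k w - k z) - L).
  by rewrite [RHS]mulrBr mulrA divff// mul1r [L * _]mulrC.
by rewrite Normc.normcM mulrC ler_wpM2r// normc_ge0.
Qed.

Lemma derivable_cts k (z : C) : derivable k z 1 -> {for z, continuous k}.
Proof. by move=> /derivable1_diffP; exact: differentiable_continuous. Qed.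

Lemma real_derive0 (f : R -> R) (l : R) : is_derive (0 : R) 1 f l ->
  forall e : R, 0 < e -> exists2 d : R, 0 < d &
    forall x, `|x| < d -> `|f x - f 0 - l * x| <= e * `|x|.
Proof.
move=> [df dl] e e0; have := df; rewrite /derivable => /cvg_ex[/= l' Hl].
have El : l' = l by rewrite -dl; apply/esym/cvg_lim.
move: Hl => /cvgrPdist_lt /(_ _ e0); rewrite near_withinE El.
move=> /nbhs_ballP[d /= d0 H]; exists d => // x xd.
have [->|x0] := eqVneq x 0; first by rewrite !subrr mulr0 subr0 normr0 mulr0.
have := H x; rewrite /ball/= sub0r normrN => /(_ xd x0).
rewrite -[x *: 1]/(x * 1) mulr1 addr0 -[_ *: _]/(x^-1 * _) => /ltW h.
have -> : f x - f 0 - l * x = - x * (l - x^-1 * (f x - f 0)).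
  by rewrite mulNr mulrBr mulrA divff// mul1r; ring.
by rewrite normrM normrN mulrC ler_wpM2r.
Qed.

(** First-order expansion of the exponential map [x + i y -> e^x e^(iy)]. *)
Lemma exp_expi_linear (e : R) : 0 < e -> exists2 d : R, 0 < d &
  forall x y : R, `|x| < d -> `|y| < d ->
  normc ((expR x)%:C * expi y - 1 - (x +i* y)) <= e * (`|x| + `|y|).
Proof.
move=> e0; have [e1 [e10 a1 a2]] : exists e1 : R, [/\ 0 < e1, e1 <= 1 & e1 * 8 <= e].
  exists (Num.min 1 (e / 8)); split; first by rewrite lt_min ltr01 divr_gt0.
    by rewrite ge_min lexx.
  by rewrite -ler_pdivlMr// ge_min lexx orbT.
have D1 : is_derive (0 : R) 1 expR 1 by have := is_derive_expR (0 : R); rewrite expR0.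
have D2 : is_derive (0 : R) 1 cos 0.
  by have := is_derive_cos (0 : R); rewrite sin0 oppr0.
have D3 : is_derive (0 : R) 1 sin 1 by have := is_derive_sin (0 : R); rewrite cos0.
have [d1 d10 H1] := real_derive0 D1 e10.
have [d2 d20 H2] := real_derive0 D2 e10.
have [d3 d30 H3] := real_derive0 D3 e10.
exists (Num.min e1 (Num.min d1 (Num.min d2 d3))).
  by rewrite !lt_min e10 d10 d20 d30.
move=> x y; rewrite !lt_min => /and4P[x0 x1 _ _] /and4P[_ _ y2 y3].
have {}H1 := H1 _ x1; have {}H2 := H2 _ y2; have {}H3 := H3 _ y3.
rewrite expR0 mul1r in H1; rewrite cos0 mul0r subr0 in H2.
rewrite sin0 mul1r subr0 in H3.
have -> : (expR x)%:C * expi y - 1 - (x +i* y) =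
    (expR x * cos y - 1 - x) +i* (expR x * sin y - y) :> R[i].
  by apply/eqP; rewrite eq_complex/=; apply/andP; split; apply/eqP; ring.
apply: (le_trans (normc_le_ReIm _)) => /=.
move: H1 H2 H3 x0; set X := `|x|; set Y := `|y|.
have X0 : 0 <= X by exact: normr_ge0.
have Y0 : 0 <= Y by exact: normr_ge0.
set E := expR x; set c := cos y; set s := sin y => H1 H2 H3 x0.
have E1 : `|E - 1| <= 2 * X.
  rewrite -(subrK x (E - 1)); apply: (le_trans (ler_normD _ _)); rewrite -/X; nra.
have E3 : `|E| <= 3.
  rewrite -(subrK 1 E); apply: (le_trans (ler_normD _ _)); rewrite normr1; nra.
have T1 : `|E * c - 1 - x| <= e1 * X + 3 * (e1 * Y).
  have -> : E * c - 1 - x = (E - 1 - x) + E * (c - 1) by ring.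
  by apply: (le_trans (ler_normD _ _)); rewrite lerD// normrM ler_pM.
have T2 : `|E * s - y| <= 3 * (e1 * Y) + 2 * e1 * Y.
  have -> : E * s - y = E * (s - y) + (E - 1) * y by ring.
  apply: (le_trans (ler_normD _ _)); rewrite lerD// normrM ?ler_pM//.
  by rewrite (le_trans E1)// ler_wpM2l// ltW.
apply: (le_trans (lerD T1 T2)); nra.
Qed.

(** In logarithmic coordinates a function differentiable off the origin
    satisfies the Cauchy-Riemann expansion, so Goursat's theorem applies to
    annuli. *)
Lemma cdiff_polar k (x0 y0 : R) :
  derivable k ((expR x0)%:C * expi y0) 1 ->
  cdiff_at (fun x y => Re (k ((expR x)%:C * expi y)))
           (fun x y => Im (k ((expR x)%:C * expi y))) x0 y0.
Proof.
set z0 := _ * _ => /derivable_epsilon[L HL].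
have z00 : 0 < normc z0.
  by rewrite normc_polar ?expR_gt0// expR_ge0.
exists (Re (L * z0)), (Im (L * z0)) => e e0.
pose nL := normc L * normc z0.
have nL0 : 0 <= nL by rewrite mulr_ge0 ?normc_ge0.
pose e1 := e / (2 * normc z0 * 2).
have e10 : 0 < e1 by rewrite divr_gt0// !mulr_gt0.
pose e2 := Num.min 1 (e / (2 * (nL + 1))).
have e20 : 0 < e2.
  by rewrite lt_min ltr01 divr_gt0// mulr_gt0// ltr_wpDl.
have [d1 d10 H1] := HL _ e10; have [d2 d20 H2] := exp_expi_linear e20.
exists (Num.min d2 (d1 / (normc z0 * 4 + 1))).
  by rewrite lt_min d20 divr_gt0// ltr_wpDl// mulr_ge0// ltW.
move=> x y; rewrite !lt_min => /andP[x1 x2] /andP[y1 y2].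
set w := (expR x)%:C * expi y : C.
set zeta : C := (expR (x - x0))%:C * expi (y - y0).
have wE : w = z0 * zeta.
  rewrite /w /z0 /zeta -{1}(subrK x0 x) -{1}(subrK y0 y) expRD expiD rmorphM/=.
  by ring.
have {}H2 := H2 _ _ x1 y1; rewrite -/zeta in H2.
set X := `|x - x0| in x1 x2 H2 *; set Y := `|y - y0| in y1 y2 H2 *.
have X0 : 0 <= X by exact: normr_ge0.
have Y0 : 0 <= Y by exact: normr_ge0.
set dz : C := (x - x0) +i* (y - y0) in H2 *.
have dzle : normc dz <= X + Y by exact: normc_le_ReIm.
have le21 : e2 <= 1 by rewrite ge_min lexx.
have z1le : normc (zeta - 1) <= 2 * (X + Y).
  rewrite -(subrK dz (zeta - 1)); apply: (le_trans (le_normcD _ _)).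
  by have := mulr_ge0 X0 Y0; nra.
have wz : w - z0 = z0 * (zeta - 1) by rewrite wE; ring.
have nwz : normc (w - z0) <= normc z0 * (2 * (X + Y)).
  by rewrite wz Normc.normcM ler_wpM2l// normc_ge0.
have wd : normc (w - z0) < d1.
  apply: (le_lt_trans nwz).
  have p0 : 0 < normc z0 * 4 + 1 by rewrite ltr_wpDl// mulr_ge0// ltW.
  move: x2 y2; rewrite !ltr_pdivlMr//; nra.
have {}H1 := H1 _ wd.
have main : normc (k w - k z0 - L * z0 * dz) <= e * (X + Y).
  have -> : k w - k z0 - L * z0 * dz =
      (k w - k z0 - L * (w - z0)) + L * z0 * (zeta - 1 - dz).
    by rewrite wz; ring.
  apply: (le_trans (le_normcD _ _)).
  have T1 : normc (k w - k z0 - L * (w - z0)) <= e / 2 * (X + Y).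
    apply: (le_trans H1); apply: (@le_trans _ _ (e1 * (normc z0 * (2 * (X + Y))))).
      by rewrite ler_wpM2l// ltW.
    by rewrite le_eqVlt; apply/orP; left; apply/eqP; rewrite /e1; field; rewrite gt_eqF.
  have T2 : normc (L * z0 * (zeta - 1 - dz)) <= e / 2 * (X + Y).
    rewrite (Normc.normcM (L * z0)) (Normc.normcM L) -/nL; apply: (@le_trans _ _ (nL * (e2 * (X + Y)))).
      by rewrite ler_wpM2l.
    rewrite mulrA ler_wpM2r ?addr_ge0//.
    apply: (@le_trans _ _ ((nL + 1) * e2)).
      by rewrite ler_wpM2r ?(ltW e20)// lerDl.
    have p0 : 0 < nL + 1 by rewrite ltr_wpDl.
    rewrite -ler_pdivlMl// ge_min; apply/orP; right.
    by rewrite le_eqVlt; apply/orP; left; apply/eqP; field; rewrite gt_eqF.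
  by rewrite [leRHS](_ : _ = e / 2 * (X + Y) + e / 2 * (X + Y)) ?lerD//; field.
have Rd : Re (L * z0 * dz) = Re (L * z0) * (x - x0) - Im (L * z0) * (y - y0).
  by rewrite /dz; case: (L * z0).
have Id : Im (L * z0 * dz) = Im (L * z0) * (x - x0) + Re (L * z0) * (y - y0).
  by rewrite /dz; case: (L * z0) => a b /=; rewrite addrC.
split.
  apply: le_trans main; apply: le_trans (ler_Re _).
  by rewrite -Rd !raddfB.
apply: le_trans main; apply: le_trans (ler_Im _).
by rewrite -Id !raddfB.
Qed.

Definition circle_mean k (r : R) : R :=
  \int[mu]_(t in `[0, 2 * pi]) Re (k (r%:C * expi t)).

(** In the variable [log z] the annulus becomes a rectangle of height [2 pi]
    whose horizontal sides carry the same values: they cancel in the boundary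
    integral, and the vertical sides give the two means. *)
Lemma circle_mean_annulus k (r1 r2 : R) : 0 < r1 -> r1 <= r2 ->
  (forall z, r1 <= normc z <= r2 -> derivable k z 1) ->
  circle_mean k r1 = circle_mean k r2.
Proof.
move=> r10 r12 dk; have r20 := lt_le_trans r10 r12.
pose u x y := Re (k ((expR x)%:C * expi y)).
pose v x y := Im (k ((expR x)%:C * expi y)).
have pi20 : (0 : R) <= 2 * pi by rewrite mulr_ge0// pi_ge0.
have cd x y : ln r1 <= x <= ln r2 -> 0 <= y <= 2 * pi -> cdiff_at u v x y.
  move=> /andP[x1 x2] _; apply: cdiff_polar; apply: dk.
  rewrite normc_polar ?expR_ge0// -{1}(lnK r10) -(lnK r20).
  by rewrite !ler_expR x1 x2.
have l12 : ln r1 <= ln r2 by rewrite ler_ln.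
have := goursat_rectangle cd l12 pi20; rewrite /boundary_form.
rewrite (_ : Rintegral _ _ _ = 0) ?add0r; last first.
  rewrite (eq_Rintegral _ (g := fun=> 0)) ?Rintegral_cst ?mul0r// => t _.
  by rewrite /v -[2 * pi]add0r expi_2pi subrr.
have hr1 : ln r1 <= ln r1 <= ln r2 by rewrite lexx.
have hr2 : ln r1 <= ln r2 <= ln r2 by rewrite lexx andbT.
have ci x : ln r1 <= x <= ln r2 -> mu.-integrable `[0, 2 * pi] (EFin \o u x).
  move=> hx; apply: integrable_within_continuous; apply: continuous_in_subspaceT.
  move=> t; rewrite inE/= in_itv/= => ht.
  by have [_ _ ? _] := cdiff_continuous (cd _ _ hx ht).
rewrite RintegralB//; [|exact: ci..].
move/eqP; rewrite subr_eq0 => /eqP; by rewrite /u !lnK ?posrE.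
Qed.

Lemma circle_continuous k (r : R) : (forall z, normc z <= `|r| -> {for z, continuous k}) ->
  continuous (fun t : R => Re (k (r%:C * expi t))).
Proof.
move=> ck t; apply: (@continuous_comp _ _ _ (fun t => k (r%:C * expi t)) Re).
  apply: (@continuous_comp _ _ _ (fun t => r%:C * expi t : C) k).
    by apply: cvgMr; exact: continuous_expi.
  by apply: ck; rewrite Normc.normcM normc_expi mulr1 normc_real.
exact: continuous_Re.
Qed.

Lemma circle_integrable k (r : R) : (forall z, normc z <= `|r| -> {for z, continuous k}) ->
  mu.-integrable `[0, 2 * pi] (EFin \o (fun t => Re (k (r%:C * expi t)))).
Proof.
move=> ck; apply: integrable_within_continuous; apply: continuous_subspaceT.
exact: circle_continuous.
Qed.

Lemma param_integral_continuous (F : R * R -> R) (u v r : R) : u < r < v ->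
  (forall x y, u <= x <= v -> 0 <= y <= 2 * pi -> {for (x, y), continuous F}) ->
  {for r, continuous (fun x => \int[mu]_(y in `[0, 2 * pi]) F (x, y))}.
Proof.
move=> urv ctF.
pose A : set (R * R) := `[u, v] `*` `[0, 2 * pi].
have cA : compact A by apply: compact_setX; exact: segment_compact.
have cF : {within A, continuous F}.
  apply: continuous_in_subspaceT => -[x y]; rewrite inE => -[/=]; rewrite !in_itv/=.
  exact: ctF.
have /compact_bounded[M [_ HM]] := continuous_compact cF cA.
have bF x y : u <= x <= v -> 0 <= y <= 2 * pi -> `|F (x, y)| <= M + 1.
  move=> hx hy; apply: (HM (M + 1)); first by rewrite ltrDl.
  by exists (x, y) => //; split => /=; rewrite in_itv/=.
have sI x : `]u, v[%classic x -> u <= x <= v.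
  by rewrite /= in_itv/= => /andP[x1 x2]; rewrite !ltW.
have := @continuity_under_integral R _ _ mu (fun x y => F (x, y)) `[0, 2 * pi]
  (measurable_itv _) u v _ _ (fun=> M + 1) _ _ r.
apply.
- move=> x /sI hx; apply: integrable_within_continuous.
  apply: continuous_in_subspaceT => y; rewrite inE/= in_itv/= => hy.
  apply: (@continuous_comp _ _ _ (fun y => (x, y)) F); last exact: ctF.
  exact: (cvg_pair (f := fun=> x) (g := id) (cvg_cst _) cvg_id).
- apply: aeW => y; rewrite /= in_itv/= => hy x; rewrite inE => /sI hx.
  apply: (@continuous_comp _ _ _ (fun x => (x, y)) F); last exact: ctF.
  exact: (cvg_pair (f := id) (g := fun=> y) cvg_id (cvg_cst _)).
- by apply: integrable_within_continuous; apply: continuous_subspaceT => x; exact: cvg_cst.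
- move=> x /sI hx; apply: aeW => y; rewrite /= in_itv/= => hy; exact: bF.
- by rewrite inE/= in_itv/=.
Qed.

Lemma continuous_polar (x y : R) :
  {for (x, y), continuous (fun p : R * R => p.1%:C * expi p.2 : C)}.
Proof.
have h1 : {for (x, y), continuous (fun p : R * R => p.1%:C : C)}.
  by apply: cvg_ReIm => /=; [exact: cvg_fst|exact: cvg_cst].
have h2 : {for (x, y), continuous (fun p : R * R => expi p.2 : C)}.
  by apply: (@continuous_comp _ _ _ snd expi); [exact: cvg_snd|exact: continuous_expi].
exact: (cvgM h1 h2).
Qed.

Lemma circle_mean_continuous k (rho : R) : 1 < rho ->
  (forall z, normc z < rho -> {for z, continuous k}) ->
  forall r, 0 <= r <= 1 -> {for r, continuous (circle_mean k)}.
Proof.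
move=> rho1 ck r /andP[r0 r1].
pose s := (1 + rho) / 2.
have s1 : 1 < s by rewrite /s; lra.
have sr : s < rho by rewrite /s; lra.
apply: (@param_integral_continuous (fun p => Re (k (p.1%:C * expi p.2))) (- s) s).
  by apply/andP; split; lra.
move=> x y xs _.
apply: (@continuous_comp _ _ _ (fun p : R * R => k (p.1%:C * expi p.2)) Re);
  last exact: continuous_Re.
apply: (@continuous_comp _ _ _ (fun p : R * R => p.1%:C * expi p.2 : C) k);
  first exact: continuous_polar.
apply: ck; rewrite Normc.normcM normc_expi mulr1 normc_real.
by rewrite (le_lt_trans _ sr)// ler_norml.
Qed.

Lemma circle_mean0 k : circle_mean k 0 = 2 * pi * Re (k 0).
Proof.
rewrite /circle_mean (eq_Rintegral _ (g := fun=> Re (k 0))) => [|t _].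
  rewrite Rintegral_cst//= lebesgue_measure_itv/= lte_fin.
  by rewrite mulr_gt0 ?pi_gt0//= subr0 mulrC.
by rewrite mul0r.
Qed.

(** Mean value property with an exceptional point, at which the function is
    only continuous: the means over circles are constant on both sides of the
    circle through [a], and they depend continuously on the radius, down to
    radius [0]. *)
Lemma mean_value_property k (rho : R) (a : C) : 1 < rho -> normc a < 1 ->
  (forall z, normc z < rho -> {for z, continuous k}) ->
  (forall z, normc z < rho -> z != a -> derivable k z 1) ->
  circle_mean k 1 = 2 * pi * Re (k 0).
Proof.
move=> rho1 a1 ck dk; rewrite -circle_mean0.
have cm := circle_mean_continuous rho1 ck.
have a0 := normc_ge0 a.
have ext (r s : R) : 0 <= r <= 1 -> 0 <= s <= 1 ->
    (forall e, 0 < e -> exists2 t, `|r - t| < e & 0 <= t <= 1 /\ circle_mean k t = circle_mean k s) ->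
    circle_mean k r = circle_mean k s.
  move=> hr hs H; apply/eqP; rewrite -subr_eq0 -normr_le0; apply/ler_addgt0Pl => e e0.
  have /cvgrPdist_lt/(_ _ e0)/nbhs_ballP[d /= d0 Hd] := cm r hr.
  have [t rt [_ <-]] := H _ d0; rewrite addr0 ltW//; exact: Hd.
have up (r s : R) : normc a < r -> r <= s -> s <= 1 -> circle_mean k r = circle_mean k s.
  move=> ar rs s1; apply: circle_mean_annulus => //; first exact: le_lt_trans ar.
  move=> z /andP[z1 z2]; apply: dk; first by rewrite (le_lt_trans z2)// (le_lt_trans s1).
  by apply/eqP => za; move: ar; rewrite -za ltNge z1.
have dn (r s : R) : 0 < r -> r <= s -> s < normc a -> circle_mean k r = circle_mean k s.
  move=> r0 rs sa; apply: circle_mean_annulus => //.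
  move=> z /andP[z1 z2]; apply: dk.
    by rewrite (le_lt_trans z2)// (lt_trans sa)// (lt_trans a1).
  by apply/eqP => za; move: sa; rewrite -za ltNge z2.
have I0 : 0 <= normc a <= 1 by rewrite a0 ltW.
have I1 : ((0 : R) <= 1) && ((1 : R) <= 1) by rewrite ler01 lexx.
have I2 : ((0 : R) <= 0) && ((0 : R) <= 1) by rewrite lexx ler01.
have h1 : circle_mean k (normc a) = circle_mean k 1.
  apply: (ext _ _ I0 I1) => e e0.
  exists (Num.min 1 (normc a + e / 2)).
    rewrite distrC ger0_norm ?subr_ge0 ?le_min ?(ltW a1) ?lerDl ?divr_ge0 ?ltW//.
    by rewrite ltrBlDl gt_min; apply/orP; right; lra.
  have E : normc a < Num.min 1 (normc a + e / 2).
    by rewrite lt_min a1/=; lra.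
  split; last by apply: up => //; rewrite ge_min lexx.
  by rewrite ge_min lexx andbT (le_trans a0)// ltW.
rewrite -h1; have [a0'|a0'] := eqVneq (normc a) 0; first by rewrite a0'.
have {}a0 : 0 < normc a by rewrite lt0r a0'.
pose s := normc a / 2.
have s0 : 0 < s by rewrite divr_gt0.
have sa : s < normc a by rewrite /s; lra.
have s1 : s < 1 by exact: lt_trans a1.
transitivity (circle_mean k s).
  have I3 : 0 <= s <= 1 by rewrite !ltW.
  apply: (ext _ _ I0 I3) => e e0.
  exists (Num.max s (normc a - e / 2)).
    rewrite ger0_norm ?subr_ge0 ?ge_max ?(ltW sa)/=; last by lra.
    by rewrite ltrBlDr -ltrBlDl lt_max; apply/orP; right; lra.
  have E : Num.max s (normc a - e / 2) < normc a by rewrite gt_max sa/=; lra.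
  split; first by rewrite le_max (ltW s0)/= ltW// (lt_trans E).
  by apply/esym/dn => //; rewrite le_max lexx.
have I3 : 0 <= s <= 1 by rewrite !ltW.
apply/esym; apply: (ext _ _ I2 I3) => e e0.
exists (Num.min s (e / 2)).
  rewrite sub0r normrN ger0_norm ?le_min ?(ltW s0) ?divr_ge0 ?ltW//.
  by rewrite gt_min; apply/orP; right; lra.
have E : 0 < Num.min s (e / 2) by rewrite lt_min s0 divr_gt0.
split; last by apply: dn => //; rewrite ge_min lexx.
by rewrite ltW//= ge_min ltW.
Qed.

Definition poisson (a : C) (t : R) : R :=
  (1 - normc a ^+ 2) / normc (expi t - a) ^+ 2.

Lemma normcJ z : normc z^* = normc z.
Proof. by case: z => x y /=; rewrite sqrrN. Qed.

Lemma mulcJ (z : R[i]) : z * z^* = (normc z ^+ 2)%:C.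
Proof.
rewrite normc_sqr; case: z => x y /=; apply/eqP; rewrite eq_complex/=.
by rewrite mulrN opprK !expr2 eqxx/= mulrN mulrC addrC subrr.
Qed.

(** On the circle [z^* = z^-1], so that the kernel splits into a Cauchy kernel
    with pole at [a] and a part which is analytic in the disk. *)
Lemma poisson_complex (a : C) (t : R) : normc a < 1 ->
  (poisson a t)%:C = expi t / (expi t - a) + a^* * expi t / (1 - a^* * expi t) :> R[i].
Proof.
move=> a1; set z : R[i] := expi t.
have z1 : normc z = 1 by exact: normc_expi.
have z0 : z != 0 by exact: expi_neq0.
have za : z - a != 0.
  by rewrite subr_eq0; apply/eqP => za; move: a1; rewrite -za z1 ltxx.
have zJ : z^* = z^-1.
  by apply: (mulfI z0); rewrite mulcJ z1 expr1n divff.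
have az : 1 - a^* * z != 0.
  rewrite subr_eq0; apply/eqP => za'; move: a1.
  by rewrite -normcJ -[ltLHS]mulr1 -[in ltLHS]z1 -Normc.normcM -za' Normc.normc1 ltxx.
have -> : (poisson a t)%:C = (1 - a * a^*) / ((z - a) * (z - a)^*).
  by rewrite /poisson fmorph_div rmorphB rmorph1/= !mulcJ.
by rewrite rmorphB/= zJ; field; rewrite za z0 az.
Qed.

(** Three applications of the mean value property, following the decomposition
    of the kernel: to [(g z - g a) z / (z - a)], continuous at [a] and
    vanishing at the origin; to [g z a^* z / (1 - a^* z)], which also vanishes
    at the origin; and to [(g a)^* / (1 - a^* z)], whose real part on the
    circle is that of the remaining [g a z / (z - a)]. *)
Lemma poisson_formula (g : C -> C) (rho : R) (a : C) : 1 < rho -> normc a < 1 ->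
  (forall z, normc z < rho -> derivable g z 1) ->
  \int[mu]_(t in `[0, 2 * pi]) (poisson a t * Re (g (expi t))) = 2 * pi * Re (g a).
Proof.
move=> rho1 a1 dg.
have [L HL] := derivable_epsilon (dg a (lt_trans a1 rho1)).
pose k1 (z : C) : C := if z == a then a * L else (g z - g a) * z / (z - a).
have k1d (z : C) : normc z < rho -> z != a -> derivable k1 z 1.
  move=> zr za; apply: (@near_eq_derivable _ _ _ (fun z => (g z - g a) * z / (z - a))).
    have : nbhs z [set y | y != a].
      apply/nbhs_normcP; exists (normc (z - a)); first by rewrite normc_gt0 subr_eq0.
      by move=> w /=; apply: contraTN => /eqP ->; rewrite normcC ltxx.
    by apply: filterS => y /= ya; rewrite /k1 (negbTE ya).
  apply: derivableM; last first.
    apply: derivableV; first by rewrite subr_eq0.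
    by apply: derivableB; [exact: derivable_id|exact: derivable_cst].
  apply: derivableM; last exact: derivable_id.
  by apply: derivableB; [exact: dg|exact: derivable_cst].
have k1c (z : C) : normc z < rho -> {for z, continuous k1}.
  move=> zr; have [->|za] := eqVneq z a; last by apply/derivable_cts/k1d.
  have k1a : k1 a = a * L by rewrite /k1 eqxx.
  apply/(@cvg_normcP _ _ (nbhs a)); rewrite k1a => e e0.
  pose e1 := e / 4; have e10 : 0 < e1 by rewrite divr_gt0.
  have [d d0 Hd] := HL _ e10.
  have nL := normc_ge0 L; have nL1 : 0 < normc L + 1 by rewrite ltr_wpDl.
  apply/nbhs_normcP; exists (Num.min d (Num.min 1 (e1 / (normc L + 1)))).
    by rewrite !lt_min d0 ltr01 divr_gt0.
  move=> w; rewrite !lt_min => /and3P[w1 w2 w3].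
  have [->|wa] := eqVneq w a; first by rewrite k1a subrr Normc.normc0.
  have wa0 : w - a != 0 by rewrite subr_eq0.
  have -> : k1 w - a * L = w * ((g w - g a - L * (w - a)) / (w - a)) + (w - a) * L.
    by rewrite /k1 (negbTE wa); field.
  apply: (le_lt_trans (le_normcD _ _)).
  rewrite !Normc.normcM Normc.normcV.
  have h1 : normc (g w - g a - L * (w - a)) / normc (w - a) <= e1.
    by rewrite ler_pdivrMr ?normc_gt0// Hd.
  have h2 : normc w <= 2.
    by have := normc_subr w a; lra.
  have h3 : normc (w - a) * normc L <= e1.
    apply: (@le_trans _ _ (e1 / (normc L + 1) * normc L)).
      by rewrite ler_wpM2r// ltW.
    by rewrite mulrAC ler_pdivrMr// ler_wpM2l ?ltW// ltrDl.
  have h4 : normc w * (normc (g w - g a - L * (w - a)) / normc (w - a)) <= 2 * e1.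
    by rewrite ler_pM ?normc_ge0// divr_ge0 ?normc_ge0.
  by rewrite (le_lt_trans (lerD h4 h3))// /e1; lra.
have m1 := mean_value_property rho1 a1 k1c k1d.
(* A radius between [1] and the modulus of the pole of [1 / (1 - a^* z)]. *)
pose rho2 := 2 / (normc a + 1).
have a0 := normc_ge0 a.
have ap : 0 < normc a + 1 by rewrite ltr_wpDl.
have rho21 : 1 < rho2 by rewrite /rho2 ltr_pdivlMr//; lra.
have az (z : C) : normc z < rho2 -> 1 - a^* * z != 0.
  rewrite /rho2 ltr_pdivlMr// => zr; rewrite subr_eq0; apply/eqP => az.
  have : normc a * normc z = 1 by rewrite -(normcJ a) -Normc.normcM -az Normc.normc1.
  by move: (normc_ge0 z) => z0; nra.
pose k3 (z : C) : C := (g a)^* / (1 - a^* * z).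
pose k2 (z : C) : C := g z * (a^* * z) / (1 - a^* * z).
have dden (z : C) : normc z < rho2 -> derivable (fun z : C => (1 - a^* * z)^-1 : C) z 1.
  move=> zr; apply: derivableV; first exact: az.
  apply: derivableB; first exact: derivable_cst.
  by apply: derivableM; [exact: derivable_cst|exact: derivable_id].
have k3d (z : C) : normc z < rho2 -> derivable k3 z 1.
  by move=> zr; apply: derivableM; [exact: derivable_cst|exact: dden].
pose rho3 := Num.min rho rho2.
have rho31 : 1 < rho3 by rewrite lt_min rho1.
have k2d (z : C) : normc z < rho3 -> derivable k2 z 1.
  rewrite lt_min => /andP[zr zr2]; apply: derivableM; last exact: dden.
  apply: derivableM; first exact: dg.
  by apply: derivableM; [exact: derivable_cst|exact: derivable_id].
have n0 : normc (0 : C) < 1 by rewrite Normc.normc0.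
have m2 := mean_value_property rho31 n0 (fun z h => derivable_cts (k2d z h)) (fun z h _ => k2d z h).
have m3 := mean_value_property rho21 n0 (fun z h => derivable_cts (k3d z h)) (fun z h _ => k3d z h).
have circ (k : C -> C) : circle_mean k 1 = \int[mu]_(t in `[0, 2 * pi]) Re (k (expi t)).
  by apply: eq_Rintegral => t _; rewrite mul1r.
rewrite !circ in m1 m2 m3.
have ci (k : C -> C) (r : R) : 1 < r -> (forall z, normc z < r -> {for z, continuous k}) ->
    mu.-integrable `[0, 2 * pi] (EFin \o (fun t => Re (k (expi t)))).
  move=> r1 ck; have := @circle_integrable k 1.
  rewrite normr1 => H; have {}H := H (fun z h => ck z (le_lt_trans h r1)).
  by apply: eq_integrable H => // t _; rewrite /= mul1r.
have i1 := ci _ _ rho1 k1c.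
have i2 := ci _ _ rho31 (fun z h => derivable_cts (k2d z h)).
have i3 := ci _ _ rho21 (fun z h => derivable_cts (k3d z h)).
have k10 : Re (k1 0) = 0.
  by rewrite /k1; case: eqP => [<-|_]; rewrite ?mul0r// mulr0 mul0r.
have k20 : Re (k2 0) = 0 by rewrite /k2 !(mulr0, mul0r).
have k30 : Re (k3 0) = Re (g a).
  by rewrite /k3 mulr0 subr0 divr1; case: (g a).
transitivity (\int[mu]_(t in `[0, 2 * pi])
   (Re (k1 (expi t)) + (Re (k2 (expi t)) + Re (k3 (expi t))))).
  apply: eq_Rintegral => t _.
  set z : C := expi t.
  have z1 : normc z = 1 by exact: normc_expi.
  have za : z != a by apply/eqP => za; move: a1; rewrite -za z1 ltxx.
  have za0 : z - a != 0 by rewrite subr_eq0.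
  have z0 : z != 0 by exact: expi_neq0.
  have zJ : z^* = z^-1.
    by apply: (mulfI z0); rewrite mulcJ z1 expr1n divff.
  have ReJ (x : C) : Re x^* = Re x by case: x.
  have ReM (r : R) (x : C) : Re (r%:C * x) = r * Re x.
    by case: x => x y /=; rewrite mul0r subr0.
  have az0 : 1 - a^* * z != 0 by apply: az; rewrite z1.
  have -> : Re (k3 z) = Re (g a * z / (z - a)).
    have JM (x y : R[i]) : (x * y)^* = x^* * y^* by exact: rmorphM.
    have JB (x y : R[i]) : (x - y)^* = x^* - y^* by exact: rmorphB.
    have [q Eq] : exists q : R[i], q = g a * z / (z - a) by eexists.
    have E : q^* * (z - a)^* = (g a * z)^* by rewrite -JM Eq divfK.
    rewrite -Eq.
    rewrite JB zJ in E.
    have -> : k3 z = q^*; last exact: ReJ.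
    apply: (mulIf az0); rewrite /k3 divfK//.
    have -> : q^* * (1 - a^* * z) = q^* * (z^-1 - a^*) * z :> R[i] by field.
    by rewrite E JM zJ mulfVK.
  rewrite -ReM poisson_complex// -/z -!raddfD/=; congr Re.
  by rewrite /k1 (negbTE za) /k2; field; rewrite za0 az0.
have i23 : mu.-integrable `[0, 2 * pi]
    (EFin \o (fun t => Re (k2 (expi t)) + Re (k3 (expi t)))).
  by apply: (integrableD _ i2 i3).
by rewrite (RintegralD_itv i1 i23) (RintegralD_itv i2 i3) m1 m2 m3 k10 k20 k30 mulr0 !add0r.
Qed.

End MeanValue.

(** * A strictly convex function of linear growth *)

Section RealLemmas.
Context {R : realType}.
Implicit Types (x y a b : R).

(** This function is strictly convex, which turns convergence of means into
    convergence of functions, and has linear growth, so that its means are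
    controlled by those of any power [p > 1]. *)
Definition Phi x : R := Num.sqrt (1 + x ^+ 2).

Lemma Phi_sqr x : Phi x ^+ 2 = 1 + x ^+ 2.
Proof. by rewrite sqr_sqrtr// addr_ge0// sqr_ge0. Qed.

Lemma Phi_ge1 x : 1 <= Phi x.
Proof.
rewrite -(@ler_pXn2r _ 2) ?nnegrE ?sqrtr_ge0// Phi_sqr expr1n lerDl.
exact: sqr_ge0.
Qed.

Lemma Phi_gt0 x : 0 < Phi x.
Proof. exact: lt_le_trans (Phi_ge1 x). Qed.

Lemma Phi_ge0 x : 0 <= Phi x.
Proof. exact: ltW (Phi_gt0 x). Qed.

Lemma Phi_le x : Phi x <= 1 + `|x|.
Proof.
rewrite -(@ler_pXn2r _ 2) ?nnegrE ?Phi_ge0 ?addr_ge0// Phi_sqr.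
rewrite sqrrD expr1n mul1r real_normK ?num_real//.
by rewrite lerD2r lerDl mulrn_wge0.
Qed.

Lemma Phi_mul_ge x y : 1 + x * y <= Phi x * Phi y.
Proof.
have [h|h] := leP (1 + x * y) 0; first by rewrite (le_trans h)// mulr_ge0 ?Phi_ge0.
rewrite -(@ler_pXn2r _ 2) ?nnegrE ?mulr_ge0 ?Phi_ge0 ?(ltW h)//.
by rewrite exprMn !Phi_sqr; have := sqr_ge0 (x - y); nra.
Qed.

Lemma Phi_tangent x y : Phi x + x / Phi x * (y - x) <= Phi y.
Proof.
have P0 := Phi_gt0 x.
have E : Phi x * (x / Phi x) = x by rewrite mulrCA mulfV ?mulr1// gt_eqF.
rewrite -(ler_pM2l P0) mulrDr mulrA E -expr2 Phi_sqr.
by have := Phi_mul_ge x y; rewrite mulrBr; lra.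
Qed.

Lemma Phi_lipschitz x y : `|Phi x - Phi y| <= `|x - y|.
Proof.
have key a b : Phi a - Phi b <= `|a - b|.
  have h := Phi_tangent a b; rewrite lerBlDr.
  have : `|a / Phi a * (b - a)| <= `|a - b|.
    rewrite normrM distrC ler_piMl// normrM normfV (gtr0_norm (Phi_gt0 a)).
    rewrite ler_pdivrMr ?Phi_gt0// mul1r.
    rewrite -(@ler_pXn2r _ 2) ?nnegrE ?Phi_ge0// Phi_sqr real_normK ?num_real//.
    by rewrite lerDr.
  by rewrite ler_norml => /andP[]; lra.
by rewrite ler_norml key andbT lerNl opprB distrC key.
Qed.

Definition Phi_defect a b : R := Phi a + Phi b - 2 * Phi ((a + b) / 2).

Lemma Phi_defect_ge0 a b : 0 <= Phi_defect a b.
Proof.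
have := Phi_tangent ((a + b) / 2) a; have := Phi_tangent ((a + b) / 2) b.
rewrite /Phi_defect; set c := _ / Phi _; move: (Phi _) (Phi _) (Phi _) => P Q S.
by nra.
Qed.

(** Strict convexity, quantitatively. It follows from two exact identities,
    obtained by conjugation: [(A B - (1 + a b)) (A B + (1 + a b)) = (a - b)^2]
    and [(A + B - 2 M) (A + B + 2 M) = 2 (A B - (1 + a b))], where [A], [B],
    [M] are the values of [Phi] at [a], [b] and their midpoint. *)
Lemma Phi_defect_lower a b l : 0 <= l -> `|a| <= l -> `|b| <= l ->
  (a - b) ^+ 2 <= 4 * (1 + l) ^+ 3 * Phi_defect a b.
Proof.
move=> l0 al bl; rewrite /Phi_defect.
have PA := Phi_ge1 a; have PB := Phi_ge1 b; have PM := Phi_ge1 ((a + b) / 2).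
have Al : Phi a <= 1 + l by apply: (le_trans (Phi_le a)); rewrite lerD2l.
have Bl : Phi b <= 1 + l by apply: (le_trans (Phi_le b)); rewrite lerD2l.
have A2 := Phi_sqr a; have B2 := Phi_sqr b; have M2 := Phi_sqr ((a + b) / 2).
have AB := Phi_mul_ge a b.
have Mle : 2 * Phi ((a + b) / 2) <= Phi a + Phi b.
  by have := Phi_defect_ge0 a b; rewrite /Phi_defect subr_ge0.
move: A2 B2 M2; set A := Phi a in PA Al AB Mle *; set B := Phi b in PB Bl AB Mle *.
set M := Phi _ in PM Mle * => A2 B2 M2.
have E1 : (A * B - (1 + a * b)) * (A * B + (1 + a * b)) = (a - b) ^+ 2.
  have -> : (A * B - (1 + a * b)) * (A * B + (1 + a * b)) = A ^+ 2 * B ^+ 2 - (1 + a * b) ^+ 2.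
    by ring.
  by rewrite A2 B2; ring.
have E2 : (A + B - 2 * M) * (A + B + 2 * M) = 2 * (A * B - (1 + a * b)).
  have -> : (A + B - 2 * M) * (A + B + 2 * M) = A ^+ 2 + B ^+ 2 + 2 * (A * B) - 4 * M ^+ 2.
    by ring.
  by rewrite A2 B2 M2; field.
set D := A + B - 2 * M in E2 *.
have D0 : 0 <= D by rewrite subr_ge0.
have A0 : 0 <= A by lra.
have B0 : 0 <= B by lra.
have ABl : A * B <= (1 + l) ^+ 2 by rewrite expr2 ler_pM.
have S1 : A + B + 2 * M <= 4 * (1 + l) by lra.
have S2 : A * B + (1 + a * b) <= 2 * (1 + l) ^+ 2 by lra.
have q0 : 0 <= A * B - (1 + a * b) by rewrite subr_ge0.
rewrite -E1; apply: (@le_trans _ _ ((A * B - (1 + a * b)) * (2 * (1 + l) ^+ 2))).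
  by rewrite ler_wpM2l.
have q1 : A * B - (1 + a * b) <= D * (2 * (1 + l)).
  have : D * (A + B + 2 * M) <= D * (4 * (1 + l)) by rewrite ler_wpM2l.
  by rewrite E2; lra.
have L0 : 0 <= 2 * (1 + l) ^+ 2 by rewrite mulr_ge0// exprn_ge0// addr_ge0.
apply: (le_trans (ler_wpM2r L0 q1)).
by rewrite le_eqVlt; apply/orP; left; apply/eqP; ring.
Qed.

(** Bounded values are close to each other by strict convexity of [Phi];
    values beyond the level [l] are absorbed in a small multiple of their
    power [p > 1]. *)
Lemma dist_le_defect (p : R) : 1 < p -> forall e c : R, 0 < e -> 0 < c ->
  exists2 K : R, 0 <= K & forall a b,
  `|a - b| <= e + K * Phi_defect a b + c * (`|a| `^ p + `|b| `^ p).
Proof.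
move=> p1 e c e0 c0.
have p10 : 0 < p - 1 by rewrite subr_gt0.
(* The level at which [2 x = c x^p]. *)
pose l := (2 / c) `^ (p - 1)^-1.
have l0 : 0 <= l by exact: powR_ge0.
have lp : l `^ (p - 1) = 2 / c.
  by rewrite -powRrM mulVf ?gt_eqF// powRr1// divr_ge0// ltW.
have K0 : 0 <= 4 * (1 + l) ^+ 3 / e.
  by rewrite divr_ge0 ?(ltW e0)// mulr_ge0// exprn_ge0// addr_ge0.
exists (4 * (1 + l) ^+ 3 / e) => // a b.
have D0 := Phi_defect_ge0 a b.
have EK0 : 0 <= e + 4 * (1 + l) ^+ 3 / e * Phi_defect a b.
  by rewrite addr_ge0 ?(ltW e0)// mulr_ge0.
have pa0 : 0 <= `|a| `^ p by exact: powR_ge0.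
have pb0 : 0 <= `|b| `^ p by exact: powR_ge0.
have big x y : l < `|x| -> `|y| <= `|x| -> `|x - y| <= c * (`|x| `^ p + `|y| `^ p).
  move=> lx yx; apply: (@le_trans _ _ (2 * `|x|)).
    by rewrite (le_trans (ler_normB _ _))// mulr_natl mulr2n lerD2l.
  apply: (@le_trans _ _ (c * `|x| `^ p)); last first.
    by rewrite ler_wpM2l ?(ltW c0)// lerDl powR_ge0.
  have x0 : 0 < `|x| by exact: le_lt_trans lx.
  have -> : `|x| `^ p = `|x| * `|x| `^ (p - 1).
    rewrite -{1}(subrK 1 p) [LHS]powRD ?powRr1 ?(ltW x0) 1?mulrC//.
    by rewrite (gt_eqF x0) implybT.
  rewrite mulrCA mulrC ler_wpM2l ?(ltW x0)// -ler_pdivrMl// mulrC -lp.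
  by apply: ge0_ler_powR; rewrite ?nnegrE//; apply: ltW.
have [al|al] := leP `|a| l; last first.
  have [ba|ab] := leP `|b| `|a|.
    by rewrite (le_trans (big _ _ al ba))// lerDr.
  have := big _ _ (lt_trans al ab) (ltW ab); rewrite distrC [X in _ * X]addrC => h.
  by rewrite (le_trans h)// lerDr.
have [bl|bl] := leP `|b| l; last first.
  have := big _ _ bl (le_trans al (ltW bl)); rewrite distrC [X in _ * X]addrC => h.
  by rewrite (le_trans h)// lerDr.
have h := Phi_defect_lower l0 al bl.
apply: (@le_trans _ _ (e + 4 * (1 + l) ^+ 3 / e * Phi_defect a b)); last first.
  by rewrite lerDl mulr_ge0 ?(ltW c0)// addr_ge0.
have [small|large] := leP `|a - b| e.
  by rewrite (le_trans small)// lerDl mulr_ge0.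
rewrite ler_wpDl ?(ltW e0)// mulrAC ler_pdivlMr//; apply: le_trans h.
by rewrite -real_normK ?num_real// expr2 ler_wpM2l// ltW.
Qed.

Lemma continuous_normr_powR (p : R) : 0 < p -> continuous (fun x : R => `|x| `^ p).
Proof.
move=> p0 x; have [->|x0] := eqVneq x 0.
  apply/cvgrPdist_lt => e e0; rewrite normr0 powR0 ?gt_eqF//.
  have d0 : 0 < e `^ p^-1 by rewrite powR_gt0.
  apply/nbhs_ballP; exists (e `^ p^-1) => // y; rewrite /ball/= !sub0r !normrN => h.
  rewrite ger0_norm ?powR_ge0//.
  have -> : e = (e `^ p^-1) `^ p by rewrite -powRrM mulVf ?gt_eqF// powRr1// ltW.
  by apply: gt0_ltr_powR; rewrite ?nnegrE// ltW.
apply: (@continuous_comp _ _ _ (fun y : R => `|y| : R) (fun y : R => y `^ p)).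
  exact: norm_continuous.
have n0 : 0 < `|x| by rewrite normr_gt0.
have [df _] := is_derive1_powR p n0.
by apply: differentiable_continuous; apply/derivable1_diffP.
Qed.

End RealLemmas.

(** * Harmonic functions and the Poisson kernel *)

Section Tonelli.
Context {R : realType}.
Local Notation mu := (@lebesgue_measure R).

Lemma tonelli_itv (f : R * R -> \bar R) (a b c d : R) :
  measurable_fun setT f -> (forall x, 0 <= f x)%E ->
  (\int[mu]_(x in `[a, b]) \int[mu]_(y in `[c, d]) f (x, y) =
   \int[mu]_(y in `[c, d]) \int[mu]_(x in `[a, b]) f (x, y))%E.
Proof.
move=> mf f0; pose D : set (R * R) := `[a, b] `*` `[c, d].
pose g := (f \_ D)%E.
have mg : measurable_fun setT g.
  apply/(measurable_restrictT _ _).1; last exact: measurable_funTS.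
  by apply: measurableX; exact: measurable_itv.
have g0 x : (0 <= g x)%E by rewrite /g patchE; case: ifPn.
have gE x y : g (x, y) = if (x \in `[a, b]) && (y \in `[c, d]) then f (x, y) else 0%E.
  rewrite /g patchE; congr (if _ then _ else _).
  apply/idP/idP => [|/andP[h1 h2]]; last by rewrite inE.
  by rewrite inE => -[/= -> ->].
transitivity (\int[mu]_x \int[mu]_y g (x, y))%E.
  rewrite integral_mkcond; apply: eq_integral => x _; rewrite patchE mem_setE.
  case: ifPn => hx.
    rewrite integral_mkcond; apply: eq_integral => y _.
    by rewrite patchE mem_setE gE hx.
  by rewrite integral0_eq// => y _; rewrite gE (negbTE hx).
rewrite (@fubini_tonelli _ _ (measurableTypeR R) (measurableTypeR R) R mu mu g mg g0) [RHS]integral_mkcond.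
apply: eq_integral => y _; rewrite patchE mem_setE.
case: ifPn => hy.
  rewrite [RHS]integral_mkcond; apply: eq_integral => x _.
  by rewrite patchE mem_setE gE hy andbT.
by rewrite integral0_eq// => x _; rewrite gE (negbTE hy) andbF.
Qed.

(** The integral of a nonnegative function, measurable or not, is the supremum
    over the simple functions below it. *)
Lemma integral_mono (D : set R) (f1 f2 : R -> \bar R) :
  (forall x, D x -> 0 <= f1 x)%E -> (forall x, D x -> f1 x <= f2 x)%E ->
  (\int[mu]_(x in D) f1 x <= \int[mu]_(x in D) f2 x)%E.
Proof.
move=> f10 f12; rewrite !ge0_integralE//; last first.
  by move=> x Dx; apply: le_trans (f12 _ Dx); exact: f10.
apply: ge_ereal_sup => _ [h hf <-]; apply: ereal_sup_ubound; exists h => // x.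
apply: (le_trans (hf x)); rewrite !patchE; case: ifPn => //.
by rewrite inE; exact: f12.
Qed.

Lemma ae_mono (P Q : R -> Prop) : {ae mu, forall x, P x} ->
  (forall x, P x -> Q x) -> {ae mu, forall x, Q x}.
Proof.
move=> aeP PQ; apply: negligibleS aeP => x /= nQ Px; apply: nQ; exact: PQ.
Qed.

Lemma integral_Rintegral (f : R -> R) (a b : R) :
  mu.-integrable `[a, b] (EFin \o f) ->
  (\int[mu]_(t in `[a, b]) (f t)%:E = (\int[mu]_(t in `[a, b]) f t)%:E)%E.
Proof. by move=> fi; rewrite fineK//; exact: integrable_fin_num. Qed.

Lemma RintegralZl_itv (f : R -> R) (k a b : R) :
  mu.-integrable `[a, b] (EFin \o f) ->
  \int[mu]_(t in `[a, b]) (k * f t) = k * \int[mu]_(t in `[a, b]) f t.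
Proof. by move=> fi; rewrite RintegralZl. Qed.

Lemma integrable_continuous (f : R -> R) (a b : R) :
  continuous f -> mu.-integrable `[a, b] (EFin \o f).
Proof. by move=> cf; apply: integrable_within_continuous; exact: continuous_subspaceT. Qed.

End Tonelli.

Section Harmonic.
Context {R : realType}.
Local Notation C := R[i]^o.
Local Notation normc := (@Normc.normc R).
Local Notation Re := (@complex.Re R).
Local Notation Im := (@complex.Im R).
Local Notation mu := (@lebesgue_measure R).

(** Harmonicity in the form in which it is used: continuity, and the Poisson
    formula on each smaller circle. *)
Definition poisson_harmonic (u : C -> R) :=
  (forall z, disk z -> {for z, continuous u}) /\
  (forall (r : R) (a : C), 0 < r < 1 -> normc a < 1 ->
    \int[mu]_(t in `[0, 2 * pi]) (poisson a t * u (r%:C * expi t)) =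
    2 * pi * u (r%:C * a)).

(** Dilating by [r < 1] makes the function analytic beyond the closed disk. *)
Lemma poisson_harmonic_Re (g : C -> C) : analytic_disk g -> poisson_harmonic (Re \o g).
Proof.
move=> dg; split=> [z /dg/derivable_cts gz|r a /andP[r0 r1] a1].
  by apply: (@continuous_comp _ _ _ g Re) => //; exact: continuous_Re.
pose h (z : C) := g (r%:C * z).
have := @poisson_formula R h r^-1 a; apply => //.
  by rewrite invf_gt1.
move=> z zr; apply/derivable1_diffP; apply: (@differentiable_comp _ _ _ _ _ g).
  apply/derivable1_diffP; apply: derivableM; [exact: derivable_cst|exact: derivable_id].
apply/derivable1_diffP; apply: dg; rewrite /disk/= Normc.normcM normc_real.
by rewrite gtr0_norm// mulrC -ltr_pdivlMr// div1r.
Qed.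

Lemma poisson_harmonic_Im (g : C -> C) : analytic_disk g -> poisson_harmonic (Im \o g).
Proof.
move=> dg; have H : analytic_disk (fun z : C => (0 -i* 1 : C) * g z).
  by move=> z zd; apply: derivableM; [exact: derivable_cst|exact: dg].
have [h1 h2] := poisson_harmonic_Re H.
have E : Im \o g = Re \o (fun z : C => (0 -i* 1 : C) * g z).
  by apply/funext => z /=; case: (g z) => x y /=; rewrite mul0r mulN1r opprK add0r.
by rewrite E; split.
Qed.

Lemma poisson_ge0 (a : C) (t : R) : normc a < 1 -> 0 <= poisson a t.
Proof.
move=> a1; rewrite /poisson divr_ge0 ?exprn_ge0 ?normc_ge0// subr_ge0.
by rewrite -(expr1n _ 2) ler_pXn2r ?nnegrE ?normc_ge0// ltW.
Qed.

Lemma normc_expi_sub_gt0 (a : C) (t : R) : normc a < 1 -> 0 < normc (expi t - a).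
Proof.
move=> a1; rewrite normc_gt0 subr_eq0; apply/eqP => h.
by move: a1; rewrite -h normc_expi ltxx.
Qed.

Lemma continuous_poisson (a : C) : normc a < 1 -> continuous (poisson a).
Proof.
move=> a1 t; apply: cvgMr; apply: cvgV.
  by rewrite expf_eq0/= gt_eqF// normc_expi_sub_gt0.
have h : (fun t => normc (expi t - a)) x @[x --> t] --> normc (expi t - a).
  apply: (@continuous_comp _ _ _ (fun t => expi t - a : C) normc).
    by apply: cvgB; [exact: continuous_expi|exact: cvg_cst].
  exact: continuous_normc.
by rewrite expr2; apply: (cvgM h h).
Qed.

Lemma normc_expi_polar (rho s t : R) :
  normc (expi t - rho%:C * expi s) ^+ 2 = 1 + rho ^+ 2 - 2 * rho * cos (t - s).
Proof.
rewrite normc_sqr /= cosB; have := cos2Dsin2 s; have := cos2Dsin2 t.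
move: (cos s) (cos t) (sin s) (sin t) => a b c d h1 h2.
have -> : (b - (rho * a - 0 * c)) ^+ 2 + (d - (rho * c + 0 * a)) ^+ 2 =
  (b ^+ 2 + d ^+ 2) + rho ^+ 2 * (a ^+ 2 + c ^+ 2) - 2 * rho * (b * a + d * c) by ring.
by rewrite h1 h2 mulr1.
Qed.

Lemma poisson_polar (rho s t : R) : 0 <= rho ->
  poisson (rho%:C * expi s) t = (1 - rho ^+ 2) / (1 + rho ^+ 2 - 2 * rho * cos (t - s)).
Proof. by move=> r0; rewrite /poisson normc_expi_polar normc_polar. Qed.

(** The kernel depends on the difference of the arguments only; this symmetry
    makes the Poisson operator preserve integrals. *)
Lemma poisson_sym (rho s t : R) : 0 <= rho ->
  poisson (rho%:C * expi s) t = poisson (rho%:C * expi t) s.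
Proof. by move=> r0; rewrite !poisson_polar// -cosN opprB. Qed.

Lemma Rintegral_poisson (a : C) : normc a < 1 ->
  \int[mu]_(t in `[0, 2 * pi]) poisson a t = 2 * pi.
Proof.
move=> a1; have [_ /(_ (1 / 2) a)] := @poisson_harmonic_Re (cst 1) (fun z _ => derivable_cst _ _ _).
rewrite /= mulr1 => H; rewrite -[RHS]H//; last by apply/andP; split; lra.
by apply: eq_Rintegral => t _; rewrite mulr1.
Qed.

Lemma Phi_continuous : continuous (@Phi R).
Proof.
move=> x; apply/cvgrPdist_lt => e e0.
near=> y; apply: (le_lt_trans (Phi_lipschitz _ _)); near: y.
exact: (@cvgr_dist_lt _ _ _ (nbhs x) _ id).
Unshelve. all: by end_near. Qed.

Lemma continuous_Phi_comp (h : R -> R) : continuous h -> continuous (fun t => Phi (h t)).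
Proof. by move=> ch t; apply: continuous_comp; [exact: ch|exact: Phi_continuous]. Qed.

(** Jensen's inequality for the probability measure given by the Poisson
    kernel: integrate the inequality stating that [Phi] lies above its tangent
    at [k]. *)
Lemma jensen_poisson (a : C) (h : R -> R) (k : R) : normc a < 1 -> continuous h ->
  2 * pi * k = \int[mu]_(t in `[0, 2 * pi]) (poisson a t * h t) ->
  2 * pi * Phi k <= \int[mu]_(t in `[0, 2 * pi]) (poisson a t * Phi (h t)).
Proof.
move=> a1 ch kE; pose m := k / Phi k.
have cP := continuous_poisson a1.
have i1 : mu.-integrable `[0, 2 * pi] (EFin \o (fun t => (Phi k - m * k) * poisson a t)).
  by apply: integrable_continuous => t; apply: cvgMr; exact: cP.
have i2 : mu.-integrable `[0, 2 * pi] (EFin \o (fun t => poisson a t * h t)).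
  by apply: integrable_continuous => t; apply: cvgM; [exact: cP|exact: ch].
have i3 : mu.-integrable `[0, 2 * pi] (EFin \o (fun t => m * (poisson a t * h t))).
  by apply: integrable_continuous => t; apply: cvgMr; apply: cvgM; [exact: cP|exact: ch].
have -> : 2 * pi * Phi k = \int[mu]_(t in `[0, 2 * pi])
    ((Phi k - m * k) * poisson a t + m * (poisson a t * h t)).
  rewrite (RintegralD_itv i1 i3) (RintegralZl_itv _ i2) RintegralZl_itv; last first.
    exact: integrable_continuous.
  by rewrite -kE (Rintegral_poisson a1); ring.
apply: le_Rintegral => //.
- apply: integrable_continuous => t; apply: cvgD; apply: cvgMr; first exact: cP.
  by apply: cvgM; [exact: cP|exact: ch].
- apply: integrable_continuous => t; apply: cvgM; first exact: cP.
  exact: continuous_Phi_comp.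
- move=> t _; have := Phi_tangent k (h t); have := poisson_ge0 t a1; rewrite -/m.
  move: (poisson a t) (Phi (h t)) => P Q P0 hh.
  have -> : (Phi k - m * k) * P + m * (P * h t) = P * (Phi k + m * (h t - k)) by ring.
  by rewrite ler_wpM2l.
Qed.

(** Dilating a harmonic function inwards decreases the mean of [Phi]: Jensen's
    inequality pointwise, then the symmetry of the Poisson kernel and
    Tonelli's theorem. *)
Lemma Phi_mean_dilate (rho : R) (h k : R -> R) : 0 <= rho < 1 ->
  continuous h -> continuous k ->
  (forall s, 2 * pi * k s =
     \int[mu]_(t in `[0, 2 * pi]) (poisson (rho%:C * expi s) t * h t)) ->
  \int[mu]_(t in `[0, 2 * pi]) Phi (k t) <= \int[mu]_(t in `[0, 2 * pi]) Phi (h t).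
Proof.
move=> /andP[rho0 rho1] ch ck kE.
have nr s : normc (rho%:C * expi s) < 1 by rewrite normc_polar.
have pi20 : (0 : R) < 2 * pi by rewrite mulr_gt0 ?pi_gt0.
have cPk := continuous_Phi_comp ck; have cPh := continuous_Phi_comp ch.
rewrite -(ler_pM2l pi20) -lee_fin.
rewrite -!RintegralZl//; [|exact: integrable_continuous..].
rewrite -!integral_Rintegral; last 2 first.
- by apply: integrable_continuous => t; apply: cvgMr; exact: cPh.
- by apply: integrable_continuous => t; apply: cvgMr; exact: cPk.
pose f (p : R * R) := (poisson (rho%:C * expi p.1) p.2 * Phi (h p.2))%:E.
have f0 p : (0 <= f p)%E by rewrite lee_fin mulr_ge0 ?poisson_ge0 ?Phi_ge0.
have mf : measurable_fun setT f.
  apply/measurable_EFinP; apply: measurable_funM; last first.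
    apply: (@measurableT_comp _ _ _ _ _ _ (fun t => Phi (h t)) _ snd) => //.
    exact: continuous_measurable_fun.
  rewrite [X in measurable_fun _ X](_ : _ = fun p : R * R =>
      poisson (rho%:C * expi 0) (p.2 - p.1)); last first.
    by apply/funext => p; rewrite !poisson_polar// subr0.
  apply: (@measurableT_comp _ _ _ _ _ _ (poisson (rho%:C * expi 0)) _
    (fun p : R * R => p.2 - p.1)) => //; last exact: measurable_funB.
  by apply: continuous_measurable_fun; exact: continuous_poisson.
have fin1 s : (\int[mu]_(t in `[0%R, (2 * pi)%R]) f (s, t))%E =
    (\int[mu]_(t in `[0, 2 * pi]) (poisson (rho%:C * expi s) t * Phi (h t)))%:E.
  rewrite -integral_Rintegral//; apply: integrable_continuous => t; apply: cvgM.
    exact: continuous_poisson.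
  exact: cPh.
have fin2 t : (\int[mu]_(s in `[0%R, (2 * pi)%R]) f (s, t))%E = (2 * pi * Phi (h t))%:E.
  rewrite -{2}(Rintegral_poisson (nr t)) -RintegralZr//; last first.
    by apply: integrable_continuous; exact: continuous_poisson.
  rewrite -integral_Rintegral; last first.
    apply: integrable_continuous => s; apply: cvgMl; exact: continuous_poisson.
  by apply: eq_integral => s _; rewrite /f /= poisson_sym.
apply: (@le_trans _ _ (\int[mu]_(s in `[0%R, (2 * pi)%R]) \int[mu]_(t in `[0%R, (2 * pi)%R]) f (s, t))%E).
  apply: integral_mono => s _; first by rewrite lee_fin mulr_ge0 ?Phi_ge0// ltW.
  by rewrite fin1 lee_fin jensen_poisson.
by rewrite tonelli_itv//; apply: integral_mono => t _; rewrite fin2// lee_fin mulr_ge0 ?Phi_ge0// ltW.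
Qed.

End Harmonic.

(** * Harmonic functions as Poisson integrals *)

Section MeanLimit.
Context {R : realType}.
Local Notation C := R[i]^o.
Local Notation normc := (@Normc.normc R).
Local Notation mu := (@lebesgue_measure R).
Local Notation "'I' f" := (\int[mu]_(t in `[0, 2 * pi]) f t) (at level 10, f at level 9).

Lemma circ_integrable (f : R -> R) : continuous f -> mu.-integrable `[0, 2 * pi] (EFin \o f).
Proof. exact: integrable_continuous. Qed.

Lemma circ_ID (f g : R -> R) : continuous f -> continuous g ->
  I (fun t => f t + g t) = I f + I g.
Proof. by move=> cf cg; rewrite RintegralD_itv//; exact: circ_integrable. Qed.

Lemma circ_IZ (k : R) (f : R -> R) : continuous f -> I (fun t => k * f t) = k * I f.
Proof. by move=> cf; rewrite RintegralZl_itv//; exact: circ_integrable. Qed.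

Lemma circ_Icst (k : R) : I (fun=> k) = 2 * pi * k.
Proof.
rewrite Rintegral_cst//= lebesgue_measure_itv/= lte_fin.
by rewrite mulr_gt0 ?pi_gt0//= subr0 mulrC.
Qed.

Lemma circ_Ile (f g : R -> R) : continuous f -> continuous g ->
  (forall t, f t <= g t) -> I f <= I g.
Proof. by move=> cf cg fg; apply: le_Rintegral => //; exact: circ_integrable. Qed.

Lemma circ_Ieq (f g : R -> R) : f =1 g -> I f = I g.
Proof. by move=> fg; apply: eq_Rintegral => t _; exact: fg. Qed.

Variables (u : C -> R) (p M : R).
Hypothesis hu : poisson_harmonic u.
Hypothesis p1 : 1 < p.
Hypothesis uM : forall r : R, 0 < r < 1 ->
  (\int[mu]_(t in `[0%R, (2 * pi)%R]) (`|u (r%:C * expi t)| `^ p)%:E <= M%:E)%E.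

Let U (r t : R) := u (r%:C * expi t).

Lemma continuous_U (r : R) : 0 <= r < 1 -> continuous (U r).
Proof.
move=> /andP[r0 r1] t; apply: (@continuous_comp _ _ _ (fun t => r%:C * expi t : C) u).
  by apply: cvgMr; exact: continuous_expi.
by apply: hu.1; rewrite /disk/mkset normc_polar.
Qed.

Let cN (f : R -> R) : continuous f -> continuous (fun t => `|f t|).
Proof. by move=> cf t; apply: cvg_norm; exact: cf. Qed.

Let cB (f g : R -> R) : continuous f -> continuous g -> continuous (fun t => f t - g t).
Proof. by move=> cf cg t; apply: cvgB; [exact: cf|exact: cg]. Qed.

Let cD (f g : R -> R) : continuous f -> continuous g -> continuous (fun t => f t + g t).
Proof. by move=> cf cg t; apply: cvgD; [exact: cf|exact: cg]. Qed.

Let cZ k (f : R -> R) : continuous f -> continuous (fun t => k * f t).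
Proof. by move=> cf t; apply: cvgMr; exact: cf. Qed.

Let cC k : continuous (fun _ : R => k : R).
Proof. by move=> t; exact: cvg_cst. Qed.

Let cpow (f : R -> R) : continuous f -> continuous (fun t => `|f t| `^ p).
Proof.
move=> cf t; apply: (@continuous_comp _ _ _ f (fun x => `|x| `^ p)); first exact: cf.
by apply: continuous_normr_powR; exact: lt_trans p1.
Qed.

Let powU (r : R) : 0 < r < 1 -> I (fun t => `|U r t| `^ p) <= M.
Proof.
move=> hr; rewrite -lee_fin -integral_Rintegral; first exact: uM.
by apply: circ_integrable; apply: cpow; apply: continuous_U; case/andP: hr => r0 ->; rewrite ltW.
Qed.

Let m (r : R) := I (fun t => Phi (U r t)).

Lemma Phi_mean_bounded (r : R) : 0 < r < 1 -> m r <= 2 * pi * 2 + M.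
Proof.
move=> hr; have cU : continuous (U r).
  by apply: continuous_U; case/andP: hr => r0 ->; rewrite ltW.
apply: (@le_trans _ _ (I (fun t => 2 + `|U r t| `^ p))).
  apply: circ_Ile; [exact: continuous_Phi_comp|exact: cD (@cC 2) (cpow cU)|] => t.
  apply: (le_trans (Phi_le _)); rewrite -[2]/(1 + 1) -addrA lerD2l.
  have [h|h] := leP `|U r t| 1; first by rewrite (le_trans h)// lerDl powR_ge0.
  rewrite (@le_trans _ _ (`|U r t| `^ p)) ?lerDr//.
  rewrite -[leLHS]powRr1 ?normr_ge0//; apply: ler_powR; exact: ltW.
by rewrite (circ_ID (@cC 2) (cpow cU)) circ_Icst lerD2l powU.
Qed.

(** The average of two traces of large radii [r] and [s] dilates to the
    average of the traces of radii [r t0] and [s t0], which is close to the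
    trace of radius [t0]; dilation does not increase the mean of [Phi]. *)
Lemma Phi_mean_average (t0 eta : R) : 0 < t0 < 1 -> 0 < eta ->
  exists2 r0 : R, 0 < r0 < 1 & forall r s, r0 < r < 1 -> r0 < s < 1 ->
  m t0 - eta <= I (fun t => Phi (2^-1 * (U r t + U s t))).
Proof.
move=> ht0 eta0.
have /andP[t00 t01] := ht0.
have cUt : continuous (U t0) by apply: continuous_U; rewrite ltW.
(* The mean of [F (r, .)] is continuous in [r], and it vanishes for [r = 1]. *)
pose F (q : R * R) := `|u ((q.1 * t0)%:C * expi q.2) - U t0 q.2|.
pose G r := I (fun t => F (r, t)).
have ct01 : 1 < (1 + t0^-1) / 2.
  by have : 1 < t0^-1; [rewrite invf_gt1|lra].
have cG : {for 1, continuous G}.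
  apply: (@param_integral_continuous _ F 0 ((1 + t0^-1) / 2)); first by rewrite ltr01.
  move=> x y /andP[x0 x1] _; apply: cvg_norm; apply: cvgB.
    apply: (@continuous_comp _ _ _ (fun q : R * R => (q.1 * t0)%:C * expi q.2 : C) u).
      apply: (@continuous_comp _ _ _ (fun q : R * R => (q.1 * t0, q.2))
        (fun q : R * R => q.1%:C * expi q.2 : C)); last exact: continuous_polar.
      have h1 : (fun q : R * R => q.1 * t0) @ nbhs (x, y) --> x * t0.
        by apply: cvgMl; exact: cvg_fst.
      exact: (cvg_pair (f := fun q : R * R => q.1 * t0) (g := snd) h1 cvg_snd).
    apply: hu.1; rewrite /disk/mkset normc_polar ?mulr_ge0// ?ltW//.
    rewrite (le_lt_trans (ler_wpM2r (ltW t00) x1))// mulrAC ltr_pdivrMr// mul1r.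
    by rewrite mulrDl mul1r mulVf ?gt_eqF//; lra.
  by apply: (@continuous_comp _ _ _ snd (U t0)); [exact: cvg_snd|exact: cUt].
have G1 : G 1 = 0.
  rewrite /G (eq_Rintegral _ (g := fun=> 0)) ?circ_Icst ?mulr0// => t _.
  by rewrite /F /= mul1r subrr normr0.
have /cvgrPdist_lt /(_ _ eta0) /nbhs_ballP[d /= d0 Hd] := cG.
have GE r : `|1 - r| < d -> G r < eta.
  move=> /Hd; rewrite G1 sub0r normrN => /(le_lt_trans _) -> //; exact: ler_norm.
exists (Num.max (1 / 2) (1 - d)).
  by rewrite lt_max gt_max; apply/andP; split; [apply/orP; left|apply/andP; split]; lra.
move=> r s; rewrite !gt_max => /andP[/andP[r0 r1] r2] /andP[/andP[s0 s1] s2].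
have hr : 0 < r < 1 by rewrite r2 andbT; lra.
have hs : 0 < s < 1 by rewrite s2 andbT; lra.
have /andP[rp _] := hr; have /andP[sp _] := hs.
have cr : continuous (U r) by apply: continuous_U; rewrite ltW.
have cs : continuous (U s) by apply: continuous_U; rewrite ltW.
have tin q : 0 < q < 1 -> 0 <= q * t0 < 1.
  by move=> /andP[q0 q1]; rewrite mulr_ge0 ?ltW//= mulr_ilt1 ?ltW.
have crt : continuous (U (r * t0)) by apply: continuous_U; exact: tin.
have cst' : continuous (U (s * t0)) by apply: continuous_U; exact: tin.
pose h t := 2^-1 * (U r t + U s t).
pose k t := 2^-1 * (U (r * t0) t + U (s * t0) t).
have ch : continuous h by exact: cZ (cD cr cs).
have ck : continuous k by exact: cZ (cD crt cst').
have dil : I (fun t => Phi (k t)) <= I (fun t => Phi (h t)).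
  apply: (@Phi_mean_dilate R t0) => //; first by rewrite ltW.
  move=> v; have vn : normc (t0%:C * expi v) < 1 by rewrite normc_polar// ltW.
  have cP := continuous_poisson vn.
  have cPr q : continuous (U q) -> continuous (fun t => poisson (t0%:C * expi v) t * U q t).
    by move=> cq t; apply: cvgM; [exact: cP|exact: cq].
  have E q : 0 < q < 1 -> I (fun t => poisson (t0%:C * expi v) t * U q t) = 2 * pi * U (q * t0) v.
    by move=> hq; rewrite hu.2// /U rmorphM/= mulrA.
  rewrite (circ_Ieq (g := fun t => 2^-1 * (poisson (t0%:C * expi v) t * U r t +
     poisson (t0%:C * expi v) t * U s t))); last by move=> t; rewrite /h; ring.
  rewrite (circ_IZ _ (cD (cPr _ cr) (cPr _ cs))) (circ_ID (cPr _ cr) (cPr _ cs)) !E//.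
  by rewrite /k; ring.
apply: le_trans dil.
have cF q : 0 < q < 1 -> continuous (fun t => F (q, t)).
  by move=> hq; exact: (cN (cB (continuous_U (tin _ hq)) cUt)).
have : m t0 <= I (fun t => Phi (k t) + 2^-1 * (F (r, t) + F (s, t))).
  apply: circ_Ile; [exact: continuous_Phi_comp| |].
    by apply: cD; [exact: continuous_Phi_comp|exact: cZ (cD (cF _ hr) (cF _ hs))].
  move=> t; have := Phi_lipschitz (U t0 t) (k t).
  have : `|U t0 t - k t| <= 2^-1 * (F (r, t) + F (s, t)).
    have -> : U t0 t - k t = 2^-1 * ((U t0 t - U (r * t0) t) + (U t0 t - U (s * t0) t)).
      by rewrite /k; field.
    rewrite normrM ger0_norm ?invr_ge0// ler_wpM2l ?invr_ge0//.
    by apply: (le_trans (ler_normD _ _)); rewrite /F /= distrC (distrC (U t0 t)).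
  have := ler_norm (Phi (U t0 t) - Phi (k t)); lra.
rewrite (circ_ID (continuous_Phi_comp ck) (@cZ _ _ (cD (cF _ hr) (cF _ hs)))).
rewrite (circ_IZ _ (cD (cF _ hr) (cF _ hs))) (circ_ID (cF _ hr) (cF _ hs)).
have gr : G r < eta by apply: GE; rewrite ltr_norml; lra.
have gs : G s < eta by apply: GE; rewrite ltr_norml; lra.
by rewrite -/(G r) -/(G s); lra.
Qed.

(** The mean of [Phi u] increases with the radius and is bounded, so it nearly
    attains its supremum at some [t0]. Traces of radii [r] and [s] beyond
    [t0], and their average, all have a mean of [Phi] close to the supremum,
    so their defect of convexity is small in mean, and so is their distance. *)
Lemma mean_cauchy (e : R) : 0 < e -> exists2 r0 : R, 0 < r0 < 1 &
  forall r s, r0 < r < 1 -> r0 < s < 1 -> I (fun t => `|U r t - U s t|) <= e.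
Proof.
move=> e0.
have pi20 : (0 : R) < 2 * pi by rewrite mulr_gt0 ?pi_gt0.
have half01 : 0 < (1 / 2 : R) < 1 by apply/andP; split; lra.
have M0 : 0 <= M by rewrite (le_trans _ (powU half01))// Rintegral_ge0// => t _; exact: powR_ge0.
pose e1 := e / (4 * (2 * pi)); have e10 : 0 < e1 by rewrite divr_gt0// mulr_gt0.
pose c := e / (8 * (M + 1)).
have M1 : 0 < M + 1 by rewrite ltr_wpDl.
have c0 : 0 < c by rewrite divr_gt0// mulr_gt0.
have [K K0 HK] := dist_le_defect p1 e10 c0.
pose eta := e / (8 * (K + 1)).
have K1 : 0 < K + 1 by rewrite ltr_wpDl.
have eta0 : 0 < eta by rewrite divr_gt0// mulr_gt0.
pose S : set R := [set m r | r in [set r | 0 < r < 1]].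
have hS : has_sup S.
  split; first by exists (m (1 / 2)), (1 / 2).
  by exists (2 * pi * 2 + M) => _ [r /= hr <-]; exact: Phi_mean_bounded.
have [_ [t0 /= ht0 <-] Ht0] := sup_adherent eta0 hS.
have mS r : 0 < r < 1 -> m r <= sup S.
  by move=> hr; apply: (ub_le_sup hS.2); exists r.
have [r0 r001 Hr0] := Phi_mean_average ht0 eta0.
exists r0 => // r s hr hs.
have low := Hr0 _ _ hr hs.
have {}hr : 0 < r < 1 by case/andP: hr => h1 ->; have /andP[h _] := r001; rewrite (lt_trans h).
have {}hs : 0 < s < 1 by case/andP: hs => h1 ->; have /andP[h _] := r001; rewrite (lt_trans h).
have /andP[rp r2] := hr; have /andP[sp s2] := hs.
have cr : continuous (U r) by apply: continuous_U; rewrite ltW.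
have cs : continuous (U s) by apply: continuous_U; rewrite ltW.
pose h t := 2^-1 * (U r t + U s t).
have ch : continuous h by exact: cZ (cD cr cs).
pose D t := Phi_defect (U r t) (U s t).
have cPr := continuous_Phi_comp cr; have cPs := continuous_Phi_comp cs.
have cPh := continuous_Phi_comp ch.
have DE t : D t = (Phi (U r t) + Phi (U s t)) + - 2 * Phi (h t).
  by rewrite /D /Phi_defect /h [2^-1 * _]mulrC mulNr.
have cDf : continuous D.
  have -> : D = fun t => (Phi (U r t) + Phi (U s t)) + - 2 * Phi (h t) by apply/funext => t.
  exact: cD (cD cPr cPs) (@cZ _ _ cPh).
have ID : I D <= 4 * eta.
  rewrite (circ_Ieq DE).
  rewrite (circ_ID (cD cPr cPs) (@cZ _ _ cPh)) (circ_ID cPr cPs) (circ_IZ _ cPh).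
  have := mS _ hr; have := mS _ hs; rewrite /m in Ht0 low *; lra.
have cpr := cpow cr; have cps := cpow cs.
apply: (@le_trans _ _ (I (fun t => e1 + K * D t + c * (`|U r t| `^ p + `|U s t| `^ p)))).
  apply: circ_Ile; last by move=> t; exact: HK.
    exact: cN (cB cr cs).
  exact: cD (cD (@cC e1) (@cZ K _ cDf)) (@cZ c _ (cD cpr cps)).
rewrite (circ_ID (cD (@cC e1) (@cZ K _ cDf)) (@cZ c _ (cD cpr cps))).
rewrite (circ_ID (@cC e1) (@cZ K _ cDf)) circ_Icst (circ_IZ _ cDf) (circ_IZ _ (cD cpr cps)).
rewrite (circ_ID cpr cps).
have T1 : 2 * pi * e1 = e / 4.
  have E (q : R) : 0 < q -> q * (e / (4 * q)) = e / 4 by move=> q0; field; rewrite gt_eqF.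
  exact: (E _ pi20).
have T2 : K * I D <= e / 2.
  apply: (@le_trans _ _ ((K + 1) * (4 * eta))); last first.
    by rewrite le_eqVlt; apply/orP; left; apply/eqP; rewrite /eta; field; rewrite gt_eqF.
  apply: (@le_trans _ _ (K * (4 * eta))); first by rewrite ler_wpM2l.
  by rewrite ler_wpM2r ?lerDl// mulr_ge0// ltW.
have T3 : c * (I (fun t => `|U r t| `^ p) + I (fun t => `|U s t| `^ p)) <= e / 4.
  apply: (@le_trans _ _ (c * (2 * (M + 1)))); last first.
    by rewrite le_eqVlt; apply/orP; left; apply/eqP; rewrite /c; field; rewrite gt_eqF.
  rewrite ler_wpM2l ?(ltW c0)//; apply: (le_trans (lerD (powU hr) (powU hs))).
  by rewrite mulrDr mulr1 mulr_natl mulr2n lerDl.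
rewrite T1; apply: (le_trans (lerD (lerD (lexx _) T2) T3)).
by rewrite le_eqVlt; apply/orP; left; apply/eqP; field.
Qed.

(** A sequence along which the traces of [u] form an absolutely convergent
    telescoping series in mean, and hence converge almost everywhere under an
    integrable majorant. *)
Lemma radii_sequence : exists r : nat -> R, [/\ (forall n, 0 < r n < 1),
  r @ \oo --> (1 : R) &
  forall n, I (fun t => `|U (r n) t - U (r n.+1) t|) <= 1 / (2 ^ n.+1)%:R].
Proof.
have e0 n : 0 < 1 / (2 ^ n.+1)%:R :> R by rewrite divr_gt0// ltr0n expn_gt0.
pose rho n := s2val (cid2 (mean_cauchy (e0 n))).
have rho01 n : 0 < rho n < 1 by rewrite /rho; case: cid2.
have rhoP n r s : rho n < r < 1 -> rho n < s < 1 ->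
    I (fun t => `|U r t - U s t|) <= 1 / (2 ^ n.+1)%:R.
  by rewrite /rho; case: cid2 => /= x _; exact.
pose q := fix q n := if n is n'.+1 then Num.max (q n') (Num.max (rho n) (1 - n.+1%:R^-1))
  else rho 0%N.
have q01 n : 0 < q n < 1.
  elim: n => [|n /andP[IH1 IH2]] /=; first exact: rho01.
  rewrite lt_max IH1/= !gt_max IH2/=; have /andP[_ ->] := rho01 n.+1.
  by rewrite ltrBlDr ltrDl invr_gt0 ltr0n.
have qrho n : rho n <= q n by case: n => [//|n] /=; rewrite !le_max lexx orbT.
have qS n : q n <= q n.+1 by rewrite /= le_max lexx.
have q1 n : 1 - n.+2%:R^-1 <= q n.+1 by rewrite /= !le_max lexx !orbT.
pose r n := (1 + q n) / 2.
have qr n : q n < r n by have /andP[_ ?] := q01 n; rewrite /r; lra.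
have r01 n : 0 < r n < 1 by have /andP[? ?] := q01 n; rewrite /r; lra.
exists r; split => //.
  apply/cvgrPdist_lt => e e_gt0.
  have [N HN] : exists N : nat, N.+1%:R^-1 < e.
    have := near_infty_natSinv_lt (PosNum e_gt0) => /= -[N _ HN].
    by exists N; exact: (HN N (leqnn N)).
  exists N.+1 => // n /= Nn.
  have /andP[_ r1] := r01 n; rewrite ger0_norm ?subr_ge0 ?(ltW r1)//.
  case: n Nn r1 => // n Nn r1.
  apply: lt_trans HN; apply: (@lt_le_trans _ _ (n.+2%:R^-1)).
    by move: (q1 n) (qr n.+1); move: (q n.+1) (r n.+1) (n.+2%:R^-1) => x y z; lra.
  by rewrite lef_pV2 ?posrE ?ltr0n// ler_nat ltnS ltnW.
move=> n; apply: rhoP.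
  by have /andP[_ ->] := r01 n; rewrite andbT (le_lt_trans (qrho n)).
have /andP[_ ->] := r01 n.+1; rewrite andbT (le_lt_trans (qrho n))//.
by rewrite (le_lt_trans (qS n)).
Qed.

(** The traces along the above radii are dominated by the integrable function
    [G], the sum of the telescoping series of absolute values; they converge
    where [G] is finite, and dominated convergence passes to the limit in the
    Poisson formula. *)
Lemma boundary_function : exists V : C -> R,
  [/\ measurable_fun setT (fun t : R => V (expi t)),
      mu.-integrable `[0, 2 * pi] (EFin \o (fun t => V (expi t))) &
      forall a, normc a < 1 -> I (fun t => poisson a t * V (expi t)) = 2 * pi * u a].
Proof.
have [r [r01 r1 rI]] := radii_sequence.
have cU n : continuous (U (r n)).
  by apply: continuous_U; have /andP[? ->] := r01 n; rewrite ltW.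
pose d n t := `|U (r n) t - U (r n.+1) t|.
have cd n : continuous (d n) by exact: cN (cB (cU n) (cU n.+1)).
(* The majorant and the limit are defined on the plane, and not in terms of
   the angle, so that they are functions of [expi t]. *)
pose Gc (z : C) : \bar R := (`|u ((r 0%N)%:C * z)|%:E +
  \sum_(0 <= n <oo) `|u ((r n)%:C * z) - u ((r n.+1)%:C * z)|%:E)%E.
pose G t := Gc (expi t).
have d0 n t : (0 <= (d n t)%:E)%E by rewrite lee_fin normr_ge0.
have mc (f : R -> R) : continuous f -> measurable_fun setT (EFin \o f).
  by move=> cf; apply/measurable_EFinP; exact: continuous_measurable_fun.
have mS : measurable_fun setT (fun t => \sum_(0 <= n <oo) (d n t)%:E)%E.
  by apply: (@ge0_emeasurable_sum _ _ _ _ (fun n t => (d n t)%:E) xpredT) => // n _; exact: mc.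
have mG : measurable_fun setT G.
  by apply: emeasurable_funD => //; exact: (mc _ (cN (cU 0%N))).
have S0 t : (0 <= \sum_(0 <= n <oo) (d n t)%:E)%E by exact: nneseries_ge0.
have G0 t : (0 <= G t)%E by apply: adde_ge0; [rewrite lee_fin|exact: S0].
have iG : mu.-integrable `[0, 2 * pi] G.
  apply/integrableP; split; first exact: measurable_funTS.
  have -> : (\int[mu]_(x in `[0%R, (2 * pi)%R]) `|G x| =
      \int[mu]_(x in `[0%R, (2 * pi)%R]) G x)%E.
    by apply: eq_integral => t _; rewrite gee0_abs.
  rewrite ge0_integralD; last 5 first.
  - by [].
  - by move=> t _; rewrite lee_fin.
  - by apply: measurable_funTS; exact: (mc _ (cN (cU 0%N))).
  - by move=> t _; exact: S0.
  - exact: measurable_funTS.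
  apply: lte_add_pinfty.
    rewrite integral_Rintegral ?ltry//; exact: circ_integrable (cN (cU 0%N)).
  rewrite integral_nneseries//; last by move=> n; apply: measurable_funTS; exact: (mc _ (cd n)).
  apply: (@le_lt_trans _ _ 1%:E); last exact: ltry.
  have eps := @epsilon_trick0 R 1 xpredT ler01.
  apply: (le_trans _ eps); apply: lee_nneseries.
    by move=> n _ _; exact: integral_ge0.
  move=> n _; rewrite integral_Rintegral; last exact: circ_integrable (cd n).
  by rewrite lee_fin; exact: rI.
pose E : set R := [set t | (G t < +oo)%E].
have mE : measurable E.
  by have := emeasurable_fun_infty_o measurableT mG +oo%E; rewrite setTI.
pose V (z : C) : R := limn (fun n => if (Gc z < +oo)%E then u ((r n)%:C * z) else 0).
have tele t k : U (r k) t = U (r 0%N) t - \sum_(0 <= i < k) (U (r i) t - U (r i.+1) t).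
  elim: k => [|k IH]; first by rewrite big_geq// subr0.
  by rewrite big_nat_recr//= opprD addrA -IH; ring.
have dom n t : (`|U (r n) t|%:E <= G t)%E.
  apply: (@le_trans _ _ (`|U (r 0%N) t|%:E + (\sum_(0 <= i < n) d i t)%:E)%E).
    by rewrite -EFinD lee_fin tele; apply: (le_trans (ler_normB _ _)); rewrite lerD2l ler_norm_sum.
  rewrite /G /Gc leeD2l// -sumEFin; exact: nneseries_lim_ge.
have cvgV t : E t -> (fun n => U (r n) t) @ \oo --> V (expi t).
  move=> Et; have Et' : (Gc (expi t) < +oo)%E by [].
  have -> : V (expi t) = limn (fun n => U (r n) t) by rewrite /V Et'.
  pose x i := U (r i) t - U (r i.+1) t.
  suff cx : cvgn (series x).
    have : cvgn (fun n => U (r 0%N) t - series x n) by apply: is_cvgB => //; exact: is_cvg_cst.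
    by under eq_fun do rewrite /series/= -tele.
  apply: normed_cvg; apply: nondecreasing_is_cvgn.
    by apply: nondecreasing_series => n _ _; exact: normr_ge0.
  exists (fine (\sum_(0 <= n <oo) (d n t)%:E)%E) => _ [n _ <-].
  rewrite -lee_fin fineK.
    rewrite /series/= -sumEFin; exact: nneseries_lim_ge.
  rewrite ge0_fin_numE//; apply: le_lt_trans Et'; rewrite /Gc leeDr//.
have VE t : ~ E t -> V (expi t) = 0.
  move=> Et; have /negbTE Et' : ~~ (Gc (expi t) < +oo)%E by apply/negP.
  by rewrite /V; under eq_fun do rewrite Et'; exact: lim_cst.
have mV : measurable_fun setT (fun t => V (expi t)).
  apply: (@measurable_fun_cvg _ _ _ _ (fun n t => U (r n) t * \1_E t)).
    move=> n; apply: measurable_funM; last exact: measurable_indic.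
    by apply: continuous_measurable_fun.
  move=> t _; have [Et|Et] := pselect (E t).
    under eq_fun do rewrite indicE mem_set// mulr1.
    exact: cvgV.
  rewrite VE//; under eq_fun do rewrite indicE memNset// mulr0.
  exact: cvg_cst.
have aeE : {ae mu, forall t, t \in `[0%R, 2 * pi] -> E t}.
  have H (mI : measurable (`[0%R, 2 * pi] : set (measurableTypeR R))) := integrable_ae mI iG.
  have {}H := H (measurable_itv _).
  move: H.
  by apply: filterS => t H /H; rewrite ge0_fin_numE.
have DC (kap : R -> R) (K : R) : continuous kap -> (forall t, `|kap t| <= K) ->
    mu.-integrable `[0, 2 * pi] (EFin \o (fun t => kap t * V (expi t))) /\
    (\int[mu]_(t in `[0%R, (2 * pi)%R]) (kap t * U (r n) t)%:E @[n --> \oo] -->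
     \int[mu]_(t in `[0%R, (2 * pi)%R]) (kap t * V (expi t))%:E)%E.
  move=> ck kK.
  have [] := @dominated_convergence _ _ _ mu `[0, 2 * pi] (measurable_itv _)
    (fun n t => (kap t * U (r n) t)%:E) (fun t => (kap t * V (expi t))%:E)
    (fun t => K%:E * G t)%E.
  - move=> n; apply: measurable_funTS; apply: mc => t.
    by apply: cvgM; [exact: ck|exact: cU].
  - apply: measurable_funTS; apply/measurable_EFinP; apply: measurable_funM => //.
    exact: continuous_measurable_fun.
  - apply: (ae_mono aeE) => t H /H Et; apply: cvg_EFin; first exact: nearW.
    by apply: cvgMr; exact: cvgV.
  - exact: integrableZl.
  - apply: aeW => t n _; rewrite /= normrM EFinM.
    by apply: lee_pmul => //; rewrite ?lee_fin.
  by [].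
have Vint a : normc a < 1 -> exists K, forall t, `|poisson a t| <= K.
  move=> a1; exists ((1 - normc a ^+ 2) / (1 - normc a) ^+ 2) => t.
  rewrite ger0_norm ?poisson_ge0// /poisson.
  have h1 : 0 < 1 - normc a by rewrite subr_gt0.
  have h2 : 1 - normc a <= normc (expi t - a) by rewrite -(normc_expi t) normc_subr.
  apply: ler_wpM2l.
    by rewrite subr_ge0 -(expr1n _ 2) ler_pXn2r ?nnegrE ?normc_ge0// ltW.
  rewrite lef_pV2 ?posrE ?exprn_gt0// ?(lt_le_trans h1)//.
  by rewrite ler_pXn2r ?nnegrE ?normc_ge0// ltW.
exists V; split => //.
- have [+ _] := DC (fun=> 1) 1 (@cC 1) (fun t => ltac:(by rewrite normr1)).
  by apply: eq_integrable => // t _; rewrite /= mul1r.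
- move=> a a1; have [K HK] := Vint a a1.
  have [int lim1] := DC _ K (continuous_poisson a1) HK.
  have lim2 : ((2 * pi * u ((r n)%:C * a))%:E @[n --> \oo] --> (2 * pi * u a)%:E)%E.
    apply: cvg_EFin; first exact: nearW.
    have hr : (fun n => (r n)%:C * a : C) @ \oo --> (a : C).
      rewrite -[X in _ --> X]mul1r; apply: cvgMl.
      by apply: cvg_ReIm => //=; exact: cvg_cst.
    by apply: cvgMr; exact: (cvg_comp _ _ hr (hu.1 a a1)).
  have E1 : (fun n => \int[mu]_(t in `[0%R, (2 * pi)%R]) (poisson a t * U (r n) t)%:E)%E =
      fun n => (2 * pi * u ((r n)%:C * a))%:E.
    apply/funext => n; rewrite integral_Rintegral ?hu.2//.
    apply: circ_integrable => t; apply: cvgM; [exact: continuous_poisson|exact: cU].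
  rewrite E1 in lim1; rewrite integral_Rintegral// in lim1.
  apply: EFin_inj; have HH : hausdorff_space (\bar R) by exact: ereal_hausdorff.
  exact: (cvg_unique HH lim1 lim2).
Qed.

End MeanLimit.

(** * Maximal functions on trees *)

Section Trees.
Context {R : realType}.

Lemma powR_mulrB1 (x p : R) : 0 <= x -> 1 < p -> x * x `^ (p - 1) = x `^ p.
Proof.
move=> x0 p1; have [->|xn0] := eqVneq x 0.
  by rewrite mul0r powR0// gt_eqF// (lt_trans _ p1).
by rewrite -{1}[x]powRr1// -powRD ?xn0 ?implybT// addrC subrK.
Qed.

Lemma powR_conj (x p : R) : 1 < p -> (x `^ (p - 1)) `^ (p / (p - 1)) = x `^ p.
Proof.
move=> p1; rewrite -powRrM mulrC divfK// gt_eqF// subr_gt0//.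
Qed.

Lemma powR_mono (x y p : R) : 0 <= p -> 0 <= x -> x <= y -> x `^ p <= y `^ p.
Proof. by move=> p0 x0 xy; apply: ge0_ler_powR; rewrite ?nnegrE// (le_trans x0). Qed.

(** With [q = p / (p - 1)] the conjugate exponent, the function [m -> m^p - q
    m^(p-1) x] has derivative [p m^(p-2) (m - x)], so it decreases until [m =
    x]. *)
Lemma powR_doob (m x p : R) : 1 < p -> 0 <= m -> m <= x ->
  x `^ p - p / (p - 1) * x `^ (p - 1) * x <=
  m `^ p - p / (p - 1) * m `^ (p - 1) * x.
Proof.
move=> p1 m0 mx; have x0 := le_trans m0 mx.
have p0 : 0 < p by rewrite (lt_trans _ p1).
have p10 : 0 < p - 1 by rewrite subr_gt0.
have q0 : 0 < p / (p - 1) by rewrite divr_gt0.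
have conj : p^-1 + (p / (p - 1))^-1 = 1.
  by field; rewrite !gt_eqF.
have := conjugate_powR x0 (powR_ge0 m (p - 1)) p0 q0 conj.
rewrite powR_conj// -mulrA [x `^ (p - 1) * x]mulrC powR_mulrB1//.
set X := x `^ p; set Z := m `^ p; set Y := m `^ (p - 1) => yng.
have h : p * (x * Y) <= X + (p - 1) * Z.
  rewrite -(ler_pM2l p0) in yng.
  by rewrite (le_trans yng)// le_eqVlt; apply/orP; left; apply/eqP; field; rewrite ?gt_eqF.
pose k := (p - 1)^-1; have k0 : 0 <= k by rewrite invr_ge0 ltW.
have kp : p / (p - 1) = 1 + k by rewrite /k; field; rewrite gt_eqF.
have := ler_wpM2l k0 h.
have -> : k * (p * (x * Y)) = (1 + k) * (x * Y) by rewrite -kp /k; ring.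
have -> : k * (X + (p - 1) * Z) = k * X + Z by rewrite /k; field; rewrite gt_eqF.
by rewrite kp; lra.
Qed.

(** Binary trees stand for the dyadic subintervals of an interval; the leaves
    carry the intervals of the finest generation. *)
Inductive tree (A : Type) := Leaf of A | Node of tree A & tree A.

Fixpoint tsum A (phi : A -> R) (t : tree A) : R :=
  match t with Leaf a => phi a | Node l r => tsum phi l + tsum phi r end.

Fixpoint tall A (P : A -> Prop) (t : tree A) : Prop :=
  match t with Leaf a => P a | Node l r => tall P l /\ tall P r end.

(** Each leaf is labelled with the maximum of [m] and of the quotients
    [tsum phi s / tsum psi s] over the subtrees [s] that contain it: a
    martingale maximal function. *)
Fixpoint lab A (phi psi : A -> R) (m : R) (t : tree A) : tree (A * R) :=
  let m' := Num.max m (tsum phi t / tsum psi t) in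
  match t with
  | Leaf a => Leaf (a, m')
  | Node l r => Node (lab phi psi m' l) (lab phi psi m' r)
  end.

Variable A : Type.
Implicit Types (phi psi : A -> R) (t : tree A).

Lemma tsum_fst phi ph ps m t : tsum (phi \o fst) (lab ph ps m t) = tsum phi t.
Proof. by elim: t m => //= l IHl r IHr m; rewrite IHl IHr. Qed.

Lemma tall_fst (P : A -> Prop) ph ps m t : tall P t -> tall (P \o fst) (lab ph ps m t).
Proof. by elim: t m => //= l IHl r IHr m [Pl Pr]; split; [exact: IHl|exact: IHr]. Qed.

Lemma tall_lab_ge ph ps m t : tall (fun x => Num.max m (tsum ph t / tsum ps t) <= x.2) (lab ph ps m t).
Proof.
have weak B (P Q : B -> Prop) (s : tree B) : (forall b, P b -> Q b) -> tall P s -> tall Q s.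
  by move=> PQ; elim: s => /= [b|l IHl r IHr]; [exact: PQ|move=> [/IHl ? /IHr ?]].
elim: t m => [a|l IHl r IHr] m /=; first by [].
by split; [apply: weak (IHl _)|apply: weak (IHr _)] => b /=; apply: le_trans;
  rewrite le_max lexx.
Qed.

Lemma tall_weak B (P Q : B -> Prop) (s : tree B) : (forall b, P b -> Q b) ->
  tall P s -> tall Q s.
Proof.
by move=> PQ; elim: s => /= [b|l IHl r IHr]; [exact: PQ|move=> [/IHl ? /IHr ?]].
Qed.

Lemma tsumB B (f g : B -> R) s : tsum (fun b => f b - g b) s = tsum f s - tsum g s.
Proof. by elim: s => //= l -> r ->; rewrite opprD addrACA. Qed.

Lemma tall_and B (P Q : B -> Prop) (s : tree B) : tall P s -> tall Q s ->
  tall (fun b => P b /\ Q b) s.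
Proof. by elim: s => //= l IHl r IHr [? ?] [? ?]; split; [exact: IHl|exact: IHr]. Qed.

Lemma tsum_gt0 B (psi : B -> R) s : tall (fun a => 0 < psi a) s -> 0 < tsum psi s.
Proof. by elim: s => //= l IHl r IHr [? ?]; rewrite addr_gt0// ?IHl ?IHr. Qed.

Lemma tsum_ge0 B (psi : B -> R) s : tall (fun a => 0 <= psi a) s -> 0 <= tsum psi s.
Proof. by elim: s => //= l IHl r IHr [? ?]; rewrite addr_ge0// ?IHl ?IHr. Qed.

Lemma tsum_le B (f g : B -> R) s : tall (fun a => f a <= g a) s -> tsum f s <= tsum g s.
Proof. by elim: s => //= l IHl r IHr [? ?]; rewrite lerD// ?IHl ?IHr. Qed.

Lemma tsumZ B (k : R) (f : B -> R) s : tsum (fun b => k * f b) s = k * tsum f s.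
Proof. by elim: s => //= l -> r ->; rewrite mulrDr. Qed.

Lemma tsumD B (f g : B -> R) s : tsum (fun b => f b + g b) s = tsum f s + tsum g s.
Proof. by elim: s => //= l -> r ->; rewrite addrACA. Qed.

(** Doob's maximal inequality in Burkholder's form: passing from a node to its
    two halves replaces the current maximum [m] by a larger one only up to the
    present quotient, and by [powR_doob] this decreases the functional [psi
    (m^p - q m^(p-1) x)], where [x] is the quotient; the sums of [psi] and of
    [phi] over the two halves add up, which is the martingale property. *)
Lemma doob_tree (p : R) phi psi m t : 1 < p -> 0 <= m ->
  tall (fun a => 0 < psi a) t ->
  tsum (fun am => psi am.1 * am.2 `^ p - p / (p - 1) * am.2 `^ (p - 1) * phi am.1)
    (lab phi psi m t) <=
  tsum psi t * (Num.max m (tsum phi t / tsum psi t)) `^ p -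
  p / (p - 1) * (Num.max m (tsum phi t / tsum psi t)) `^ (p - 1) * tsum phi t.
Proof.
move=> p1; elim: t m => [a|l IHl r IHr] m m0; first by move=> _ /=.
move=> /= [pl pr]; set m' := Num.max m _.
have m'0 : 0 <= m' by rewrite le_max m0.
apply: (le_trans (lerD (IHl m' m'0 pl) (IHr m' m'0 pr))).
have key s : tall (fun a => 0 < psi a) s ->
    tsum psi s * (Num.max m' (tsum phi s / tsum psi s)) `^ p -
    p / (p - 1) * (Num.max m' (tsum phi s / tsum psi s)) `^ (p - 1) * tsum phi s <=
    tsum psi s * m' `^ p - p / (p - 1) * m' `^ (p - 1) * tsum phi s.
  move=> /tsum_gt0 ps.
  have [h|h] := leP (tsum phi s / tsum psi s) m'.
    by [].
  set x := _ / _ in h *.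
  have -> : tsum phi s = tsum psi s * x by rewrite mulrC divfK// gt_eqF.
  have := powR_doob p1 m'0 (ltW h); rewrite -(ler_pM2l ps) !mulrBr.
  by rewrite !(mulrCA (tsum psi s)).
apply: (le_trans (lerD (key l pl) (key r pr))).
by rewrite le_eqVlt; apply/orP; left; apply/eqP; rewrite -/m'; ring.
Qed.

(** Young's inequality with the first term kept to half a power, so that it
    can be absorbed on the left in [doob_maximal]; it is checked on the two
    sides of [m = 2 q x]. *)
Lemma powR_absorb (p q m x : R) : 1 < p -> 0 < q -> 0 <= m -> 0 <= x ->
  q * m `^ (p - 1) * x <= m `^ p / 2 + (2 * q) `^ p / 2 * x `^ p.
Proof.
move=> p1 q0 m0 x0; have p10 : 0 <= p - 1 by rewrite subr_ge0 ltW.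
have q20 : 0 <= 2 * q by rewrite mulr_ge0// ltW.
have [h|h] := leP (2 * q * x) m.
  apply: (@le_trans _ _ (m `^ p / 2)); last first.
    by rewrite lerDl mulr_ge0 ?powR_ge0// divr_ge0// powR_ge0.
  rewrite -(powR_mulrB1 m0 p1) mulrAC -mulrA [leRHS]mulrC mulrA.
  rewrite [leLHS](_ : _ = 2^-1 * (2 * q * x) * m `^ (p - 1)); last by field.
  by rewrite -mulrA ler_wpM2l ?invr_ge0// ler_wpM2r// powR_ge0.
apply: (@le_trans _ _ ((2 * q) `^ p / 2 * x `^ p)); last first.
  by rewrite lerDr divr_ge0// powR_ge0.
have e : (2 * q) `^ p / 2 * x `^ p = q * (2 * q * x) `^ (p - 1) * x.
  rewrite -(powR_mulrB1 x0 p1) -(powR_mulrB1 q20 p1) (powRM (p - 1) q20 x0).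
  by field.
rewrite e ler_wpM2r// ler_wpM2l ?(ltW q0)//; apply: powR_mono => //; exact: ltW.
Qed.

Lemma doob_maximal (p : R) phi psi t : 1 < p ->
  tall (fun a => 0 < psi a /\ 0 <= phi a) t ->
  tsum (fun am => psi am.1 * am.2 `^ p) (lab phi psi 0 t) <=
  (2 * (p / (p - 1))) `^ p * tsum (fun a => psi a * (phi a / psi a) `^ p) t.
Proof.
move=> p1 pos; set q := p / (p - 1).
have q0 : 0 < q by rewrite divr_gt0 ?subr_gt0// (lt_trans _ p1).
have pos1 : tall (fun a => 0 < psi a) t by apply: tall_weak pos => a [].
have pos2 : tall (fun a => 0 <= phi a) t by apply: tall_weak pos => a [].
have S0 := tsum_gt0 pos1; have P0 := tsum_ge0 pos2.
set T := lab phi psi 0 t; set L := tsum _ T.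
have x0 : 0 <= tsum phi t / tsum psi t by rewrite divr_ge0// ltW.
have D : L <= tsum (fun am => q * am.2 `^ (p - 1) * phi am.1) T.
  have := @doob_tree p phi psi 0 t p1 (lexx 0) pos1; rewrite /= -/T max_r//.
  rewrite tsumB -/q -/L; set x := _ / _ in x0 *.
  have -> : tsum phi t = tsum psi t * x by rewrite mulrC divfK// gt_eqF.
  have -> : tsum psi t * x `^ p - q * x `^ (p - 1) * (tsum psi t * x)
      = tsum psi t * (1 - q) * x `^ p.
    by rewrite -(powR_mulrB1 x0 p1); ring.
  have q1 : 1 <= q by rewrite /q ler_pdivlMr ?subr_gt0// mul1r gerBl.
  have h : tsum psi t * (1 - q) * x `^ p <= 0.
    by rewrite mulr_le0_ge0 ?powR_ge0// pmulr_rle0// subr_le0.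
  by move=> h2; rewrite -subr_le0; exact: le_trans h2 h.
have Y : tsum (fun am => q * am.2 `^ (p - 1) * phi am.1) T <=
    2^-1 * L + (2 * q) `^ p / 2 * tsum (fun a => psi a * (phi a / psi a) `^ p) t.
  rewrite -(tsum_fst _ phi psi 0 t) -/T -!tsumZ -tsumD; apply: tsum_le.
  have P1 := tall_fst phi psi 0 pos; have P2 := tall_lab_ge phi psi 0 t.
  apply: tall_weak (tall_and P1 P2) => -[a k] /= [[pa fa]].
  rewrite max_r// => xk; have k0 := le_trans x0 xk.
  have xa0 : 0 <= phi a / psi a by rewrite divr_ge0// ltW.
  have := powR_absorb p1 q0 k0 xa0; rewrite -(ler_pM2l pa).
  rewrite [leLHS](_ : _ = q * k `^ (p - 1) * phi a); last by field; rewrite gt_eqF.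
  by move=> /le_trans -> //; rewrite le_eqVlt; apply/orP; left; apply/eqP; field.
have := le_trans D Y; set K := tsum _ t; set Z := (2 * q) `^ p; move=> h.
have -> : Z * K = 2 * (Z / 2 * K) by field.
by move: h; set X := Z / 2 * K; lra.
Qed.

End Trees.

Section Lerner.
Context {R : realType}.
Variables (A : Type) (F W S N len : A -> R) (p Q D : R).
Hypothesis p1 : 1 < p.
Hypothesis Q0 : 0 <= Q.
Let q := p / (p - 1).
Let leaf_pos (a : A) := [/\ 0 < W a, 0 < S a, 0 < len a & 0 <= F a].

Fixpoint nodes (P : tree A -> Prop) (t : tree A) : Prop :=
  P t /\ if t is Node l r then nodes P l /\ nodes P r else True.

Let ap_node (t : tree A) :=
  tsum W t * tsum S t `^ (p - 1) <= Q * tsum len t `^ p.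

Let Y2 (a : A * R) := len a.1 * a.2 `^ (p - 1).

(** Lerner's domination of the dyadic maximal function by a composition of two
    weighted ones. On every subtree [I], writing [k] for the maximal function
    of [F] relative to [S], the [A_p] condition gives [(F_I / |I|)^(p-1) <= Q
    |I| / W_I (F_I / S_I)^(p-1)], and [F_I / S_I <= k] on all of [I] bounds
    this by [Q / W_I] times the sum of [|.| k^(p-1)] over [I]. *)
Lemma lerner_tree (t : tree A) (m k k2 : R) :
  0 <= m -> 0 <= k -> m `^ (p - 1) <= Q * k2 -> tall leaf_pos t -> nodes ap_node t ->
  tsum (fun am => W am.1 * am.2 `^ p) (lab F len m t) <=
  tsum (fun am => W am.1.1 * (Q * am.2) `^ q) (lab Y2 (W \o fst) k2 (lab F S k t)).
Proof.
move: m k k2.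
have p10 : 0 < p - 1 by rewrite subr_gt0.
have q0 : 0 <= q by rewrite divr_ge0 ?(ltW p10)// ltW// (lt_trans _ p1).
have node (s : tree A) (m k k2 : R) : 0 <= m -> 0 <= k -> m `^ (p - 1) <= Q * k2 ->
    tall leaf_pos s -> ap_node s ->
    (Num.max m (tsum F s / tsum len s)) `^ (p - 1) <=
    Q * Num.max k2 (tsum Y2 (lab F S k s) / tsum W s).
  move=> m0 k0 mk pos ap.
  have W0 : 0 < tsum W s by apply: tsum_gt0; apply: tall_weak pos => a [].
  have S0 : 0 < tsum S s by apply: tsum_gt0; apply: tall_weak pos => a [].
  have l0 : 0 < tsum len s by apply: tsum_gt0; apply: tall_weak pos => a [].
  have F0 : 0 <= tsum F s by apply: tsum_ge0; apply: tall_weak pos => a [].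
  have Ylow : tsum len s * (tsum F s / tsum S s) `^ (p - 1) <= tsum Y2 (lab F S k s).
    rewrite mulrC -(tsum_fst len F S k s) -tsumZ; apply: tsum_le.
    have P1 := tall_fst F S k pos; have P2 := tall_lab_ge F S k s.
    apply: tall_weak (tall_and P1 P2) => -[a h] /= [[_ _ la _]] hk.
    rewrite /Y2 /= mulrC ler_wpM2l ?(ltW la)//; apply: powR_mono => //; first exact: ltW.
      by rewrite divr_ge0// ltW.
    by apply: le_trans hk; rewrite le_max lexx orbT.
  have [h|h] := leP (tsum F s / tsum len s) m.
    by rewrite (le_trans mk)// ler_wpM2l// le_max lexx.
  apply: (@le_trans _ _ (Q * (tsum Y2 (lab F S k s) / tsum W s))); last first.
    by rewrite ler_wpM2l// le_max lexx orbT.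
  apply: (@le_trans _ _ (Q * (tsum len s * (tsum F s / tsum S s) `^ (p - 1) / tsum W s))); last first.
    by rewrite ler_wpM2l// ler_wpM2r// invr_ge0 ltW.
  have V (x : R) : 0 < x -> (x^-1) `^ (p - 1) = (x `^ (p - 1))^-1.
    by move=> x0; rewrite -powR_inv1 ?(ltW x0)// -powRrM mulN1r powRN.
  rewrite !powRM ?invr_ge0 ?(ltW S0) ?(ltW l0)// !V//.
  set f := tsum F s `^ (p - 1).
  have f0 : 0 <= f by exact: powR_ge0.
  have Sp : 0 < tsum S s `^ (p - 1) by exact: powR_gt0.
  have lp : 0 < tsum len s `^ (p - 1) by exact: powR_gt0.
  rewrite ler_pdivrMr//.
  move: ap; rewrite /ap_node -(powR_mulrB1 (ltW l0) p1).
  move: (tsum W s) (tsum S s `^ (p - 1)) (tsum len s) (tsum len s `^ (p - 1)) W0 Sp l0 lp.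
  move=> w sg l lq w0 sg0 l0 lq0 ap.
  rewrite [leRHS](_ : _ = f * (Q * (l * lq) / (w * sg))); last by field; rewrite !gt_eqF.
  by rewrite ler_peMr// ler_pdivlMr ?mulr_gt0// mul1r.
elim: t => [a|l IHl r IHr] m k k2 m0 k0 mk pos nd.
  have [ap _] := nd; have [Wa Sa la Fa] := pos.
  have := node (Leaf a) m k k2 m0 k0 mk pos ap => /= H.
  rewrite ler_wpM2l ?(ltW Wa)//.
  rewrite -(powR_conj _ p1); apply: powR_mono => //; exact: powR_ge0.
have [ap [ndl ndr]] := nd; have [posl posr] := pos.
have := node (Node l r) m k k2 m0 k0 mk pos ap => H.
have W0 : tsum (W \o fst) (lab F S k (Node l r)) = tsum W (Node l r) by exact: tsum_fst.
rewrite -W0 in H; rewrite /= in H *.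
apply: lerD; [apply: IHl|apply: IHr] => //; by rewrite le_max ?m0 ?k0.
Qed.

(** The maximal theorem with an [A_p] weight: by [lerner_tree] it reduces to
    two applications of Doob's inequality, with the measure [W] and the
    exponent [q], then with the measure [S] and the exponent [p]; their
    constants do not depend on the weights. The hypotheses on the leaves are
    Hoelder's inequality, up to the factor [D]. *)
Lemma lerner_discrete (t : tree A) : 0 <= D -> tall leaf_pos t -> nodes ap_node t ->
  tall (fun a => [/\ 0 <= N a, len a `^ p <= D * W a * S a `^ (p - 1) &
    F a `^ p <= D * N a * S a `^ (p - 1)]) t ->
  tsum (fun am => W am.1 * am.2 `^ p) (lab F len 0 t) <=
  Q `^ q * ((2 * (q / (q - 1))) `^ q * (D `^ (q - 1) * ((2 * q) `^ p * (D * tsum N t)))).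
Proof.
move=> D0 pos nd hyp.
have p10 : 0 < p - 1 by rewrite subr_gt0.
have p0 : 0 < p by rewrite (lt_trans _ p1).
have q0 : 0 <= q by rewrite divr_ge0 ?(ltW p10)// ltW.
have q1 : 1 < q by rewrite /q ltr_pdivlMr// mul1r gtrBl.
have qE : q - 1 = (p - 1)^-1 by rewrite /q; field; rewrite gt_eqF.
have z : 0 `^ (p - 1) <= Q * 0 by rewrite mulr0 powR0// gt_eqF.
apply: (le_trans (lerner_tree (lexx 0) (lexx 0) z pos nd)).
set t1 := lab F S 0 t.
have pos1 : tall (fun a => [/\ leaf_pos a.1, 0 <= a.2 &
    [/\ 0 <= N a.1, len a.1 `^ p <= D * W a.1 * S a.1 `^ (p - 1) &
     F a.1 `^ p <= D * N a.1 * S a.1 `^ (p - 1)]]) t1.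
  have P1 := tall_fst F S 0 pos; have P2 := tall_lab_ge F S 0 t.
  have P3 := tall_fst F S 0 hyp.
  apply: tall_weak (tall_and (tall_and P1 P2) P3) => -[a h] [[h1 h2] h3]; split => //.
  by apply: le_trans h2; rewrite le_max lexx.
have E1 : tsum (fun am => W am.1.1 * (Q * am.2) `^ q) (lab Y2 (W \o fst) 0 t1) <=
    Q `^ q * tsum (fun am => (W \o fst) am.1 * am.2 `^ q) (lab Y2 (W \o fst) 0 t1).
  rewrite -tsumZ; apply: tsum_le.
  apply: tall_weak (tall_lab_ge Y2 (W \o fst) 0 t1) => -[a h] /=.
  rewrite ge_max => /andP[h0 _]; rewrite powRM//.
  by rewrite le_eqVlt; apply/orP; left; apply/eqP; ring.
apply: (le_trans E1); rewrite ler_wpM2l ?powR_ge0//.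
have posW : tall (fun a => 0 < (W \o fst) a /\ 0 <= Y2 a) t1.
  apply: tall_weak pos1 => -[a h] /= [[Wa Sa la Fa] h0 _]; split => //.
  by rewrite /Y2 mulr_ge0 ?powR_ge0// ltW.
apply: (le_trans (doob_maximal q1 posW)); rewrite ler_wpM2l ?powR_ge0//.
have V (x r : R) : 0 < x -> (x^-1) `^ r = (x `^ r)^-1.
  by move=> x0; rewrite -powR_inv1 ?(ltW x0)// -powRrM mulN1r powRN.
have E2 : tsum (fun a => (W \o fst) a * (Y2 a / (W \o fst) a) `^ q) t1 <=
    D `^ (q - 1) * tsum (fun a => S a.1 * a.2 `^ p) t1.
  rewrite -tsumZ; apply: tsum_le; apply: tall_weak pos1 => -[a h] /=.
  move=> [[Wa Sa la Fa] h0 [Na ha _]].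
  have hp0 : 0 <= h `^ (p - 1) by exact: powR_ge0.
  rewrite /Y2 /= !powRM ?invr_ge0 ?mulr_ge0 ?(ltW la) ?(ltW Wa)// powR_conj// V//.
  have lq : len a `^ q <= D `^ (q - 1) * W a `^ (q - 1) * S a.
    have -> : len a `^ q = (len a `^ p) `^ (p - 1)^-1 by rewrite -powRrM.
    have e : S a = (S a `^ (p - 1)) `^ (p - 1)^-1.
      by rewrite -powRrM divff ?powRr1 ?(ltW Sa)// gt_eqF.
    rewrite qE [in leRHS]e -!powRM ?mulr_ge0 ?powR_ge0 ?(ltW Wa)//.
    by apply: powR_mono => //; rewrite ?invr_ge0 ?powR_ge0// ltW.
  have Wq : 0 < W a `^ (q - 1) by exact: powR_gt0.
  rewrite -(powR_mulrB1 (ltW Wa) q1).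
  rewrite [leLHS](_ : _ = len a `^ q / W a `^ (q - 1) * h `^ p); last first.
    by field; rewrite !gt_eqF.
  rewrite mulrA ler_wpM2r ?powR_ge0// ler_pdivrMr// (le_trans lq)//.
  by rewrite le_eqVlt; apply/orP; left; apply/eqP; ring.
apply: (le_trans E2); rewrite ler_wpM2l ?powR_ge0//.
have posS : tall (fun a => 0 < S a /\ 0 <= F a) t by apply: tall_weak pos => a [].
apply: (le_trans (doob_maximal p1 posS)); rewrite -/q ler_wpM2l ?powR_ge0//.
rewrite -tsumZ; apply: tsum_le; apply: tall_weak (tall_and pos hyp) => a.
move=> [[Wa Sa la Fa] [Na _ hF]].
rewrite powRM ?invr_ge0 ?(ltW Sa)// V//.
have Sp : 0 < S a `^ (p - 1) by exact: powR_gt0.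
rewrite -(powR_mulrB1 (ltW Sa) p1).
rewrite [leLHS](_ : _ = F a `^ p / S a `^ (p - 1)); last by field; rewrite !gt_eqF.
by rewrite ler_pdivrMr.
Qed.

End Lerner.

(** * The dyadic maximal theorem with weights *)

Section Dyadic.
Context {R : realType}.
Local Notation mu := (@lebesgue_measure R).
Implicit Types (f g : R -> \bar R).

Definition ival (g : R -> \bar R) (I : R * R) : R :=
  fine (\int[mu]_(t in `[I.1, I.2[) g t)%E.

Definition len (I : R * R) : R := I.2 - I.1.

Lemma itv_co_split (g : R -> \bar R) (x y z : R) : x <= y <= z ->
  measurable_fun setT g -> (forall t, 0 <= g t)%E ->
  (\int[mu]_(t in `[x, z[) g t =
   \int[mu]_(t in `[x, y[) g t + \int[mu]_(t in `[y, z[) g t)%E.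
Proof.
move=> /andP[xy yz] mg g0.
rewrite (@itv_bndbnd_setU _ _ (BLeft x) (BLeft y) (BLeft z)) ?bnd_simp//.
rewrite ge0_integral_setU//.
- by rewrite -itv_bndbnd_setU ?bnd_simp//; exact: measurable_funTS.
- apply/disj_setPS => t [/=]; rewrite !in_itv/= => /andP[_ h1] /andP[h2 _].
  by move: h1; rewrite ltNge h2.
Qed.

Lemma itv_co_sub (g : R -> \bar R) (x x' y' y : R) : x <= x' -> y' <= y ->
  measurable_fun setT g -> (forall t, 0 <= g t)%E ->
  (\int[mu]_(t in `[x', y'[) g t <= \int[mu]_(t in `[x, y[) g t)%E.
Proof.
move=> xx' y'y mg g0; apply: ge0_subset_integral => //; first exact: measurable_funTS.
by apply: subset_itv; rewrite bnd_simp.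
Qed.

Lemma ivalE (g : R -> \bar R) (a b x y : R) : a <= x -> y <= b ->
  measurable_fun setT g -> (forall t, 0 <= g t)%E ->
  (\int[mu]_(t in `[a, b[) g t < +oo)%E ->
  (\int[mu]_(t in `[x, y[) g t = (ival g (x, y))%:E)%E.
Proof.
move=> ax yb mg g0 gi; rewrite fineK// ge0_fin_numE; last exact: integral_ge0.
exact: le_lt_trans (itv_co_sub ax yb mg g0) gi.
Qed.

Lemma ival_split (g : R -> \bar R) (a b x y z : R) : a <= x -> x <= y -> y <= z -> z <= b ->
  measurable_fun setT g -> (forall t, 0 <= g t)%E ->
  (\int[mu]_(t in `[a, b[) g t < +oo)%E ->
  ival g (x, z) = ival g (x, y) + ival g (y, z).
Proof.
move=> ax xy yz zb mg g0 gi; apply: EFin_inj; rewrite EFinD.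
rewrite -!(ivalE (a := a) (b := b))//; last 2 first.
- exact: le_trans ax xy.
- exact: le_trans yz zb.
by rewrite (@itv_co_split _ x y z)// xy.
Qed.

Lemma ival_ge0 (g : R -> \bar R) I : (forall t, 0 <= g t)%E -> 0 <= ival g I.
Proof. by move=> g0; apply: fine_ge0; exact: integral_ge0. Qed.

Fixpoint dtree (n : nat) (x y : R) : tree (R * R) :=
  if n is n'.+1 then
    Node (dtree n' x ((x + y) / 2)) (dtree n' ((x + y) / 2) y)
  else Leaf (x, y).

(** Maximum of [m] and of the averages of [phi] over the dyadic subintervals
    of [x, y[ of depth at most [n] that contain [t]; the accumulator [m] makes
    the recursion follow that of [lab]. *)
Fixpoint dmax (phi : R * R -> R) (n : nat) (x y m t : R) : R :=
  let m' := Num.max m (phi (x, y) / len (x, y)) in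
  if n is n'.+1 then
    if t < (x + y) / 2 then dmax phi n' x ((x + y) / 2) m' t
    else dmax phi n' ((x + y) / 2) y m' t
  else m'.

Lemma dmax_ge phi n x y m t : m <= dmax phi n x y m t.
Proof.
elim: n x y m => [|n IH] x y m /=; first by rewrite le_max lexx.
by case: ifP => _; apply: le_trans (IH _ _ _); rewrite le_max lexx.
Qed.

Lemma dmax_leS phi n x y m t : dmax phi n x y m t <= dmax phi n.+1 x y m t.
Proof.
elim: n x y m => [|n IH] x y m.
  by rewrite /=; case: ifP => _; rewrite le_max lexx.
by rewrite [leLHS]/= [leRHS]/=; case: ifP => _; exact: IH.
Qed.

Lemma dmax_le phi n k x y m t : (n <= k)%N -> dmax phi n x y m t <= dmax phi k x y m t.
Proof.
move=> /subnK <-; elim: (k - n)%N => [//|j IH].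
by rewrite addSn (le_trans IH)// dmax_leS.
Qed.

Lemma measurable_dmax phi n x y m : measurable_fun setT (dmax phi n x y m).
Proof.
elim: n x y m => [|n IH] x y m /=; first exact: measurable_cst.
by apply: measurable_fun_ifT => //; exact: measurable_fun_ltr.
Qed.

(** The hypothesis on [t] says that it lies in the [j]-th of the [2 ^ n]
    intervals of depth [n]. *)
Lemma dmax_average phi n x y m t (j : nat) : (j < 2 ^ n)%N ->
  x + j%:R * ((y - x) / 2 ^+ n) <= t < x + j.+1%:R * ((y - x) / 2 ^+ n) ->
  x < y ->
  phi (x + j%:R * ((y - x) / 2 ^+ n), x + j.+1%:R * ((y - x) / 2 ^+ n)) / ((y - x) / 2 ^+ n) <=
  dmax phi n x y m t.
Proof.
elim: n x y m j => [|n IH] x y m j.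
  rewrite expn0 ltnS leqn0 => /eqP -> _ xy.
  by rewrite expr0 divr1 mul0r addr0 mul1r addrC subrK /= le_max lexx orbT.
have p2 : (0 : R) < 2 ^+ n by rewrite exprn_gt0.
rewrite expnS => jn tj xy; set c := (x + y) / 2.
have h : (y - x) / 2 ^+ n.+1 = (c - x) / 2 ^+ n by rewrite exprS /c; field; rewrite gt_eqF.
have h' : (y - x) / 2 ^+ n.+1 = (y - c) / 2 ^+ n by rewrite exprS /c; field; rewrite gt_eqF.
have xc : x < c by rewrite /c; lra.
have cy : c < y by rewrite /c; lra.
have d0 : 0 < (c - x) / 2 ^+ n by rewrite divr_gt0// subr_gt0.
have cE : x + (2 ^ n)%:R * ((c - x) / 2 ^+ n) = c.
  by rewrite natrX mulrCA mulfV ?gt_eqF// mulr1 addrC subrK.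
move: tj => /andP[t1 t2]; rewrite /= -/c.
have [jlt|jge] := ltnP j (2 ^ n).
  have tc : t < c.
    rewrite (lt_le_trans t2)// h -[leRHS]cE lerD2l ler_wpM2r ?(ltW d0)//.
    by rewrite ler_nat.
  by rewrite tc h; apply: IH => //; rewrite -h t1 t2.
have tc : ~~ (t < c).
  rewrite -leNgt (le_trans _ t1)// h -[leLHS]cE lerD2l ler_wpM2r ?(ltW d0)//.
  by rewrite ler_nat.
rewrite (negbTE tc) h'.
have e (i : nat) : (2 ^ n <= i)%N ->
    x + i%:R * ((y - c) / 2 ^+ n) = c + (i - 2 ^ n)%:R * ((y - c) / 2 ^+ n).
  have DD : (y - c) / 2 ^+ n = (c - x) / 2 ^+ n by rewrite -h' h.
  by move=> hi; rewrite DD natrB// mulrBl -[X in _ = X + _]cE; ring.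
rewrite !e// ?(leq_trans jge)// subSn//; apply: IH => //.
  by rewrite ltn_subLR// addnn -mul2n.
by rewrite -subSn// -!e ?(leq_trans jge)// -h' t1 t2.
Qed.

Lemma powR_eq_inj (p x y : R) : 0 < p -> 0 <= x -> 0 <= y -> x `^ p = y `^ p -> x = y.
Proof.
move=> p0 x0 y0 e.
by rewrite -[LHS](powRr1 x0) -[RHS](powRr1 y0) -(@mulfV _ p) ?gt_eqF// !powRrM e.
Qed.

Section Maximal.
Variables (a b : R) (f w : R -> R) (sg : R -> \bar R) (p Q : R).
Hypothesis ab : a < b.
Hypothesis p1 : 1 < p.
Hypothesis Q0 : 0 <= Q.
Hypothesis mf : measurable_fun setT f.
Hypothesis mw : measurable_fun setT w.
Hypothesis msg : measurable_fun setT sg.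
Hypothesis f0 : forall t, 0 <= f t.
Hypothesis w0 : forall t, 0 <= w t.
Hypothesis sgE : forall t, sg t =
  if w t == 0 then +oo%E else (w t `^ (- (p - 1)^-1))%:E.
Hypothesis fi : (\int[mu]_(t in `[a, b[) (f t)%:E < +oo)%E.
Hypothesis wi : (\int[mu]_(t in `[a, b[) (w t)%:E < +oo)%E.
Hypothesis sgi : (\int[mu]_(t in `[a, b[) sg t < +oo)%E.
Hypothesis fwi : (\int[mu]_(t in `[a, b[) (f t `^ p * w t)%:E < +oo)%E.
Hypothesis wpos : forall x y, a <= x -> x < y -> y <= b ->
  0 < ival (EFin \o w) (x, y).
Hypothesis Ap : forall x y, a <= x -> x < y -> y <= b ->
  ival (EFin \o w) (x, y) * ival sg (x, y) `^ (p - 1) <= Q * (y - x) `^ p.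

Let sg0 t : (0 <= sg t)%E.
Proof. by rewrite sgE; case: ifP => // _; rewrite lee_fin powR_ge0. Qed.

Let F := ival (EFin \o f).
Let W := ival (EFin \o w).
Let S := ival sg.
Let N := ival (fun t => (f t `^ p * w t)%:E).

Let EFin_ge0 (h : R -> R) : (forall t, 0 <= h t) -> forall t, (0 <= (EFin \o h) t)%E.
Proof. by move=> h0 t; rewrite lee_fin. Qed.

Let mEf : measurable_fun setT (EFin \o f). Proof. exact/measurable_EFinP. Qed.
Let mEw : measurable_fun setT (EFin \o w). Proof. exact/measurable_EFinP. Qed.

Lemma measurable_powR_comp (h : R -> R) (r : R) : measurable_fun setT h ->
  measurable_fun setT (fun t => h t `^ r).
Proof.
by move=> mh; apply: (@measurableT_comp _ _ _ _ _ _ (fun x => x `^ r) _ h) => //; exact: measurable_powR.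
Qed.

(** Hoelder's inequality in its optimized additive form: the two terms on the
    right are equal for [k = (Z / Y)^((p - 1) / p)], at the cost of a factor
    [2^p]. *)
Lemma optimize_holder (X Y Z : R) : 0 <= X -> 0 <= Y -> 0 < Z ->
  (forall k, 0 < k -> X <= k * Y + k `^ (- (p - 1)^-1) * Z) ->
  X `^ p <= 2 `^ p * Y * Z `^ (p - 1).
Proof.
move=> X0 Y0 Z0 H.
have p0 : 0 < p by rewrite (lt_trans _ p1).
have p10 : 0 < p - 1 by rewrite subr_gt0.
have [Yp|] := ltP 0 Y; last first.
  rewrite le_eqVlt ltNge Y0 orbF => /eqP Y00.
  suff -> : X = 0 by rewrite powR0 ?gt_eqF// !mulr_ge0 ?powR_ge0.
  apply/eqP; rewrite eq_le X0 andbT leNgt; apply/negP => Xp.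
  (* If [Y] vanishes, letting [k] grow gives [X = 0]; the chosen [k] makes the
     right-hand side [X / 2]. *)
  have k0 : 0 < (2 * Z / X) `^ (p - 1) by rewrite powR_gt0// divr_gt0// mulr_gt0.
  have := H _ k0; rewrite Y00 mulr0 add0r -powRrM mulrN mulfV ?gt_eqF//.
  rewrite powR_inv1 ?divr_ge0 ?mulr_ge0 ?(ltW Z0)//.
  by rewrite (_ : _ * Z = X / 2); [lra|field; rewrite !gt_eqF].
have V (x r : R) : 0 < x -> (x^-1) `^ r = (x `^ r)^-1.
  by move=> x0; rewrite -powR_inv1 ?(ltW x0)// -powRrM mulN1r powRN.
pose k := (Z / Y) `^ ((p - 1) / p).
have ZY : 0 < Z / Y by rewrite divr_gt0.
have k0 : 0 < k by rewrite powR_gt0.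
have kY : (k * Y) `^ p = Y * Z `^ (p - 1).
  rewrite powRM ?(ltW k0)// -powRrM divfK ?gt_eqF// powRM ?invr_ge0 ?(ltW Z0)// V//.
  rewrite -(powR_mulrB1 Y0 p1); field; by rewrite gt_eqF// powR_gt0.
have kZ : (k `^ (- (p - 1)^-1) * Z) `^ p = Y * Z `^ (p - 1).
  rewrite powRM ?powR_ge0 ?(ltW Z0)// -!powRrM.
  have -> : (p - 1) / p * (- (p - 1)^-1 * p) = -1 by field; rewrite !gt_eqF.
  rewrite powR_inv1 ?(ltW ZY)// -(powR_mulrB1 (ltW Z0) p1); field.
  by rewrite !gt_eqF.
have eq : k `^ (- (p - 1)^-1) * Z = k * Y.
  apply: (powR_eq_inj p0).
  - exact: mulr_ge0 (powR_ge0 _ _) (ltW Z0).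
  - exact: mulr_ge0 (ltW k0) Y0.
  - exact: etrans kZ (esym kY).
have := H _ k0; rewrite eq => h; have {h} : X <= 2 * (k * Y) by lra.
move=> h; apply: (le_trans (powR_mono (ltW p0) X0 h)).
by rewrite powRM ?(mulr_ge0 (ltW k0) Y0)// kY mulrA.
Qed.

(** Hoelder's inequality between the weight and its dual: pointwise, [h <= k
    h^p w + (k w)^(- 1 / (p - 1))], since the first term is at least [h] as
    soon as [h] exceeds the second. *)
Lemma holder_ival (h : R -> R) x y : measurable_fun setT h -> (forall t, 0 <= h t) ->
  a <= x -> x < y -> y <= b -> 0 < S (x, y) ->
  (\int[mu]_(t in `[a, b[) (h t)%:E < +oo)%E ->
  (\int[mu]_(t in `[a, b[) (h t `^ p * w t)%:E < +oo)%E ->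
  ival (EFin \o h) (x, y) `^ p <=
  2 `^ p * ival (fun t => (h t `^ p * w t)%:E) (x, y) * S (x, y) `^ (p - 1).
Proof.
move=> mh h0 ax xy yb Sp hi hwi.
have p10 : 0 < p - 1 by rewrite subr_gt0.
have mEh : measurable_fun setT (EFin \o h) by exact/measurable_EFinP.
have mhw : measurable_fun setT (fun t => (h t `^ p * w t)%:E).
  by apply/measurable_EFinP; apply: measurable_funM => //; exact: measurable_powR_comp.
have hw0 t : (0 <= (h t `^ p * w t)%:E)%E by rewrite lee_fin mulr_ge0 ?powR_ge0.
apply: optimize_holder => //; [exact/ival_ge0/EFin_ge0|exact: ival_ge0|].
move=> k k0; rewrite -lee_fin EFinD !EFinM.
rewrite -(ivalE ax yb mEh (EFin_ge0 h0) hi) -(ivalE ax yb mhw hw0 hwi) -(ivalE ax yb msg sg0 sgi).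
have kk0 : 0 <= k `^ (- (p - 1)^-1) by exact: powR_ge0.
rewrite -!ge0_integralZl_EFin//; try (by rewrite ltW); try exact: measurable_funTS.
rewrite -ge0_integralD//; last 4 first.
- by move=> t _; rewrite mule_ge0// lee_fin ltW.
- by apply: measurable_funTS; apply: measurable_funeM.
- by move=> t _; rewrite mule_ge0.
- by apply: measurable_funTS; apply: measurable_funeM.
apply: integral_mono => t _; first by rewrite lee_fin.
rewrite /= sgE; have [w00|wn0] := eqVneq (w t) 0.
  rewrite gt0_muley ?lte_fin ?powR_gt0// addey ?leey//.
have wp : 0 < w t by rewrite lt0r wn0 w0.
rewrite -!EFinM -EFinD lee_fin -powRM ?(ltW k0) ?(ltW wp)//.
set z := (k * w t) `^ _.
have kw : 0 < k * w t by rewrite mulr_gt0.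
have z0 : 0 < z by rewrite powR_gt0.
have [hz|zh] := leP (h t) z.
  by rewrite (le_trans hz)// lerDr mulr_ge0 ?(ltW k0)// mulr_ge0 ?powR_ge0.
apply: (@le_trans _ _ (k * (h t `^ p * w t))); last by rewrite lerDl ltW.
have zp : 1 = z `^ (p - 1) * (k * w t).
  by rewrite /z -powRrM mulNr mulVf ?gt_eqF// powR_inv1 ?(ltW kw)// mulVf// gt_eqF.
rewrite -(powR_mulrB1 (h0 t) p1) -[leLHS]mulr1.
have -> : k * (h t * h t `^ (p - 1) * w t) = h t * (h t `^ (p - 1) * (k * w t)) by ring.
rewrite ler_wpM2l// [leLHS]zp ler_wpM2r ?(ltW kw)//.
by apply: powR_mono; exact: ltW.
Qed.

Let Spos x y : a <= x -> x < y -> y <= b -> 0 < S (x, y).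
Proof.
move=> ax xy yb; rewrite lt0r ival_ge0// andbT; apply/eqP => S00.
have : ae_eq mu [set` `[x, y[] sg (cst 0%E).
  apply/ae_eq_integral_abs => //; first exact: measurable_funTS.
  have -> : (\int[mu]_(t in `[x, y[) `|sg t| = \int[mu]_(t in `[x, y[) sg t)%E.
    by apply: eq_integral => t _; rewrite gee0_abs.
  by rewrite (ivalE ax yb msg sg0 sgi) -/S S00.
move=> [A [mA A0 sub]].
have : (mu `[x, y[ <= mu A)%E.
  apply: le_measure; rewrite ?inE// => t xt; apply: sub => /= H.
  have := H xt; rewrite sgE; case: eqP => // w00 [/eqP].
  by rewrite powR_eq0; move/eqP: w00 => /negbTE ->.
rewrite A0 lebesgue_measure_itv/= lte_fin xy -EFinD lee_fin.
by rewrite leNgt subr_gt0 xy.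
Qed.

Let lenW x y : a <= x -> x < y -> y <= b ->
  (y - x) `^ p <= 2 `^ p * W (x, y) * S (x, y) `^ (p - 1).
Proof.
move=> ax xy yb.
have e1 : ival (EFin \o (fun=> 1 : R)) (x, y) = y - x.
  rewrite /ival/= integral_cst//= mul1e lebesgue_measure_itv/= lte_fin xy.
  by [].
have i1 : (\int[mu]_(t in `[a, b[) (1 : R)%:E < +oo)%E.
  by rewrite integral_cst//= mul1e lebesgue_measure_itv/= lte_fin ab -EFinD ltry.
have ew : (fun t => ((1 : R) `^ p * w t)%:E) = EFin \o w.
  by apply/funext => t /=; rewrite powR1 mul1r.
have := @holder_ival (fun=> 1) x y (measurable_cst _) (fun=> ler01) ax xy yb (Spos ax xy yb) i1.
by rewrite e1 ew; exact.
Qed.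

Let add_tsum (g : R -> \bar R) n x y : a <= x -> x < y -> y <= b ->
  measurable_fun setT g -> (forall t, 0 <= g t)%E ->
  (\int[mu]_(t in `[a, b[) g t < +oo)%E ->
  tsum (ival g) (dtree n x y) = ival g (x, y).
Proof.
move=> ax xy yb mg g0 gi; elim: n x y ax xy yb => [//|n IH] x y ax xy yb /=.
rewrite !IH; try lra.
by rewrite -(@ival_split g a b)//; lra.
Qed.

Let len_tsum n x y : tsum len (dtree n x y) = len (x, y).
Proof. by elim: n x y => [//|n IH] x y /=; rewrite !IH /len /=; field. Qed.

(** On an interval of the last generation the dyadic maximal function is
    constant, so the integral is a sum over leaves. *)
Lemma integral_dmax n x y m : a <= x -> x < y -> y <= b -> 0 <= m ->
  (\int[mu]_(t in `[x, y[) (dmax F n x y m t `^ p * w t)%:E =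
   (tsum (fun am => W am.1 * am.2 `^ p) (lab F len m (dtree n x y)))%:E)%E.
Proof.
have mm n' x' y' m' : measurable_fun setT (fun t => (dmax F n' x' y' m' t `^ p * w t)%:E).
  apply/measurable_EFinP; apply: measurable_funM => //; apply: measurable_powR_comp.
  exact: measurable_dmax.
elim: n x y m => [|n IH] x y m ax xy yb m0.
  rewrite /=; set M := Num.max _ _; rewrite [W _ * _]mulrC EFinM -(ivalE ax yb mEw (EFin_ge0 w0) wi).
  under eq_integral do rewrite EFinM.
  rewrite ge0_integralZl_EFin ?powR_ge0//; last exact: measurable_funTS.
  by move=> t _; rewrite lee_fin.
set c := (x + y) / 2; have xc : x < c by rewrite /c; lra.
have cy : c < y by rewrite /c; lra.
set m' := Num.max m (F (x, y) / len (x, y)).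
have m'0 : 0 <= m' by rewrite le_max m0.
rewrite (@itv_co_split _ x c y); last 3 first.
- by rewrite !ltW.
- exact: mm.
- by move=> t; rewrite lee_fin mulr_ge0 ?powR_ge0.
rewrite [lab _ _ _ _]/= -/c (add_tsum n ax xc (le_trans (ltW cy) yb) mEf (EFin_ge0 f0) fi).
rewrite (add_tsum n (le_trans ax (ltW xc)) cy yb mEf (EFin_ge0 f0) fi).
rewrite -(@ival_split _ a b x c y ax (ltW xc) (ltW cy) yb mEf (EFin_ge0 f0) fi).
rewrite !len_tsum (_ : len (x, c) + len (c, y) = len (x, y)); last by rewrite /len /=; ring.
have dS t : dmax F n.+1 x y m t =
    if t < c then dmax F n x c m' t else dmax F n c y m' t by [].
have E1 : (\int[mu]_(t in `[x, c[) (dmax F n.+1 x y m t `^ p * w t)%:E =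
           \int[mu]_(t in `[x, c[) (dmax F n x c m' t `^ p * w t)%:E)%E.
  apply: eq_integral => t /set_mem tI.
  have /andP[_ t2] : x <= t < c by move: tI; rewrite /= in_itv.
  by rewrite dS t2.
have E2 : (\int[mu]_(t in `[c, y[) (dmax F n.+1 x y m t `^ p * w t)%:E =
           \int[mu]_(t in `[c, y[) (dmax F n c y m' t `^ p * w t)%:E)%E.
  apply: eq_integral => t /set_mem tI.
  have /andP[t1 _] : c <= t < y by move: tI; rewrite /= in_itv.
  by rewrite dS ltNge t1.
rewrite E1 E2 (IH _ _ _ ax xc (le_trans (ltW cy) yb) m'0).
by rewrite (IH _ _ _ (le_trans ax (ltW xc)) cy yb m'0) -EFinD.
Qed.

(** The dyadic maximal theorem with an [A_p] weight; the constant involves the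
    weight only through [Q] and does not depend on the depth. *)
Lemma dyadic_muckenhoupt n :
  (\int[mu]_(t in `[a, b[) (dmax F n a b 0 t `^ p * w t)%:E <=
   (Q `^ (p / (p - 1)) * ((2 * (p / (p - 1) / (p / (p - 1) - 1))) `^ (p / (p - 1)) *
    ((2 `^ p) `^ (p / (p - 1) - 1) * ((2 * (p / (p - 1))) `^ p * (2 `^ p * N (a, b))))))%:E)%E.
Proof.
rewrite integral_dmax// lee_fin.
have mN : measurable_fun setT (fun t => (f t `^ p * w t)%:E).
  by apply/measurable_EFinP; apply: measurable_funM => //; exact: measurable_powR_comp.
have N0 t : (0 <= (f t `^ p * w t)%:E)%E by rewrite lee_fin mulr_ge0 ?powR_ge0.
rewrite /N -(add_tsum n (lexx a) ab (lexx b) mN N0 fwi).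
have tallD (P : R * R -> Prop) k x y : (forall x y, a <= x -> x < y -> y <= b -> P (x, y)) ->
    a <= x -> x < y -> y <= b -> tall P (dtree k x y).
  move=> HP; elim: k x y => [|k IH] x y ax xy yb /=; first exact: HP.
  by split; apply: IH; lra.
have nodesD (P : tree (R * R) -> Prop) k x y :
    (forall k x y, a <= x -> x < y -> y <= b -> P (dtree k x y)) ->
    a <= x -> x < y -> y <= b -> nodes P (dtree k x y).
  move=> HP; elim: k x y => [|k IH] x y ax xy yb.
    by split => //; exact: (HP 0%N).
  split; first exact: (HP k.+1).
  by split; apply: IH; lra.
apply: (lerner_discrete p1 Q0 (powR_ge0 2 p)).
- apply: tallD => // x y ax xy yb; split; rewrite ?/len/= ?subr_gt0//; first exact: wpos.
    exact: Spos.
  exact/ival_ge0/EFin_ge0.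
- apply: nodesD => // k x y ax xy yb.
  rewrite len_tsum (add_tsum k ax xy yb mEw (EFin_ge0 w0) wi).
  by rewrite (add_tsum k ax xy yb msg sg0 sgi); exact: Ap.
- apply: tallD => // x y ax xy yb; split; [exact: ival_ge0|exact: lenW|].
  exact: holder_ival (Spos ax xy yb) fi fwi.
Qed.

End Maximal.
End Dyadic.

(** * Translations and periodic functions *)

Section Periodic.
Context {R : realType}.
Local Notation mu := (@lebesgue_measure R).

Section Shift.
Variable c : R.

Definition shift_map (t : measurableTypeR R) : measurableTypeR R := t + c.

Lemma measurable_shift_map : measurable_fun setT shift_map.
Proof. by apply: measurable_funD => //; exact: measurable_cst. Qed.

HB.instance Definition _ := isMeasurableFun.Build _ _ _ _ shift_map measurable_shift_map.

(** Both measures give the same values to intervals, and these determine a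
    measure on the line. *)
Lemma lebesgue_measure_shift (A : set R) : measurable A ->
  pushforward mu shift_map A = mu A.
Proof.
move=> mA; apply/esym/lebesgue_measure_unique => //= _ [[a b]] _ <-.
rewrite /pushforward (_ : shift_map @^-1` `]a, b] = `]a - c, b - c]%classic).
  by rewrite !lebesgue_measure_itv/= !lte_fin ltrD2r; case: ifP => // _; congr EFin; ring.
by apply/seteqP; split => t /=; rewrite /shift_map !in_itv/= ltrBlDr lerBrDr.
Qed.

Lemma integral_shift (g : R -> \bar R) (x y : R) :
  measurable_fun setT g -> (forall t, 0 <= g t)%E ->
  (\int[mu]_(t in `[(x + c)%R, (y + c)%R[) g t = \int[mu]_(t in `[x, y[) g (t + c)%R)%E.
Proof.
move=> mg g0.
have -> : (\int[mu]_(t in `[(x + c)%R, (y + c)%R[) g t =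
    \int[pushforward mu shift_map]_(t in `[(x + c)%R, (y + c)%R[) g t)%E.
  by apply: eq_measure_integral => //= A mA _; exact/esym/lebesgue_measure_shift.
rewrite ge0_integral_pushforward//; last exact: measurable_funTS.
congr (integral _ _ _).
by apply/seteqP; split => t /=; rewrite /shift_map !in_itv/= lerD2r ltrD2r.
Qed.
End Shift.

(** The part of the one period that precedes the other is translated by [T]
    onto the part of the other that follows it. *)
Lemma integral_periodic (T : R) (g : R -> \bar R) (x y : R) : 0 < T ->
  measurable_fun setT g -> (forall t, 0 <= g t)%E -> (forall t, g (t + T)%R = g t) ->
  x <= y <= x + T ->
  (\int[mu]_(t in `[x, (x + T)%R[) g t = \int[mu]_(t in `[y, (y + T)%R[) g t)%E.
Proof.
move=> T0 mg g0 gT /andP[xy yx].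
rewrite (@itv_co_split _ _ x y (x + T))// ?xy// addeC.
rewrite (@itv_co_split _ _ y (x + T) (y + T))// ?yx ?lerD2r//.
congr (_ + _)%E; rewrite integral_shift//.
by apply: eq_integral => t _; rewrite gT.
Qed.

Lemma integral_itv_cc (g : R -> \bar R) (x y : R) :
  measurable_fun setT g -> (forall t, 0 <= g t)%E ->
  (\int[mu]_(t in `[x, y]) g t = \int[mu]_(t in `[x, y[) g t)%E.
Proof. by move=> mg g0; rewrite integral_itv_bndo_bndc//; exact: measurable_funTS. Qed.

Lemma circle_int_periodic (H : R[i]^o -> \bar R) (x : R) :
  measurable_fun setT (fun t => H (expi t)) -> (forall t, 0 <= H (expi t))%E ->
  - (2 * pi) <= x <= 2 * pi ->
  (\int[mu]_(t in `[x, (x + 2 * pi)%R[) H (expi t) = circle_int H)%E.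
Proof.
move=> mH H0 /andP[x1 x2].
have pi0 : 0 < 2 * pi :> R by rewrite mulr_gt0// pi_gt0.
have per t : H (expi (t + 2 * pi)) = H (expi t) by rewrite expi_2pi.
rewrite /circle_int integral_itv_cc// -[X in `[0%R, X[]add0r.
have [x0|/ltW x0] := leP 0 x.
  by rewrite -(@integral_periodic (2 * pi) _ 0 x)// x0 add0r.
by rewrite (@integral_periodic (2 * pi) _ x 0)// x0/=; lra.
Qed.

End Periodic.

(** * Directions and Stolz cones *)

Section Directions.
Context {R : realType}.
Local Notation C := R[i]^o.
Local Notation normc := (@Normc.normc R).
Local Notation Re := (@complex.Re R).
Local Notation Im := (@complex.Im R).

(** The coordinates of [z] in the orthonormal frame
    [(expi phi, expi (phi + pi / 2))]. *)
Definition along (phi : R) (z : C) : R := cos phi * Re z + sin phi * Im z.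
Definition across (phi : R) (z : C) : R := cos phi * Im z - sin phi * Re z.

Lemma ReB (z w : C) : Re (z - w) = Re z - Re w.
Proof. by case: z => a b; case: w. Qed.
Lemma ImB (z w : C) : Im (z - w) = Im z - Im w.
Proof. by case: z => a b; case: w. Qed.

Lemma acrossB phi (z w : C) : across phi (z - w) = across phi z - across phi w.
Proof. by rewrite /across ReB ImB; ring. Qed.
Lemma alongB phi (z w : C) : along phi (z - w) = along phi z - along phi w.
Proof. by rewrite /along ReB ImB; ring. Qed.

Lemma normc_frame phi (z : C) : normc z ^+ 2 = along phi z ^+ 2 + across phi z ^+ 2.
Proof.
rewrite normc_sqr /along /across; have := cos2Dsin2 phi => e.
transitivity ((cos phi ^+ 2 + sin phi ^+ 2) * (Re z ^+ 2 + Im z ^+ 2)); last by ring.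
by rewrite e mul1r.
Qed.

Lemma across_le phi (z : C) : `|across phi z| <= normc z.
Proof.
rewrite -ler_sqr ?nnegrE ?normr_ge0 ?normc_ge0// real_normK ?num_real//.
by rewrite (normc_frame phi) lerDr sqr_ge0.
Qed.

Lemma along_expi phi x : along phi (expi (phi + x)) = cos x.
Proof.
rewrite /along /expi/= cosD sinD; have := cos2Dsin2 phi => e.
transitivity ((cos phi ^+ 2 + sin phi ^+ 2) * cos x); first by ring.
by rewrite e mul1r.
Qed.

Lemma across_expi phi x : across phi (expi (phi + x)) = sin x.
Proof.
rewrite /across /expi/= cosD sinD; have := cos2Dsin2 phi => e.
transitivity ((cos phi ^+ 2 + sin phi ^+ 2) * sin x); first by ring.
by rewrite e mul1r.
Qed.

Lemma normc_le_frame phi (z : C) : normc z <= `|along phi z| + `|across phi z|.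
Proof.
have := normc_frame phi z; have := normc_ge0 z.
move: (normr_ge0 (along phi z)) (normr_ge0 (across phi z)).
rewrite -(real_normK (num_real (along phi z))) -(real_normK (num_real (across phi z))).
by move: (normc z) `|along phi z| `|across phi z| => n u v u0 v0 n0 h; nra.
Qed.

(** A point [z] whose direction is within [acos ((1 + alpha^-1) / 2)] of [expi
    phi] sees along [expi phi] a boundary point in whose Stolz cone it lies.
    The margin is uniform as long as [z] stays in a compact subset of the
    disk; hence the same holds for the boundary points at which lines parallel
    to [expi phi] and close to [z] leave the disk. *)
Lemma stolz_near (alpha kappa : R) : 1 < alpha -> 0 < kappa -> kappa < 1 ->
  exists2 eta : R, 0 < eta & forall phi x (z : C), normc z <= 1 - kappa ->
    (1 + alpha^-1) / 2 * normc z <= along phi z -> 0 <= cos x ->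
    `|sin x - across phi z| <= eta -> stolz alpha (expi (phi + x)) z.
Proof.
move=> a1 k0 k1.
have a0 : 0 < alpha by rewrite (lt_trans _ a1).
(* The boundary point ahead of [z] satisfies the cone condition with the
   margin [m]; [eta] is small enough for a shift of the line by [eta] to use
   up less than that. *)
pose m := kappa * (alpha - 1) / (alpha + 3).
have m0 : 0 < m by rewrite /m divr_gt0 ?mulr_gt0//; lra.
pose eta := m * kappa / 4.
have eta0 : 0 < eta by rewrite /eta divr_gt0// mulr_gt0.
exists eta => // phi x z zk cz cx sx.
have zd : disk z by rewrite /disk/mkset (le_lt_trans zk)// ltrBlDr ltrDl.
split => //.
have [r rE] : exists r, r = normc z by exists (normc z).
have [c cE] : exists c, c = along phi z by exists (along phi z).
have [y yE] : exists y, y = across phi z by exists (across phi z).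
have rcy : r ^+ 2 = c ^+ 2 + y ^+ 2 by rewrite rE cE yE; exact: normc_frame.
rewrite -rE in zk cz *; rewrite -cE in cz; rewrite -yE in sx.
have r0 : 0 <= r by rewrite rE normc_ge0.
have c0 : 0 <= c.
  by apply: le_trans cz; rewrite mulr_ge0// divr_ge0// addr_ge0 ?invr_ge0 ?ltW.
have [T TE] : exists T, T = Num.sqrt (1 - y ^+ 2) by eexists.
have y2 : y ^+ 2 <= r ^+ 2 by rewrite rcy lerDr sqr_ge0.
have r2 : r ^+ 2 <= 1 - kappa by nra.
have T2 : T ^+ 2 = 1 - y ^+ 2 by rewrite TE sqr_sqrtr//; lra.
have T0 : 0 <= T by rewrite TE sqrtr_ge0.
have Tk : kappa <= T ^+ 2 by rewrite T2; lra.
have T1 : T <= 1 by have := sqr_ge0 y; nra.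
have kT : kappa <= T by nra.
have cT : c <= T by nra.
have acz : (alpha + 1) * r <= 2 * alpha * c.
  have -> : (alpha + 1) * r = 2 * alpha * ((1 + alpha^-1) / 2 * r) by field; rewrite gt_eqF.
  by rewrite ler_wpM2l// mulr_ge0// ltW.
have main : T - c <= alpha * (1 - r) - m.
  have h1 : (1 - r) * (alpha - 1) <= (c + alpha * (1 - r)) ^+ 2 - T ^+ 2.
    have -> : (c + alpha * (1 - r)) ^+ 2 - T ^+ 2 =
       (1 - r) * (2 * alpha * c + alpha ^+ 2 * (1 - r) - (1 + r)).
      have y2E : y ^+ 2 = r ^+ 2 - c ^+ 2 by rewrite rcy; ring.
      by rewrite T2 y2E; ring.
    rewrite ler_wpM2l//; first lra.
    have : 0 <= (alpha - 1) * (alpha * (1 - r)) by rewrite !mulr_ge0//; lra.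
    by nra.
  have h2 : kappa * (alpha - 1) <= (c + alpha * (1 - r)) ^+ 2 - T ^+ 2.
    by apply: le_trans h1; rewrite ler_wpM2r//; lra.
  have [U UE] : exists U, U = c + alpha * (1 - r) by eexists.
  rewrite -UE in h2.
  suff : m <= U - T by rewrite UE; lra.
  have U3 : U + T <= alpha + 3.
    have ar : 0 <= alpha * r by rewrite mulr_ge0// ltW.
    have e : alpha * (1 - r) = alpha - alpha * r by ring.
    by rewrite UE e; lra.
  have U0 : 0 <= U by rewrite UE addr_ge0// mulr_ge0 ?ltW//; lra.
  have kap : 0 < kappa * (alpha - 1) by rewrite mulr_gt0//; lra.
  have UT : 0 <= U - T by nra.
  rewrite /m ler_pdivrMr; last lra.
  apply: (le_trans h2); rewrite subr_sqr ler_wpM2l//.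
have cos1 : `|cos x - T| <= 2 * eta / kappa.
  have e : (cos x - T) * (cos x + T) = (y - sin x) * (y + sin x).
    rewrite -!subr_sqr T2; have := cos2Dsin2 x => h.
    by rewrite -h; ring.
  rewrite ler_pdivlMr//; apply: (@le_trans _ _ (`|cos x - T| * (cos x + T))).
    by rewrite ler_wpM2l//; lra.
  rewrite -(ger0_norm (_ : 0 <= cos x + T)); last by rewrite addr_ge0.
  rewrite -normrM e normrM mulrC ler_pM// ?normr_ge0//; last by rewrite distrC.
  have y1 : `|y| <= 1 by rewrite ler_norml; apply/andP; split; nra.
  have s1 : `|sin x| <= 1 by rewrite ler_norml sin_geN1 sin_le1.
  by rewrite (le_trans (ler_normD _ _))//; lra.
have ekE : 2 * eta / kappa = m / 2 by rewrite /eta; field; rewrite gt_eqF.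
rewrite ekE in cos1.
apply: (@le_lt_trans _ _ (`|c - cos x| + `|y - sin x|)).
  rewrite (le_trans (normc_le_frame phi _))// alongB acrossB along_expi across_expi.
  by rewrite -cE -yE.
have ek : eta < m / 2.
  rewrite /eta; have : m * kappa < m by rewrite gtr_pMr.
  by lra.
rewrite (distrC y); have t3 : `|c - cos x| <= `|c - T| + `|T - cos x| by exact: ler_distD.
have t4 : `|c - T| = T - c by rewrite distrC ger0_norm// subr_ge0.
have t5 : `|T - cos x| = `|cos x - T| by rewrite distrC.
by lra.
Qed.

(** The projections of a vector along two directions at angle [delta] cannot
    both be small. *)
Lemma two_directions (phi delta : R) (z : C) : 0 <= sin delta ->
  normc z * sin delta <= `|across phi z| + `|across (phi + delta) z|.
Proof.
move=> s0.
have e : z * (sin delta)%:C =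
    (across phi z)%:C * expi (phi + delta) - (across (phi + delta) z)%:C * expi phi.
  have h := cos2Dsin2 phi.
  case: z => u v; rewrite /across /expi; apply/eqP; rewrite eq_complex/= sinD cosD.
  apply/andP; split; apply/eqP.
    transitivity ((cos phi ^+ 2 + sin phi ^+ 2) * (u * sin delta)); last by ring.
    by rewrite h; ring.
  transitivity ((cos phi ^+ 2 + sin phi ^+ 2) * (v * sin delta)); last by ring.
  by rewrite h; ring.
have -> : normc z * sin delta = normc (z * (sin delta)%:C).
  by rewrite Normc.normcM normc_real ger0_norm.
rewrite e; apply: le_trans.
  exact: (normc_tri _ 0).
by rewrite subr0 sub0r normcN !Normc.normcM !normc_real !normc_expi !mulr1.
Qed.

Lemma cos_le_of_le (t d : R) : `|t| <= d -> d <= pi -> cos d <= cos t.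
Proof.
move=> td dpi; have -> : cos t = cos `|t| by case: ger0P => // _; rewrite cosN.
move: (td); rewrite le_eqVlt => /orP[/eqP -> //|tlt].
apply: ltW; rewrite ltr_cos// in_itv/= ?normr_ge0 ?dpi ?andbT//.
  exact: le_trans td dpi.
exact: le_trans (normr_ge0 _) td.
Qed.

Lemma sector (delta : R) (N : nat) (z : C) : 0 < delta -> delta <= pi ->
  2 * pi <= N%:R * delta ->
  exists2 k : nat, (k < N)%N &
    cos delta * normc z <= along (k%:R * delta) z /\
    cos delta * normc z <= along (k%:R * delta + delta) z.
Proof.
move=> d0 dpi Nd.
have [t /andP[t0 t2] zE] : exists2 t, 0 <= t < 2 * pi & z = (normc z)%:C * expi t.
  have [z0|zn0] := eqVneq z 0.
    exists 0; first by rewrite lexx mulr_gt0// pi_gt0.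
    by rewrite z0 Normc.normc0 mul0r.
  have nz : normc z != 0 by apply: contraNneq zn0 => /Normc.eq0_normc ->.
  have cz : circle (z / (normc z)%:C).
    by rewrite /circle/mkset Normc.normcM Normc.normcV normc_real ger0_norm ?normc_ge0// mulfV.
  exists (arg (z / (normc z)%:C)); first exact: arg_ge0_lt2pi.
  rewrite expi_arg// mulrC divfK//.
  by apply: contra nz => /eqP[->].
have N0 : (0 < N)%N.
  by case: N Nd => // ; rewrite mul0r leNgt mulr_gt0// pi_gt0.
have fl := Num.Theory.truncn_itv (_ : 0 <= t / delta).
have {fl} /andP[f1 f2] := fl (divr_ge0 t0 (ltW d0)).
set k := Num.trunc (t / delta) in f1 f2.
exists k.
  rewrite -(ltr_nat R) (le_lt_trans f1)// ltr_pdivrMr//.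
  exact: lt_le_trans t2 Nd.
have t1 : k%:R * delta <= t by rewrite -ler_pdivlMr.
have t3 : t < k%:R * delta + delta.
  by move: f2; rewrite ltr_pdivrMr// -addn1 natrD mulrDl mul1r.
have aE phi : along phi z = normc z * cos (t - phi).
  rewrite {1}zE -{1}(subrK phi t) addrC -(along_expi phi (t - phi)) addrC subrK /along.
  move: (expi t) => w; case: w => u v /=; ring.
rewrite !aE !(mulrC (cos delta)).
by split; rewrite ler_wpM2l ?normc_ge0//; apply: cos_le_of_le => //;
  rewrite ler_norml; apply/andP; split; lra.
Qed.

End Directions.

(** * Boundaries of planar convex sets *)

Section ConvexCurves.
Context {R : realType}.
Local Notation C := R[i]^o.
Local Notation normc := (@Normc.normc R).
Local Notation Re := (@complex.Re R).
Local Notation Im := (@complex.Im R).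

Definition det (u v : C) : R := Re u * Im v - Im u * Re v.

Lemma det_le (u v : C) : `|det u v| <= normc u * normc v.
Proof.
rewrite -ler_sqr ?nnegrE ?normr_ge0 ?mulr_ge0 ?normc_ge0// real_normK ?num_real//.
rewrite exprMn !normc_sqr /det -subr_ge0.
have -> : (Re u ^+ 2 + Im u ^+ 2) * (Re v ^+ 2 + Im v ^+ 2) -
  (Re u * Im v - Im u * Re v) ^+ 2 = (Re u * Re v + Im u * Im v) ^+ 2 by ring.
exact: sqr_ge0.
Qed.

Lemma detB (u u' v v' : C) : det u v - det u' v' = det (u - u') v + det u' (v - v').
Proof. by rewrite /det !ReB !ImB; ring. Qed.

(** Twice the signed area of the triangle. *)
Definition orient (a b c : C) : R := det (b - a) (c - a).

(** The constant is crude: the edges of a triangle have length at most [4]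
    here, and they move by at most [2 e]. *)
Lemma orient_near (e : R) (a b c a' b' c' : C) :
  normc a <= 1 -> normc b <= 1 -> normc c <= 1 ->
  normc a' <= 2 -> normc b' <= 2 -> normc c' <= 2 ->
  normc (a - a') <= e -> normc (b - b') <= e -> normc (c - c') <= e ->
  `|orient a b c - orient a' b' c'| <= 12 * e.
Proof.
move=> a1 b1 c1 a1' b1' c1' ae be ce.
have n2 (k : R) (x y : C) : normc x <= k -> normc y <= k -> normc (x - y) <= 2 * k.
  move=> x1 y1; have := normc_tri x 0 y; rewrite subr0 sub0r normcN; lra.
have de (x y x' y' : C) : normc (x - x') <= e -> normc (y - y') <= e ->
    normc (x - y - (x' - y')) <= 2 * e.
  move=> h1 h2; have -> : x - y - (x' - y') = (x - x') - (y - y') by ring.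
  by have := normc_tri (x - x') 0 (y - y'); rewrite subr0 sub0r normcN; lra.
rewrite /orient detB (le_trans (ler_normD _ _))//.
have h1 : `|det (b - a - (b' - a')) (c - a)| <= (2 * e) * (2 * 1).
  by apply: (le_trans (det_le _ _)); apply: ler_pM; rewrite ?normc_ge0//; [exact: de|exact: n2].
have h2 : `|det (b' - a') (c - a - (c' - a'))| <= (2 * 2) * (2 * e).
  by apply: (le_trans (det_le _ _)); apply: ler_pM; rewrite ?normc_ge0//; [exact: n2|exact: de].
lra.
Qed.

Lemma orient_frame phi (a b c : C) : orient a b c =
  (along phi b - along phi a) * (across phi c - across phi a) -
  (across phi b - across phi a) * (along phi c - along phi a).
Proof.
rewrite /orient -!alongB -!acrossB /det /along /across.
set u := b - a; set v := c - a.
transitivity ((cos phi ^+ 2 + sin phi ^+ 2) * (Re u * Im v - Im u * Re v)); last by ring.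
by rewrite cos2Dsin2 mul1r.
Qed.

Lemma barycentric (a b c w : C) : orient a b c != 0 ->
  w = (orient w b c / orient a b c)%:C * a + (orient a w c / orient a b c)%:C * b +
      (orient a b w / orient a b c)%:C * c.
Proof.
case: a b c w => a1 a2 [b1 b2] [c1 c2] [w1 w2]; rewrite /orient /det /= => D0.
by apply/eqP; rewrite eq_complex/=; apply/andP; split; apply/eqP; field.
Qed.

Section ConvexSet.
Variable K : set C.
Hypothesis cK : convex_set (K : set (convex_lmodType C)).

Lemma convex_mem (x y : C) (t : R) : K x -> K y -> 0 <= t -> t <= 1 ->
  K (t%:C * x + (1 - t)%:C * y).
Proof.
move=> Kx Ky t0 t1.
have t0' : (0 : R[i]) <= t%:C by rewrite ler0c.
have t1' : t%:C <= (1 : R[i]) by rewrite -[1]/(1%:C) lecR.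
have := @cK x y (Itv01 t0' t1'); rewrite !inE => /(_ Kx Ky).
rewrite /conv/=.
have -> : (1 - t)%:C = 1 - t%:C :> R[i] by rewrite rmorphB.
exact.
Qed.

Lemma triangle_mem (a b c w : C) : K a -> K b -> K c -> orient a b c != 0 ->
  0 < orient w b c / orient a b c -> 0 < orient a w c / orient a b c ->
  0 <= orient a b w / orient a b c -> K w.
Proof.
move=> Ka Kb Kc D0 p0 q0 r0.
have [p pE] : exists p, p = orient w b c / orient a b c by eexists.
have [q qE] : exists q, q = orient a w c / orient a b c by eexists.
have [r rE] : exists r, r = orient a b w / orient a b c by eexists.
rewrite -pE in p0; rewrite -qE in q0; rewrite -rE in r0.
have pqr : p + q + r = 1.
  rewrite pE qE rE -!mulrDl -[RHS](mulfV D0); congr (_ / _).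
  by rewrite /orient /det !ReB !ImB; ring.
have wE : w = p%:C * a + q%:C * b + r%:C * c by rewrite pE qE rE; exact: barycentric.
have qr0 : 0 < q + r by lra.
have -> : w = p%:C * a + (1 - p)%:C * ((q / (q + r))%:C * b + (1 - q / (q + r))%:C * c).
  rewrite wE -addrA; congr (_ + _); rewrite mulrDr !mulrA -!rmorphM/=.
  have e1p : 1 - p = q + r by lra.
  have -> : (1 - p) * (q / (q + r)) = q.
    by rewrite e1p; field; rewrite gt_eqF.
  have -> : (1 - p) * (1 - q / (q + r)) = r; last by [].
    by rewrite e1p; field; rewrite gt_eqF.
apply: convex_mem => //; [|exact: ltW|lra].
apply: convex_mem => //; first by rewrite divr_ge0//; lra.
by rewrite ler_pdivrMr// mul1r; lra.
Qed.

Hypothesis Kdisk : K `<=` disk.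

Lemma closure_near (z : C) (e : R) : closure K z -> 0 < e ->
  exists2 z', K z' & normc (z - z') < e.
Proof.
move=> cz e0.
have [|z' [Kz' /= zz']] := cz [set w | normc (w - z) < e].
  by apply/nbhs_normcP; exists e.
by exists z' => //; rewrite normcC.
Qed.

Lemma closure_normc_le1 (z : C) : closure K z -> normc z <= 1.
Proof.
move=> cz; apply/ler_addgt0Pr => e e0.
have [z' /Kdisk z1 zz'] := closure_near cz e0.
have := normc_tri z z' 0; rewrite !subr0; move: z1; rewrite /disk/mkset; lra.
Qed.

(** If points of the closure of a convex set lie on both sides of a line, then
    the points of the line strictly between two points of the closure are
    interior. A point close to [z2] lies in one of the two triangles based on
    points of [K] close to [z1] and [z3], whose third vertex is in [K] and
    close to [P] or to [Q]. All six orientations that decide this are stable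
    under small perturbations. *)
Lemma between_interior (z1 z2 z3 P Q : C) :
  closure K z1 -> closure K z2 -> closure K z3 -> closure K P -> closure K Q ->
  0 < orient z1 z3 Q -> 0 < orient z2 z3 Q -> 0 < orient z1 z2 Q ->
  orient z1 z3 P < 0 -> orient z2 z3 P < 0 -> orient z1 z2 P < 0 ->
  K° z2.
Proof.
move=> c1 c2 c3 cP cQ o1 o2 o3 o4 o5 o6.
have [m m0 [[m1 m2 m3] [m4 m5 m6]]] : exists2 m : R, 0 < m &
    [/\ m <= orient z1 z3 Q, m <= orient z2 z3 Q & m <= orient z1 z2 Q] /\
    [/\ orient z1 z3 P <= - m, orient z2 z3 P <= - m & orient z1 z2 P <= - m].
  exists (Num.min (Num.min (orient z1 z3 Q) (Num.min (orient z2 z3 Q) (orient z1 z2 Q)))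
    (Num.min (- orient z1 z3 P) (Num.min (- orient z2 z3 P) (- orient z1 z2 P)))).
    by rewrite !lt_min o1 o2 o3 !oppr_gt0 o4 o5 o6.
  have gm (x y : R) : Num.min x y <= x /\ Num.min x y <= y by rewrite !ge_min !lexx orbT.
  set A := Num.min (orient z1 z3 Q) _; set B := Num.min (- orient z1 z3 P) _.
  have [hA hB] := gm A B; move: (Num.min A B) hA hB => m mA mB.
  have [A1 A'] := gm (orient z1 z3 Q) (Num.min (orient z2 z3 Q) (orient z1 z2 Q)).
  have [A2 A3] := gm (orient z2 z3 Q) (orient z1 z2 Q).
  have [B1 B'] := gm (- orient z1 z3 P) (Num.min (- orient z2 z3 P) (- orient z1 z2 P)).
  have [B2 B3] := gm (- orient z2 z3 P) (- orient z1 z2 P).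
  split; split; rewrite 1?lerNr; first [exact: (le_trans mA A1)|
   exact: (le_trans mA (le_trans A' A2))|exact: (le_trans mA (le_trans A' A3))|
   exact: (le_trans mB B1)|exact: (le_trans mB (le_trans B' B2))|
   exact: (le_trans mB (le_trans B' B3))].
(* A perturbation of size [e] changes an orientation by at most [12 e], which
   must stay below [m]. *)
have [e [e0 em e1]] : exists e, [/\ 0 < e, 12 * e < m & e <= 1].
  exists (Num.min 1 (m / 24)); split; first by rewrite lt_min ltr01 divr_gt0.
    have : Num.min 1 (m / 24) <= m / 24 by rewrite ge_min lexx orbT.
    lra.
  by rewrite ge_min lexx.
have [a Ka ae] := closure_near c1 e0.
have [b Kb be] := closure_near c3 e0.
have [p Kp pe] := closure_near cP e0.
have [q Kq qe] := closure_near cQ e0.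
have n1 := closure_normc_le1.
have k1 (z : C) : K z -> normc z <= 2.
  by move=> /Kdisk; rewrite /disk/mkset => h; lra.
apply/nbhs_normcP; exists e => // w wz2.
have we : normc (z2 - w) < e by rewrite normcC.
have w1 : normc w <= 2.
  have := normc_tri w z2 0; rewrite !subr0; have := n1 _ c2; lra.
have near (x y z x' y' z' : C) : closure K x -> closure K y -> closure K z ->
    normc x' <= 2 -> normc y' <= 2 -> normc z' <= 2 ->
    normc (x - x') < e -> normc (y - y') < e -> normc (z - z') < e ->
    (m <= orient x y z -> 0 < orient x' y' z') /\
    (orient x y z <= - m -> orient x' y' z' < 0).
  move=> cx cy cz kx ky kz /ltW hx /ltW hy /ltW hz.
  have := orient_near (n1 _ cx) (n1 _ cy) (n1 _ cz) kx ky kz hx hy hz.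
  by rewrite ler_norml => /andP[u v]; split => h; lra.
have p1 := (near z1 z3 Q a b q c1 c3 cQ (k1 _ Ka) (k1 _ Kb) (k1 _ Kq) ae be qe).1 m1.
have p2 := (near z2 z3 Q w b q c2 c3 cQ w1 (k1 _ Kb) (k1 _ Kq) we be qe).1 m2.
have p3 := (near z1 z2 Q a w q c1 c2 cQ (k1 _ Ka) w1 (k1 _ Kq) ae we qe).1 m3.
have p4 := (near z1 z3 P a b p c1 c3 cP (k1 _ Ka) (k1 _ Kb) (k1 _ Kp) ae be pe).2 m4.
have p5 := (near z2 z3 P w b p c2 c3 cP w1 (k1 _ Kb) (k1 _ Kp) we be pe).2 m5.
have p6 := (near z1 z2 P a w p c1 c2 cP (k1 _ Ka) w1 (k1 _ Kp) ae we pe).2 m6.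
have [h|h] := leP 0 (orient a b w).
  apply: (triangle_mem Ka Kb Kq); rewrite ?gt_eqF// ?divr_gt0//.
  by rewrite divr_ge0// ltW.
apply: (triangle_mem Ka Kb Kp); rewrite ?lt_eqF//.
- by rewrite -mulrNN -invrN divr_gt0// oppr_gt0.
- by rewrite -mulrNN -invrN divr_gt0// oppr_gt0.
- by rewrite -mulrNN -invrN divr_ge0// oppr_ge0 ltW.
Qed.

(** Of three boundary points on a line that meets both sides of [K], the
    middle one would be interior. *)
Lemma three_collinear phi s (P Q z1 z2 z3 : C) :
  closure K P -> closure K Q -> across phi P < s < across phi Q ->
  boundary K z1 -> boundary K z2 -> boundary K z3 ->
  across phi z1 = s -> across phi z2 = s -> across phi z3 = s ->
  z1 != z2 -> z2 != z3 -> z1 != z3 -> False.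
Proof.
move=> cP cQ /andP[Ps sQ] b1 b2 b3 s1 s2 s3 n12 n23 n13.
have key (u v w : C) : boundary K u -> boundary K v -> boundary K w ->
    across phi u = s -> across phi v = s -> across phi w = s ->
    along phi u < along phi v -> along phi v < along phi w -> False.
  move=> [cu _] [cv nv] [cw _] su sv sw uv vw; apply: nv.
  apply: (between_interior cu cv cw cP cQ); rewrite (orient_frame phi) ?su ?sv ?sw subrr mul0r subr0.
  - by rewrite mulr_gt0// subr_gt0 ?(lt_trans uv).
  - by rewrite mulr_gt0// subr_gt0.
  - by rewrite mulr_gt0// subr_gt0.
  - by rewrite pmulr_rlt0 ?subr_lt0// subr_gt0 (lt_trans uv).
  - by rewrite pmulr_rlt0 ?subr_lt0// subr_gt0.
  - by rewrite pmulr_rlt0 ?subr_lt0// subr_gt0.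
have inj (u v : C) : across phi u = s -> across phi v = s -> along phi u = along phi v -> u = v.
  move=> su sv h; apply/eqP; rewrite -subr_eq0; apply/eqP/Normc.eq0_normc/eqP.
  by rewrite -sqrf_eq0 (normc_frame phi) alongB acrossB su sv h !subrr expr0n addr0.
case: (ltgtP (along phi z1) (along phi z2)) => [h12|h12|/(inj _ _ s1 s2) /eqP]; last 1 first.
- by rewrite (negbTE n12).
- case: (ltgtP (along phi z2) (along phi z3)) => [h23|h23|/(inj _ _ s2 s3) /eqP]; last 1 first.
  + by rewrite (negbTE n23).
  + exact: (key z1 z2 z3).
  case: (ltgtP (along phi z1) (along phi z3)) => [h13|h13|/(inj _ _ s1 s3) /eqP]; last 1 first.
  + by rewrite (negbTE n13).
  + exact: (key z1 z3 z2).
  + exact: (key z3 z1 z2).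
- case: (ltgtP (along phi z1) (along phi z3)) => [h13|h13|/(inj _ _ s1 s3) /eqP]; last 1 first.
  + by rewrite (negbTE n13).
  + exact: (key z2 z1 z3).
  case: (ltgtP (along phi z2) (along phi z3)) => [h23|h23|/(inj _ _ s2 s3) /eqP]; last 1 first.
  + by rewrite (negbTE n23).
  + exact: (key z2 z3 z1).
  + exact: (key z3 z2 z1).
Qed.

End ConvexSet.
End ConvexCurves.

(** * Lines crossing a convex curve *)

Section Crossings.
Context {R : realType}.
Local Notation C := R[i]^o.
Local Notation mu := (@lebesgue_measure R).

Definition edges (c : R) (l : seq R) : seq (R * R) := zip (c :: l) l.

Lemma edges_cons c x l : edges c (x :: l) = (c, x) :: edges x l.
Proof. by []. Qed.

Lemma edges_cat c l1 l2 : edges c (l1 ++ l2) = edges c l1 ++ edges (last c l1) l2.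
Proof. by elim: l1 c => [|x l1 IH] c //=; rewrite !edges_cons IH. Qed.

Lemma edges_in c l e : path <%R c l -> e \in edges c l ->
  [/\ c <= e.1, e.1 < e.2 & e.2 <= last c l].
Proof.
elim: l c => [|x l IH] c; first by [].
rewrite edges_cons inE /= => /andP[cx pl].
have xl : x <= last x l.
  elim: l x {IH cx} pl => [//|y l IH] x /= /andP[xy pl].
  exact: le_trans (ltW xy) (IH _ pl).
move=> /orP[/eqP -> //=|ein].
have [h1 h2 h3] := IH x pl ein; split => //.
exact: le_trans (ltW cx) h1.
Qed.

Lemma edges_pairwise c l : path <%R c l ->
  pairwise (fun e e' => e.2 <= e'.1) (edges c l).
Proof.
elim: l c => [//|x l IH] c /andP[cx pl].
rewrite edges_cons [pairwise _ _]/= IH// andbT.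
by apply/allP => e ein; have [h _ _] := edges_in pl ein.
Qed.

Definition crosses (y : R -> R) (s : R) (e : R * R) : bool :=
  (y e.1 < s < y e.2) || (y e.2 < s < y e.1).

Lemma crosses_point (y : R -> R) s (a b : R) (e : R * R) :
  {within `[a, b], continuous y} -> a <= e.1 -> e.1 < e.2 -> e.2 <= b ->
  crosses y s e -> exists2 u, e.1 < u < e.2 & y u = s.
Proof.
move=> cy ae ee eb cr.
have cy' : {within `[e.1, e.2], continuous y}.
  by apply: continuous_subspaceW cy => t /=; rewrite !in_itv/= => /andP[h1 h2];
    rewrite (le_trans ae)//= (le_trans h2).
have [u ue yu] : exists2 u, u \in `[e.1, e.2] & y u = s.
  apply: IVT => //; first exact: ltW.
  rewrite ge_min le_max; case/orP: cr => /andP[/ltW h1 /ltW h2]; rewrite h1 h2 ?orbT//.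
exists u => //; move: ue; rewrite in_itv/= !le_eqVlt => /andP[/orP[/eqP h|->] /orP[/eqP h'|->]] //.
- by move: ee; rewrite h h' ltxx.
- by exfalso; move: cr; rewrite /crosses h yu ltxx andbF.
- by exfalso; move: cr; rewrite /crosses -h' yu ltxx andbF.
Qed.

Lemma continuous_across phi : continuous (across phi : C -> R).
Proof.
move=> z; apply: (@cvgB _ _ _ (nbhs z)); apply: (@cvgMr _ _ (nbhs z)).
  exact: continuous_Im.
exact: continuous_Re.
Qed.

Lemma within_across (gam : R -> C) (A : set R) phi : {within A, continuous gam} ->
  {within A, continuous (across phi \o gam)}.
Proof. by move=> cg t; exact: (continuous_comp (cg t) (@continuous_across phi (gam t))). Qed.

(** Each edge of the inscribed polygon whose endpoints are separated by the
    line subtends an arc which meets the line, by the intermediate value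
    theorem. Three such edges would give three boundary points of the convex
    set on the line, distinct because the curve is simple, while the endpoints
    of an edge lie on both sides: [three_collinear] excludes this. *)
Lemma line_crosses_twice (gam : R -> C) (a b phi s : R) (l : seq R) :
  convex_curve gam a b -> itv_partition a b l ->
  (count (crosses (across phi \o gam) s) (edges a l) <= 2)%N.
Proof.
move=> [ab cg _ inj [K [cK Kd bK]]] [pl lb].
rewrite -size_filter leqNgt; apply/negP.
have := edges_pairwise pl; have := filter_subseq (crosses (across phi \o gam) s) (edges a l).
move=> /subseq_pairwise h /h {h}.
have : forall e, e \in [seq e <- edges a l | crosses (across phi \o gam) s e] ->
    exists u, [/\ e.1 < u < e.2, a < u < b & across phi (gam u) = s] /\
      [/\ a <= e.1, e.1 < e.2, e.2 <= b & crosses (across phi \o gam) s e].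
  move=> e; rewrite mem_filter => /andP[cr ein].
  have [h1 h2 h3] := edges_in pl ein; rewrite (eqP lb) in h3.
  have [u /andP[u1 u2] yu] := crosses_point (within_across (phi := phi) cg) h1 h2 h3 cr.
  exists u; split; split => //; first by rewrite u1.
  by rewrite (le_lt_trans h1)//= (lt_le_trans u2).
move=> H pw sz; move: sz H pw.
case: [seq e <- edges a l | crosses (across phi \o gam) s e] => [//|e1 [//|e2 [//|e3 F]]] _ H pw.
move: pw; rewrite /= -!andbA => /and3P[e12 e13 /andP[_ /andP[e23 _]]].
have [u1 [[/andP[p1 q1] r1 s1] [ae1 ee1 e1b cr]]] := H e1 (mem_head _ _).
have [|u2 [[/andP[p2 q2] r2 s2] _]] := H e2; first by rewrite !inE eqxx orbT.
have [|u3 [[/andP[p3 q3] r3 s3] _]] := H e3; first by rewrite !inE eqxx !orbT.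
have u12 : u1 < u2 by rewrite (lt_trans q1)// (le_lt_trans e12).
have u23 : u2 < u3 by rewrite (lt_trans q2)// (le_lt_trans e23).
have inab t : a < t < b -> (t \in `[a, b]) /\ (t \in `[a, b[).
  by move=> /andP[h1 h2]; rewrite !in_itv/= !ltW.
have ginj t t' : a < t < b -> a < t' < b -> t < t' -> gam t != gam t'.
  move=> /inab[h1 h2] /inab[h3 h4] tt'; apply/eqP => e.
  suff : t = t' by move=> /eqP; rewrite lt_eqF.
  by case: inj => [i|[_ i]]; apply: i.
have [cu1 cu2] : closure K (gam e1.1) /\ closure K (gam e1.2).
  by split; apply: (bK _ _).1; rewrite in_itv/=; lra.
have bu t : a < t < b -> boundary K (gam t) by move=> /inab[h _]; exact: bK.
have fin (P Q : C) : closure K P -> closure K Q -> across phi P < s < across phi Q -> False.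
  move=> cP cQ PQ; apply: (three_collinear cK Kd cP cQ PQ (bu _ r1) (bu _ r2) (bu _ r3) s1 s2 s3).
  - exact: ginj.
  - exact: ginj.
  - by apply: ginj => //; exact: lt_trans u23.
by case/orP: cr => h; [exact: (fin _ _ cu1 cu2 h)|exact: (fin _ _ cu2 cu1 h)].
Qed.

(** A line parallel to a fixed direction is parametrized by the point [expi x]
    at which it leaves the disk, so its level is [sin x]. The lines that
    separate the endpoints of an edge fill an interval of levels of length the
    projection of the edge, and the sine is 1-Lipschitz. *)
Lemma integral_crosses (y : R -> R) (M : R) (e : R * R) : 0 <= M ->
  `|y e.1| < 1 -> `|y e.2| < 1 ->
  ((M * `|y e.1 - y e.2|)%:E <=
   \int[mu]_(x in `[(- (pi / 2))%R, (pi / 2)%R])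
     (if crosses y (sin x) e then M else 0)%:E)%E.
Proof.
move=> M0.
wlog y12 : e / y e.1 <= y e.2 => [wl|].
  have [h|/ltW h] := leP (y e.1) (y e.2); first exact: wl.
  move=> h1 h2; have := wl (e.2, e.1) h h2 h1; rewrite /= distrC => /le_trans; apply.
  by apply: integral_mono => t _; rewrite /crosses/= orbC// lee_fin; case: ifP.
rewrite !ltr_norml => /andP[a1 b1] /andP[a2 b2].
have i1 : y e.1 \in `[(-1), 1] by rewrite in_itv/=; lra.
have i2 : y e.2 \in `[(-1), 1] by rewrite in_itv/=; lra.
have i1' : -1 <= y e.1 <= 1 by lra.
have i2' : -1 <= y e.2 <= 1 by lra.
have [x1 x1E] : exists x, x = asin (y e.1) by eexists.
have [x2 x2E] : exists x, x = asin (y e.2) by eexists.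
have s1 : sin x1 = y e.1 by rewrite x1E asinK.
have s2 : sin x2 = y e.2 by rewrite x2E asinK.
have r1 : - (pi / 2) <= x1 <= pi / 2 by rewrite x1E asin_geNpi2// asin_lepi2.
have r2 : - (pi / 2) <= x2 <= pi / 2 by rewrite x2E asin_geNpi2// asin_lepi2.
have x12 : x1 <= x2.
  rewrite leNgt; apply/negP => x21.
  have : sin x2 < sin x1 by rewrite ltr_sin// in_itv.
  by rewrite s1 s2 ltNge y12.
apply: (@le_trans _ _ (\int[mu]_(x in `]x1, x2[) M%:E)%E).
  rewrite integral_cst//= lebesgue_measure_itv/= lte_fin.
  have yx : `|y e.1 - y e.2| <= x2 - x1.
    by rewrite -s1 -s2 distrC; exact: sin_lipschitz.
  have [lt12|] := ltP x1 x2; first by rewrite -EFinM lee_fin ler_wpM2l.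
  move=> x21; rewrite mule0 lee_fin; have := mulr_ge0 M0 (normr_ge0 (y e.1 - y e.2)).
  have : x2 - x1 <= 0 by lra.
  by move=> h; have -> : `|y e.1 - y e.2| = 0; [apply/le_anti; rewrite normr_ge0 (le_trans yx)|rewrite mulr0].
have sub : `]x1, x2[ `<=` `[(- (pi / 2))%R, (pi / 2)%R].
  by move=> t /=; rewrite !in_itv/= => /andP[h1 h2]; lra.
have -> : (\int[mu]_(x in `]x1, x2[) M%:E =
    \int[mu]_(x in `]x1, x2[) (if crosses y (sin x) e then M else 0)%:E)%E.
  apply: eq_integral => x /set_mem; rewrite /= in_itv/= => /andP[h1 h2].
  have -> // : crosses y (sin x) e.
  have xI : x \in `[- (pi / 2), pi / 2] by rewrite in_itv/=; lra.
  by rewrite /crosses -s1 -s2 !ltr_sin ?in_itv//= ?h1 ?h2.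
apply: ge0_subset_integral => //; last by move=> x _; rewrite lee_fin; case: ifP.
apply/measurable_EFinP; apply: measurable_funTS; apply: measurable_fun_ifT => //.
have ms : measurable_fun setT (@sin R) by apply: continuous_measurable_fun; exact: continuous_sin.
by apply: measurable_or; apply: measurable_and; apply: measurable_fun_ltr.
Qed.

End Crossings.

(** * Arclength *)

Section Crofton.
Context {R : realType}.
Local Notation C := R[i]^o.
Local Notation normc := (@Normc.normc R).
Local Notation mu := (@lebesgue_measure R).

Lemma sum_crossing_le (y : R -> R) (s : R) (E : seq (R * R)) (M : R * R -> R) (h : \bar R) :
  (0 <= h)%E -> (forall e, e \in E -> crosses y s e -> ((M e)%:E <= h)%E) ->
  (\sum_(e <- E) (if crosses y s e then M e else 0)%:E <=
   (count (crosses y s) E)%:R%:E * h)%E.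
Proof.
move=> h0; elim: E => [|e E IH] H; first by rewrite big_nil mul0e.
have {}IH := IH (fun e' e'E => H e' (mem_behead (s := e :: E) e'E)).
rewrite big_cons /= natrD EFinD ge0_muleDl ?lee_fin//.
apply: leeD => //; case: ifP => cr; last by rewrite mul0e.
by rewrite mul1e; apply: H => //; exact: mem_head.
Qed.

(** Integrating over the lines of one direction the number of edges that are
    crossed, which is at most two, with the weights [M]. *)
Lemma crofton_direction (y : R -> R) (E : seq (R * R)) (M : R * R -> R) (h : R -> \bar R) :
  (forall e, 0 <= M e) ->
  (forall e, e \in E -> `|y e.1| < 1 /\ `|y e.2| < 1) ->
  (forall s, (count (crosses y s) E <= 2)%N) ->
  measurable_fun setT h -> (forall x, 0 <= h x)%E ->
  (forall e, e \in E -> forall x, - (pi / 2) <= x <= pi / 2 ->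
     crosses y (sin x) e -> ((M e)%:E <= h x)%E) ->
  ((\sum_(e <- E) M e * `|y e.1 - y e.2|)%:E <=
   2%:E * \int[mu]_(x in `[(- (pi / 2))%R, (pi / 2)%R]) h x)%E.
Proof.
move=> M0 y1 c2 mh h0 H.
apply: (@le_trans _ _ (\sum_(e <- E) \int[mu]_(x in `[(- (pi / 2))%R, (pi / 2)%R])
     (if crosses y (sin x) e then M e else 0)%:E)%E).
  rewrite -sumEFin big_seq_cond [leRHS]big_seq_cond.
  by apply: lee_sum => e /andP[/y1[h1 h2] _]; exact: integral_crosses.
have ms : measurable_fun setT (@sin R) by apply: continuous_measurable_fun; exact: continuous_sin.
rewrite -ge0_integral_sum//; last 2 first.
- move=> e; apply/measurable_EFinP; apply: measurable_funTS; apply: measurable_fun_ifT => //.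
  by apply: measurable_or; apply: measurable_and; apply: measurable_fun_ltr.
- by move=> e x _; rewrite lee_fin; case: ifP.
rewrite -ge0_integralZl_EFin//; last exact: measurable_funTS.
apply: integral_mono => x xI.
  by apply: sume_ge0 => e _; rewrite lee_fin; case: ifP.
apply: (le_trans (@sum_crossing_le y (sin x) E M (h x) (h0 x) _)).
  by move=> e eE; apply: H => //; move: xI; rewrite /= in_itv.
by rewrite lee_wpmul2r// lee_fin ler_nat.
Qed.

Section Arclength.
Variables (gam : R -> C).

Definition plen (c : R) (l : seq R) : R :=
  \sum_(e <- edges c l) normc (gam e.2 - gam e.1).

Lemma plen_cons c x l : plen c (x :: l) = normc (gam x - gam c) + plen x l.
Proof. by rewrite /plen edges_cons big_cons. Qed.

Lemma plen_cat c l1 l2 : plen c (l1 ++ l2) = plen c l1 + plen (last c l1) l2.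
Proof. by rewrite /plen edges_cat big_cat. Qed.

Lemma plen_ge0 c l : 0 <= plen c l.
Proof. by apply: sumr_ge0 => e _; exact: normc_ge0. Qed.

Lemma polygonal_lengthE a b l : polygonal_length gam a b l = plen a l.
Proof.
rewrite /polygonal_length; elim: l a => [|x l IH] a.
  by rewrite big_geq// /plen big_nil.
rewrite plen_cons -IH [size _]/= big_nat_recl//=; congr (_ + _).
Qed.

Lemma chord_le_plen c l : normc (gam (last c l) - gam c) <= plen c l.
Proof.
elim: l c => [|x l IH] c /=; first by rewrite subrr Normc.normc0 plen_ge0.
rewrite plen_cons; have := IH x; have := normc_tri (gam (last x l)) (gam x) (gam c); lra.
Qed.

Variables (a b : R).
Hypothesis rect : rectifiable gam a b.

Let ub_from t : a <= t -> t <= b -> has_ubound (polygonal_lengths gam a t).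
Proof.
move=> at_; rewrite le_eqVlt => /predU1P[-> //|tb].
have [x ux] := rect; exists x => _ [l [pl lt] <-].
apply: le_trans (ux (polygonal_length gam a b (rcons l b)) _).
  by rewrite !polygonal_lengthE -cats1 plen_cat lerDl plen_ge0.
by exists (rcons l b) => //; split; rewrite ?rcons_path ?pl ?(eqP lt)// last_rcons.
Qed.

Lemma plen_le_arclength t l : a <= t -> t <= b -> itv_partition a t l ->
  plen a l <= arclength gam a t.
Proof.
move=> at_ tb pl; rewrite -(polygonal_lengthE a t); apply: ub_le_sup; first exact: ub_from.
by exists l.
Qed.

Lemma arclength_start : arclength gam a a = 0.
Proof.
rewrite /arclength (_ : polygonal_lengths gam a a = [set 0]) ?sup1//.
apply/seteqP; split => [_ [l /itv_partitionxx -> <-]|_ ->].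
  by rewrite polygonal_lengthE /plen big_nil.
by exists [::]; [split|rewrite polygonal_lengthE /plen big_nil].
Qed.

Lemma arclength_chord t t' : a <= t -> t <= t' -> t' <= b ->
  arclength gam a t + normc (gam t' - gam t) <= arclength gam a t'.
Proof.
move=> at_; rewrite le_eqVlt => /predU1P[-> _|tt' tb].
  by rewrite subrr Normc.normc0 addr0.
rewrite -lerBrDr; apply: ge_sup.
  move: at_; rewrite le_eqVlt => /predU1P[<-|at_].
    by exists (polygonal_length gam a a [::]); exists [::].
  by exists (polygonal_length gam a t [:: t]); exists [:: t] => //; exact: itv_partition1.
move=> _ [l [pl lt] <-]; rewrite polygonal_lengthE lerBrDr.
have -> : plen a l + normc (gam t' - gam t) = plen a (rcons l t').
  by rewrite -cats1 plen_cat (eqP lt) plen_cons /plen big_nil addr0.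
apply: plen_le_arclength => //; first by rewrite (le_trans at_)// ltW.
by split; rewrite ?rcons_path ?pl ?(eqP lt)// last_rcons.
Qed.

Lemma arclength_le t t' : a <= t -> t <= t' -> t' <= b -> arclength gam a t <= arclength gam a t'.
Proof.
move=> h1 h2 h3; apply: le_trans (arclength_chord h1 h2 h3).
by rewrite lerDl normc_ge0.
Qed.

Lemma edge_of_arclength l s : itv_partition a b l -> a < b ->
  0 <= s <= arclength gam a b ->
  exists2 e, e \in edges a l & arclength gam a e.1 <= s <= arclength gam a e.2 /\
    exists2 t, e.1 <= t <= e.2 & arclength_param gam a b s = gam t.
Proof.
move=> [pl lb] ab /andP[s0 sL].
suff : forall c, a <= c -> arclength gam a c <= s -> c < b -> path <%R c l -> last c l == b ->
    exists2 e, e \in edges c l & arclength gam a e.1 <= s <= arclength gam a e.2 /\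
    exists2 t, e.1 <= t <= e.2 & arclength_param gam a b s = gam t.
  by apply => //; rewrite arclength_start.
elim: l {pl lb} => [|x l IH] c ac cs cb /=; first by move=> _ /eqP h; rewrite h ltxx in cb.
move=> /andP[cx pl] lb; rewrite edges_cons.
have xb : x <= b.
  case: l {IH} pl lb => [_ /eqP <- //|x' l pl /eqP <-].
  have := @edges_in R x (x' :: l) (x, x') pl; rewrite edges_cons mem_head => /(_ isT)[_ /ltW h1 h2].
  exact: le_trans h1 h2.
have supc : c <= sup [set t | t \in `[a, b] /\ arclength gam a t <= s].
  apply: ub_le_sup; first by exists b => t [/=]; rewrite in_itv/= => /andP[].
  by split => //; rewrite in_itv/= ac ltW.
have supx : (forall t, x < t -> t <= b -> s < arclength gam a t) ->
    sup [set t | t \in `[a, b] /\ arclength gam a t <= s] <= x.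
  move=> H; apply: ge_sup.
    by exists c; split => //; rewrite in_itv/= ac ltW.
  move=> t [/=]; rewrite in_itv/= => /andP[at_ tb] ts; rewrite leNgt; apply/negP => xt.
  by have := H t xt tb; rewrite ltNge ts.
have [xs|sx] := leP (arclength gam a x) s.
  have [xb'|] := ltP x b.
    have [e el he] := IH x (le_trans ac (ltW cx)) xs xb' pl lb.
    by exists e => //; rewrite inE el orbT.
  move=> bx; have xbE : x = b by apply/le_anti; rewrite xb.
  exists (c, x); rewrite ?mem_head//= ; split; first by rewrite cs xbE.
  exists (sup [set t | t \in `[a, b] /\ arclength gam a t <= s]) => //.
  by rewrite supc supx// => t; rewrite xbE => h1; rewrite leNgt h1.
exists (c, x); rewrite ?mem_head//=; split; first by rewrite cs ltW.
exists (sup [set t | t \in `[a, b] /\ arclength gam a t <= s]) => //.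
rewrite supc supx// => t xt tb; apply: lt_le_trans sx _.
by apply: arclength_le => //; [exact: le_trans ac (ltW cx)|exact: ltW].
Qed.

Lemma sum_edges_telescope (A : R -> R) c l : \sum_(e <- edges c l) (A e.2 - A e.1) = A (last c l) - A c.
Proof.
elim: l c => [|x l IH] c; first by rewrite big_nil subrr.
by rewrite edges_cons big_cons IH /=; ring.
Qed.

(** An upper Darboux sum of the arclength integral, with the lengths of arcs
    replaced by those of chords; this replacement costs at most [K] times the
    difference between the length of the curve and that of the polygon. *)
Lemma curve_int_le (F : C -> \bar R) (l : seq R) (M : R * R -> R) (K : R) :
  itv_partition a b l -> a < b -> (forall z, 0 <= F z)%E ->
  (forall e, 0 <= M e <= K) ->
  (forall e, e \in edges a l -> forall t, e.1 <= t <= e.2 -> (F (gam t) <= (M e)%:E)%E) ->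
  (curve_int gam a b F <=
   (\sum_(e <- edges a l) M e * normc (gam e.2 - gam e.1) +
    K * (arclength gam a b - plen a l))%:E)%E.
Proof.
move=> pl ab F0 M0K FM.
have M0 e : 0 <= M e by have /andP[] := M0K e.
have lb : last a l = b by apply/eqP; case: pl.
have [A AE] : exists A, A = arclength gam a by eexists.
have ein e : e \in edges a l -> [/\ a <= e.1, e.1 < e.2 & e.2 <= b].
  by case: pl => pl' _ /(edges_in pl'); rewrite lb.
have A12 e : e \in edges a l -> normc (gam e.2 - gam e.1) <= A e.2 - A e.1.
  move=> /ein[h1 h2 h3]; rewrite lerBrDl AE; apply: arclength_chord => //; exact: ltW.
have step1 : (curve_int gam a b F <=
    \int[mu]_(s in `[0%R, arclength gam a b])
      \sum_(e <- edges a l) (M e * \1_(`[A e.1, A e.2] : set R) s)%:E)%E.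
  apply: integral_mono => s; rewrite /= in_itv/= => sI; first exact: F0.
  have [e el [es [t te ->]]] := edge_of_arclength pl ab sI.
  apply: (le_trans (FM e el t te)).
  rewrite sumEFin lee_fin (big_rem e el)/=.
  rewrite indicE mem_set ?mulr1; last by rewrite /= in_itv/= AE.
  by rewrite lerDl; apply: sumr_ge0 => i _; rewrite mulr_ge0.
apply: (le_trans step1).
rewrite ge0_integral_sum//; last 2 first.
- by move=> e; apply/measurable_EFinP; apply: measurable_funM => //; exact: measurable_indic.
- by move=> e x _; rewrite lee_fin mulr_ge0.
apply: (@le_trans _ _ (\sum_(e <- edges a l) (M e * (A e.2 - A e.1))%:E)%E).
  rewrite big_seq_cond [leRHS]big_seq_cond; apply: lee_sum => e /andP[el _].
  under eq_integral do rewrite EFinM.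
  rewrite ge0_integralZl_EFin//; last first.
    by apply/measurable_EFinP; exact: measurable_indic.
  rewrite EFinM lee_wpmul2l ?lee_fin//.
  have mE : (mu `[A e.1, A e.2]%classic <= (A e.2 - A e.1)%:E)%E.
    rewrite lebesgue_measure_itv/= lte_fin; case: ifP => // _; rewrite lee_fin.
    by apply: le_trans (A12 _ el); exact: normc_ge0.
  rewrite integral_indic//= (le_trans (le_measure _ _ _ (@subIsetl _ _ _)))// ?inE//.
    exact: measurableI.
rewrite sumEFin lee_fin.
have -> : arclength gam a b - plen a l =
    \sum_(e <- edges a l) ((A e.2 - A e.1) - normc (gam e.2 - gam e.1)).
  by rewrite sumrB sum_edges_telescope lb AE arclength_start subr0.
rewrite mulr_sumr -big_split/= big_seq_cond [leRHS]big_seq_cond.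
apply: ler_sum => e /andP[el _].
have := A12 e el; have /andP[_ h2] := M0K e => h1.
rewrite -subr_ge0; have -> : M e * normc (gam e.2 - gam e.1) +
    K * (A e.2 - A e.1 - normc (gam e.2 - gam e.1)) - M e * (A e.2 - A e.1) =
    (K - M e) * (A e.2 - A e.1 - normc (gam e.2 - gam e.1)) by ring.
by rewrite mulr_ge0// subr_ge0.
Qed.

End Arclength.
End Crofton.

(** * Crofton's inequality for convex curves *)

Section CroftonCurve.
Context {R : realType}.
Local Notation C := R[i]^o.
Local Notation normc := (@Normc.normc R).
Local Notation mu := (@lebesgue_measure R).

Definition fine_mesh (gam : R -> C) (eta c : R) (l : seq R) : Prop :=
  forall e, e \in edges c l ->
    forall t t', e.1 <= t <= e.2 -> e.1 <= t' <= e.2 -> normc (gam t - gam t') <= eta.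

Lemma fine_cat gam eta c l1 l2 : fine_mesh gam eta c l1 -> fine_mesh gam eta (last c l1) l2 ->
  fine_mesh gam eta c (l1 ++ l2).
Proof.
by move=> f1 f2 e; rewrite edges_cat mem_cat => /orP[/f1|/f2].
Qed.

Lemma path_lt_last (c : R) l : path <%R c l -> c <= last c l.
Proof.
elim: l c => [//|x l IH] c /= /andP[cx /IH]; exact: le_trans (ltW cx).
Qed.

Lemma small_dyadic (Z d : R) : 0 <= Z -> 0 < d -> exists n : nat, Z / 2 ^+ n < d.
Proof.
move=> Z0 d0; have [n nE] : exists n : nat, n = Num.truncn (Z / d) by eexists.
exists n.+1; rewrite ltr_pdivrMr ?exprn_gt0// mulrC -ltr_pdivrMr//.
have /andP[_ h] := Num.Theory.truncn_itv (divr_ge0 Z0 (ltW d0)).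
rewrite -nE in h; apply: (lt_le_trans h).
by rewrite -natrX ler_nat ltnW// ltn_expl.
Qed.

(** Uniform continuity by bisection: an interval without a fine partition has
    a half without one, and nested halves shrink to a point at which [gam] is
    continuous. *)
Lemma fine_partition (gam : R -> C) (a b eta : R) : a < b ->
  {within `[a, b], continuous gam} -> 0 < eta ->
  exists2 l, itv_partition a b l & fine_mesh gam eta a l.
Proof.
move=> ab cg eta0; apply: contrapT => bad.
pose good x y := exists2 l, itv_partition x y l & fine_mesh gam eta x l.
pose h n : R := (b - a) / 2 ^+ n.
pose stp n x := if `[< good x (x + h n.+1) >] then x + h n.+1 else x.
pose x := fix x n := if n is n'.+1 then stp n' (x n') else a.
have h0 n : 0 < h n by rewrite divr_gt0 ?exprn_gt0// subr_gt0.
have hS n : h n = h n.+1 + h n.+1 by rewrite /h exprS; field; rewrite expf_neq0.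
have xS n : x n.+1 = stp n (x n) by [].
have xmono n : x n <= x n.+1 /\ x n.+1 + h n.+1 <= x n + h n.
  rewrite xS /stp; have := h0 n.+1; rewrite (hS n).
  by case: asboolP => _ hh; split; lra.
have badn n : ~ good (x n) (x n + h n).
  elim: n => [|n IH].
    by move=> g; apply: bad; move: g; rewrite /= /h expr0 divr1 addrC subrK.
  rewrite xS /stp; case: asboolP => // -[l1 pl1 f1] [l2 pl2 f2]; apply: IH.
  exists (l1 ++ l2).
    by rewrite (hS n) addrA; apply: itv_partition_cat pl1 pl2.
  by apply: fine_cat => //; case: pl1 => _ /eqP ->.
have [X HX] := @nested_intervals R x h (fun n => ltW (h0 n)) (fun n => (xmono n).1)
  (fun n => (xmono n).2).
have inab n : a <= x n /\ x n + h n <= b.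
  elim: n => [|n [h1 h2]]; first by rewrite /= /h expr0 divr1 addrC subrK.
  have [h3 h4] := xmono n; split; lra.
have Xab : X \in `[a, b].
  by have /andP[h1 h2] := HX 0%N; have [h3 h4] := inab 0%N; rewrite in_itv/=; apply/andP; split; lra.
have [d d0 Hd] : exists2 d, 0 < d & forall t, a <= t <= b -> `|t - X| < d ->
    normc (gam t - gam X) <= eta / 2.
  have : gam @ within `[a, b] (nbhs X) --> gam X.
    by rewrite (@nbhs_subspace_in _ `[a, b] X); [exact: cg|exact: Xab].
  move=> /cvg_normcP/(_ (eta / 2)); rewrite divr_gt0// => /(_ isT).
  rewrite near_withinE => /nbhs_ballP[d /= d0 Hd]; exists d => // t tab tX.
  by apply/ltW/Hd; rewrite /ball/= ?in_itv/= // distrC.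
have [n hn] : exists n : nat, h n < d by apply: small_dyadic => //; rewrite subr_ge0 ltW.
apply: (badn n); exists [:: x n + h n]; first by apply: itv_partition1; rewrite ltrDl.
move=> e; rewrite /edges/= inE => /eqP -> /= t t' tI t'I.
have [h1 h2] := inab n; have /andP[h3 h4] := HX n.
have near s : x n <= s <= x n + h n -> normc (gam s - gam X) <= eta / 2.
  move=> /andP[s1 s2]; apply: Hd; first by apply/andP; split; lra.
  by rewrite ltr_norml; apply/andP; split; lra.
have := normc_tri (gam t) (gam X) (gam t').
by rewrite (normcC (gam X)); have := near _ tI; have := near _ t'I; lra.
Qed.

(** Refining a subdivision can only lengthen the inscribed polygon. *)
Lemma refine_partition (gam : R -> C) (a b eta c : R) (l : seq R) :
  {within `[a, b], continuous gam} -> 0 < eta -> a <= c -> path <%R c l -> last c l = b ->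
  exists l', [/\ itv_partition c b l', plen gam c l <= plen gam c l' & fine_mesh gam eta c l'].
Proof.
move=> cg eta0; elim: l c => [|x l IH] c ac /=.
  by move=> _ cb; exists [::]; split => //; rewrite /itv_partition/= cb.
move=> /andP[cx pl] lb.
have xb : x <= b by rewrite -lb; exact: path_lt_last.
have [l2 [p2 h2 f2]] := IH x (le_trans ac (ltW cx)) pl lb.
have [l1 p1 f1] : exists2 l, itv_partition c x l & fine_mesh gam eta c l.
  apply: fine_partition => //; apply: continuous_subspaceW cg => t /=.
  by rewrite !in_itv/= => /andP[? ?]; apply/andP; split; [exact: le_trans ac _|exact: le_trans xb].
have lx : last c l1 = x by case: p1 => _ /eqP.
exists (l1 ++ l2); split; first exact: itv_partition_cat p1 p2.
  rewrite plen_cons plen_cat lx; have := chord_le_plen gam c l1; rewrite lx; lra.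
by apply: fine_cat => //; rewrite lx.
Qed.

Let between_close (s x1 x2 z eta : R) : - (eta / 2) <= z - x1 -> z - x1 <= eta / 2 ->
  - (eta / 2) <= x2 - x1 -> x2 - x1 <= eta / 2 -> x1 < s -> s < x2 ->
  - eta <= s - z <= eta.
Proof. by move=> *; apply/andP; split; lra. Qed.

Let between_close' (s x1 x2 z eta : R) : - (eta / 2) <= z - x1 -> z - x1 <= eta / 2 ->
  - (eta / 2) <= x2 - x1 -> x2 - x1 <= eta / 2 -> x2 < s -> s < x1 ->
  - eta <= s - z <= eta.
Proof. by move=> *; apply/andP; split; lra. Qed.

Let itv_slide (c d : R) : 0 < d -> 0 <= c -> c <= 3 * d ->
  [/\ - (2 * d) <= c - d <= 2 * d, c - d <= - (d / 2) + c & d / 2 + c <= c - d + 2 * d].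
Proof. by move=> *; split; [apply/andP; split; lra|lra|lra]. Qed.

(** The arclength integral of [F] over a convex curve is dominated by the
    integral over the circle of any [H] that, at each [xi], dominates [F] on
    the part of the curve lying in the Stolz cone of vertex [xi]. *)
Definition crofton_constant (alpha B : R) : Prop :=
  forall (gam : R -> C) (a b : R) (F : C -> R) (H : C -> \bar R),
    convex_curve gam a b -> (forall t, t \in `[a, b] -> disk (gam t)) ->
    (forall z, 0 <= F z) -> {within `[a, b], continuous (F \o gam)} ->
    measurable_fun setT (fun t => H (expi t)) -> (forall t, (0 <= H (expi t))%E) ->
    (forall t s, t \in `[a, b] -> stolz alpha (expi s) (gam t) ->
       ((F (gam t))%:E <= H (expi s))%E) ->
    (curve_int gam a b (EFin \o F) <= B%:E * circle_int H)%E.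

(** Inscribe in the curve a polygon of nearly the same length, so fine that
    [F] may be evaluated at the point [tm e] of each arc at which it is
    maximal. The directions [k delta] are chosen so that two consecutive ones
    enclose the direction of [tm e]. The projections of the edge across these
    two control its length by [two_directions]; and the parallel lines that
    cross the edge leave the disk, in these directions, at boundary points
    whose cones contain [tm e]. For each direction, integrating over the
    lines, each of which crosses at most two edges, gives twice the integral
    of [H]. *)
Lemma crofton (alpha : R) : 1 < alpha ->
  exists2 B : R, 0 <= B & crofton_constant alpha B.
Proof.
move=> a1; have a0 : 0 < alpha by rewrite (lt_trans _ a1).
have ai : alpha^-1 < 1 by rewrite invf_lt1.
have ai0 : 0 < alpha^-1 by rewrite invr_gt0.
have [k0 kE] : exists k, k = (1 + alpha^-1) / 2 by eexists.
have kI : -1 <= k0 <= 1 by apply/andP; split; lra.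
(* The angle allowed by [stolz_near] between the direction of a point and that
   of the lines. *)
have [delta dE] : exists d, d = acos k0 by eexists.
have cd : cos delta = k0 by rewrite dE acosK// in_itv.
have d0 : 0 < delta by rewrite dE acos_gt0//; lra.
have dpi : delta < pi by rewrite dE acos_ltpi//; lra.
have sd : 0 < sin delta by apply: sin_gt0_pi; rewrite d0.
have [N N1 N2] : exists2 N : nat, 2 * pi <= N%:R * delta & N%:R * delta <= 3 * pi.
  have pi0 := pi_gt0 R.
  have t0 : 0 <= 2 * pi / delta by rewrite divr_ge0 ?(ltW d0)// mulr_ge0// ltW.
  have /andP[h1 h2] := Num.Theory.truncn_itv t0.
  exists (Num.trunc (2 * pi / delta)).+1; first by rewrite -ler_pdivrMr// ltW.
  rewrite -natr1 mulrDl mul1r; move: h1; rewrite ler_pdivlMr// => h1; lra.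
(* The number of directions times the number of crossings, divided by the loss
   in [two_directions]. *)
exists (N.+1%:R * 2 / sin delta); first by rewrite divr_ge0 ?(ltW sd).
move=> gam a b F H cc gd F0 cF mH H0 FH.
have [ab cg rect inj _] := cc.
have [tK tKI HK] := EVT_max (ltW ab) cF.
pose K := F (gam tK) + 1.
have K0 : 0 < K by rewrite /K ltr_pwDr.
have cn : {within `[a, b], continuous (normc \o gam)}.
  by move=> t; exact: (continuous_comp (cg t) (@continuous_normc R (gam t))).
have [tn tnI Hn] := EVT_max (ltW ab) cn.
have n1 : normc (gam tn) < 1 by exact: gd.
have [kappa [kp0 kp1 Hkap]] : exists k, [/\ 0 < k, k < 1 &
    forall t, t \in `[a, b] -> normc (gam t) <= 1 - k].
  exists ((1 - normc (gam tn)) / 2); have := normc_ge0 (gam tn); split; [lra|lra|].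
  by move=> t /Hn /= h; lra.
have [eta eta0 Heta] := stolz_near a1 kp0 kp1.
apply/lee_addgt0Pr => eps eps0.
have eK0 : 0 < eps / K by rewrite divr_gt0.
have [l0 [pl0 ll0] hl0] : exists2 l, itv_partition a b l & arclength gam a b - eps / K < plen gam a l.
  have hs : has_sup (polygonal_lengths gam a b).
    split => //; exists (polygonal_length gam a b [:: b]); exists [:: b] => //.
    exact: itv_partition1.
  have [_ [l pl <-]] := sup_adherent eK0 hs.
  by rewrite polygonal_lengthE; exists l.
have [l [pl hl fl]] := refine_partition cg (divr_gt0 eta0 (ltr0Sn R 1)) (lexx a) pl0 (eqP ll0).
have ein e : e \in edges a l -> [/\ a <= e.1, e.1 < e.2 & e.2 <= b].
  by case: pl => pl' /eqP lb /(edges_in pl'); rewrite lb.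
have [tm Htm] : exists tm : R * R -> R, forall e, a <= e.1 -> e.1 < e.2 -> e.2 <= b ->
    e.1 <= tm e <= e.2 /\ forall t, e.1 <= t <= e.2 -> F (gam t) <= F (gam (tm e)).
  suff ex : forall e : R * R, exists x, a <= e.1 -> e.1 < e.2 -> e.2 <= b ->
      e.1 <= x <= e.2 /\ forall t, e.1 <= t <= e.2 -> F (gam t) <= F (gam x).
    by have [tm Htm] := boolp.choice ex; exists tm.
  move=> e.
  have [ae|/negP ae] := boolP (a <= e.1); last by exists 0.
  have [ee|/negP ee] := boolP (e.1 < e.2); last by exists 0.
  have [eb|/negP eb] := boolP (e.2 <= b); last by exists 0.
  have cF' : {within `[e.1, e.2], continuous (F \o gam)}.
    apply: continuous_subspaceW cF => t /=; rewrite !in_itv/= => /andP[? ?].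
    by apply/andP; split; [exact: le_trans ae _|exact: le_trans eb].
  have [x xI hx] := EVT_max (ltW ee) cF'.
  by exists x => _ _ _; split; [move: xI; rewrite in_itv|move=> t tI; apply: hx; rewrite in_itv].
pose M e := if e \in edges a l then F (gam (tm e)) else 0.
have tmab e : e \in edges a l -> tm e \in `[a, b].
  move=> /ein[h1 h2 h3]; have [/andP[h4 h5] _] := Htm e h1 h2 h3.
  by rewrite in_itv/= (le_trans h1 h4) (le_trans h5 h3).
have M0K e : 0 <= M e <= K.
  rewrite /M; case: ifP => [el|_]; last by rewrite lexx ltW.
  by rewrite F0 /= /K; have := HK _ (tmab e el) => /= h; lra.
have M0 e : 0 <= M e by have /andP[] := M0K e.
have FM e : e \in edges a l -> forall t, e.1 <= t <= e.2 -> ((EFin \o F) (gam t) <= (M e)%:E)%E.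
  move=> el t te; rewrite lee_fin /M el; have [h1 h2 h3] := ein e el.
  by have [_] := Htm e h1 h2 h3; exact.
apply: (le_trans (curve_int_le rect pl ab _ M0K FM)).
  by move=> z; rewrite lee_fin.
have Keps : K * (arclength gam a b - plen gam a l) <= eps.
  rewrite mulrC -ler_pdivlMr//; lra.
rewrite EFinD leeD// ?lee_fin//.
pose y k := across (k%:R * delta) \o gam.
(* The edges that are accounted for by the direction [k delta]. *)
pose near k e := k0 * normc (gam (tm e)) <= along (k%:R * delta) (gam (tm e)).
pose D k := \sum_(e <- edges a l | near k e) M e * `|y k e.1 - y k e.2|.
have yB k e : `|y k e.1 - y k e.2| = `|across (k%:R * delta) (gam e.2 - gam e.1)|.
  by rewrite distrC acrossB.
have total : (\sum_(e <- edges a l) M e * normc (gam e.2 - gam e.1)) * sin delta <=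
    \sum_(k < N.+1) D k.
  rewrite /D (eq_bigr (fun k : 'I_N.+1 => \sum_(e <- edges a l)
    (if near k e then M e * `|y k e.1 - y k e.2| else 0))); last by move=> k _; rewrite -big_mkcond.
  rewrite exchange_big mulr_suml; apply: ler_sum => e _ /=.
  have [k kN [c1 c2]] := sector (gam (tm e)) d0 (ltW dpi) N1.
  rewrite cd in c1 c2.
  have kS : k.+1%:R * delta = k%:R * delta + delta by rewrite -natr1 mulrDl mul1r.
  rewrite -kS in c2.
  have i1 : (k < N.+1)%N by exact: ltnW.
  rewrite (bigD1 (Ordinal i1))//= (bigD1 (Ordinal (kN : (k.+1 < N.+1)%N)))/=; last first.
    by rewrite -val_eqE/= gtn_eqF.
  rewrite /near c1 c2 addrA -mulrDr !yB -mulrA.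
  apply: (@le_trans _ _ (M e * (`|across (k%:R * delta) (gam e.2 - gam e.1)| +
      `|across (k.+1%:R * delta) (gam e.2 - gam e.1)|))).
    by rewrite ler_wpM2l// kS; apply: two_directions; exact: ltW.
  by rewrite lerDl; apply: sumr_ge0 => i _; case: ifP => // _; rewrite mulr_ge0.
have dir k : (k <= N)%N -> ((D k)%:E <= 2%:E * circle_int H)%E.
  move=> kN; pose h x := H (expi (k%:R * delta + x)).
  have mh : measurable_fun setT h.
    have mk : measurable_fun setT (fun x : R => k%:R * delta + x) by exact: measurable_funD.
    exact: (measurableT_comp mH mk).
  have h0 x : (0 <= h x)%E by exact: H0.
  rewrite /D -big_filter.
  apply: (@le_trans _ _ (2%:E * \int[mu]_(x in `[(- (pi / 2))%R, (pi / 2)%R]) h x)%E).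
    apply: (crofton_direction M0) => //.
    - move=> e; rewrite mem_filter => /andP[_ /ein[h1 h2 h3]].
      have i1 : e.1 \in `[a, b] by rewrite in_itv/= h1 (le_trans (ltW h2)).
      have i2 : e.2 \in `[a, b] by rewrite in_itv/= h3 (le_trans h1 (ltW h2)).
      by split; apply: (le_lt_trans (across_le _ _)); exact: gd.
    - move=> s; apply: leq_trans (line_crosses_twice (k%:R * delta) s cc pl).
      exact/leq_count_subseq/filter_subseq.
    - move=> e; rewrite mem_filter => /andP[ne el] x xI cr.
      rewrite /M el; apply: FH; first exact: tmab.
      have [h1 h2 h3] := ein e el; have [te _] := Htm e h1 h2 h3.
      apply: Heta; [exact/Hkap/tmab|by rewrite -kE|by apply: cos_ge0_pihalf|].
      have e1I : e.1 <= e.1 <= e.2 by rewrite lexx ltW.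
      have e2I : e.1 <= e.2 <= e.2 by rewrite lexx ltW.
      have f1 := fl e el _ _ te e1I; have f2 := fl e el _ _ e2I e1I.
      have g1 := across_le (k%:R * delta) (gam (tm e) - gam e.1).
      have g2 := across_le (k%:R * delta) (gam e.2 - gam e.1).
      rewrite !acrossB in g1 g2.
      have {f1}g1 := le_trans g1 f1; have {f2}g2 := le_trans g2 f2.
      move: g1 g2; rewrite !ler_norml => /andP[u1 u2] /andP[u3 u4].
      case/orP: cr => /andP[/= v1 v2]; rewrite /y/= in v1 v2.
        by move: u1 u2 u3 u4 v1 v2; exact: between_close.
      by move: u1 u2 u3 u4 v1 v2; exact: between_close'.
  apply: lee_wpmul2l; first by rewrite lee_fin.
  have pi0 := pi_gt0 R.
  have kd0 : 0 <= k%:R * delta by rewrite mulr_ge0// ltW.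
  have kd1 : k%:R * delta <= 3 * pi.
    by apply: le_trans N2; rewrite ler_wpM2r ?(ltW d0)// ler_nat.
  have [sl1 sl2 sl3] := itv_slide pi0 kd0 kd1.
  (* The lines of one direction leave the disk on a half circle; its integral
     is at most that over the whole circle. *)
  rewrite -(@circle_int_periodic R H (k%:R * delta - pi))//.
  have -> : (\int[mu]_(x in `[(- (pi / 2))%R, (pi / 2)%R]) h x =
      \int[mu]_(x in `[(- (pi / 2) + k%:R * delta)%R, (pi / 2 + k%:R * delta)%R[) H (expi x))%E.
    rewrite integral_itv_cc// integral_shift//.
    by apply: eq_integral => x _; rewrite /h addrC.
  exact: itv_co_sub.
have dirs n : (n <= N.+1)%N -> ((\sum_(k < n) D k)%:E <= (n%:R * 2)%:E * circle_int H)%E.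
  have ci0 : (0 <= circle_int H)%E by apply: integral_ge0 => t _; exact: H0.
  elim: n => [|n IH] nN; first by rewrite big_ord0 mul0r mul0e.
  rewrite big_ord_recr/= EFinD -natr1 mulrDl mul1r EFinD ge0_muleDl ?lee_fin//.
  by apply: leeD; [exact/IH/ltnW|exact: dir].
have -> : \sum_(e <- edges a l) M e * normc (gam e.2 - gam e.1) =
    (sin delta)^-1 * ((\sum_(e <- edges a l) M e * normc (gam e.2 - gam e.1)) * sin delta).
  by rewrite mulrC mulfK// gt_eqF.
apply: (@le_trans _ _ ((sin delta)^-1 * \sum_(k < N.+1) D k)%:E).
  by rewrite lee_fin ler_wpM2l// invr_ge0 ltW.
rewrite (mulrC _ (sin delta)^-1) !EFinM -muleA; apply: lee_wpmul2l.
  by rewrite lee_fin invr_ge0 ltW.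
by rewrite -EFinM; exact: dirs.
Qed.

End CroftonCurve.

(** * The Poisson kernel in a Stolz cone *)

Section Kernel.
Context {R : realType}.
Local Notation C := R[i]^o.
Local Notation normc := (@Normc.normc R).
Local Notation mu := (@lebesgue_measure R).

(** A sixth of the length of a dyadic arc of depth [n]: this leaves room for
    an arc of this radius to be contained in a dyadic arc of one of two grids. *)
Definition arc_radius (n : nat) : R := pi / 3 / 2 ^+ n.

Lemma arc_radius_gt0 n : 0 < arc_radius n.
Proof. by rewrite /arc_radius !divr_gt0 ?exprn_gt0// pi_gt0. Qed.

Lemma arc_radiusS n : arc_radius n = 2 * arc_radius n.+1.
Proof. by rewrite /arc_radius exprS; field; rewrite expf_neq0. Qed.

Lemma arc_radius_scale (delta : R) : 0 < delta -> delta <= 1 ->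
  exists N, arc_radius N <= delta /\ delta < 2 * arc_radius N.
Proof.
move=> d0 d1.
have ex : exists n, arc_radius n <= delta.
  have [n hn] := @small_dyadic R (pi / 3) delta (divr_ge0 (pi_ge0 R) (ler0n _ _)) d0.
  by exists n; exact: ltW.
have [N PN minN] := ex_minnP ex.
exists N; split => //; case: N PN minN => [_ _|N PN minN].
  by rewrite /arc_radius expr0 divr1; have := pi_ge2 R; lra.
rewrite -arc_radiusS ltNge; apply/negP => h.
by have := minN N h; rewrite ltnn.
Qed.

Section Stolz.
Variables (beta theta : R) (a : C).
Hypothesis beta1 : 1 < beta.
Hypothesis aS : stolz beta (expi theta) a.
Let delta := 1 - normc a.
Let b2 := (1 + beta) ^+ 2.

Let delta0 : 0 < delta.
Proof. by rewrite /delta subr_gt0; case: aS. Qed.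
Let delta1 : delta <= 1.
Proof. by rewrite /delta lerBlDr lerDl normc_ge0. Qed.
Let beta0 : 0 <= beta.
Proof. exact: ltW (lt_trans ltr01 beta1). Qed.
Let b20 : 1 <= b2.
Proof. by rewrite /b2 exprn_ege1// lerDl. Qed.
Let b2_ge0 : 0 <= b2.
Proof. exact: le_trans ler01 b20. Qed.

Let coef_ge0 (k : R) n : 0 <= k -> 0 <= k * b2 * delta / arc_radius n ^+ 2.
Proof.
move=> k0; apply: divr_ge0; last exact: sqr_ge0.
by apply: mulr_ge0; [exact: mulr_ge0|exact: ltW].
Qed.

Lemma poisson_near t : poisson a t <= 2 / delta.
Proof.
have [a1 _] := aS.
have h1 : delta <= normc (expi t - a).
  by have := normc_subr (expi t) a; rewrite normc_expi.
rewrite /poisson ler_pdivrMr ?exprn_gt0 ?(lt_le_trans delta0)//.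
apply: (@le_trans _ _ (2 / delta * delta ^+ 2)).
  rewrite expr2 mulrA divfK ?gt_eqF//.
  have -> : 1 - normc a ^+ 2 = (1 + normc a) * delta by rewrite /delta; ring.
  by rewrite ler_wpM2r ?(ltW delta0)//; rewrite /disk/mkset in a1; lra.
rewrite ler_wpM2l ?divr_ge0 ?(ltW delta0)// ler_pXn2r// nnegrE ?normc_ge0//.
exact: ltW.
Qed.

(** In a Stolz cone of vertex [expi theta], the distance from [a] to [expi t]
    is comparable to that from [expi theta] to [expi t], up to the aperture. *)
Lemma poisson_far t k : 0 < k -> k <= `|t - theta| -> `|t - theta| <= pi ->
  poisson a t <= 8 * b2 * delta / k ^+ 2.
Proof.
move=> k0 kt tpi; have [a1 aS2] := aS.
have h1 : delta <= normc (expi t - a).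
  by have := normc_subr (expi t) a; rewrite normc_expi.
have h2 : k / 2 <= (1 + beta) * normc (expi t - a).
  have h3 : k / 2 <= normc (expi t - expi theta).
    by apply: le_trans (normc_expiB_ge tpi); rewrite ler_wpM2r.
  have h4 := normc_tri (expi t) a (expi theta).
  have h5 : beta * delta <= beta * normc (expi t - a) by rewrite ler_wpM2l.
  rewrite mulrDl mul1r; move: aS2; rewrite -/delta; lra.
have n0 : 0 < normc (expi t - a) by exact: lt_le_trans h1.
rewrite /poisson ler_pdivrMr ?exprn_gt0//.
have -> : 8 * b2 * delta / k ^+ 2 * normc (expi t - a) ^+ 2 =
    2 * delta * ((1 + beta) * normc (expi t - a) / (k / 2)) ^+ 2.
  by rewrite /b2; field; rewrite gt_eqF.
have -> : 1 - normc a ^+ 2 = (1 + normc a) * delta by rewrite /delta; ring.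
apply: (@le_trans _ _ (2 * delta)).
  by rewrite ler_wpM2r ?(ltW delta0)//; rewrite /disk/mkset in a1; lra.
rewrite ler_peMr ?mulr_ge0 ?(ltW delta0)// exprn_ege1//.
by rewrite ler_pdivlMr ?divr_gt0// mul1r.
Qed.

(** The Poisson kernel is dominated by a superposition of indicators of arcs
    about the vertex: [poisson_far] between two consecutive radii, and
    [poisson_near] on the smallest arc, whose radius is comparable to the
    distance from [a] to the circle. *)
Lemma poisson_dyadic N t : arc_radius N <= delta -> delta < 2 * arc_radius N ->
  theta - pi <= t < theta + pi ->
  poisson a t <= 8 * b2 * delta / arc_radius 0 ^+ 2 +
    \sum_(n < N.+1) 32 * b2 * delta / arc_radius n ^+ 2 *
      \1_(`[theta - arc_radius n, theta + arc_radius n[%classic : set R) t.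
Proof.
move=> N1 N2 /andP[t1 t2].
have tpi : `|t - theta| <= pi by rewrite ler_norml; apply/andP; split; lra.
have c0 n : 0 <= 32 * b2 * delta / arc_radius n ^+ 2.
  exact: coef_ge0.
have s0 m : 0 <= \sum_(n < m) 32 * b2 * delta / arc_radius n ^+ 2 *
      \1_(`[theta - arc_radius n, theta + arc_radius n[%classic : set R) t.
  by apply: sumr_ge0 => n _; rewrite mulr_ge0.
have out n : ~ (`[theta - arc_radius n, theta + arc_radius n[%classic t) ->
    arc_radius n <= `|t - theta|.
  rewrite /= in_itv/= => /negP; rewrite negb_and -ltNge -leNgt => /orP[h|h].
    by rewrite distrC ler_normr; apply/orP; left; lra.
  by rewrite ler_normr; apply/orP; left; lra.
have [tN|tN] := pselect (`[theta - arc_radius N, theta + arc_radius N[%classic t).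
  rewrite big_ord_recr/= indicE mem_set// mulr1.
  apply: (@le_trans _ _ (32 * b2 * delta / arc_radius N ^+ 2)); last first.
    by rewrite addrA lerDr; apply: addr_ge0; [exact: coef_ge0|exact: s0].
  apply: (le_trans (poisson_near t)).
  rewrite ler_pdivrMr// mulrAC ler_pdivlMr ?exprn_gt0 ?arc_radius_gt0//.
  have : arc_radius N ^+ 2 <= delta ^+ 2.
    by rewrite ler_pXn2r// nnegrE ?(ltW delta0)// ltW// arc_radius_gt0.
  have : delta ^+ 2 <= b2 * delta ^+ 2 by rewrite ler_peMl// sqr_ge0.
  have := sqr_ge0 delta.
  by rewrite (_ : 32 * b2 * delta * delta = 32 * (b2 * delta ^+ 2)); [lra|ring].
elim: N {N1 N2} tN => [|N IH] tN.
  by apply: (le_trans (poisson_far (arc_radius_gt0 0) (out _ tN) tpi)); rewrite lerDl.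
rewrite big_ord_recr/= addrA.
have [tN'|tN'] := pselect (`[theta - arc_radius N, theta + arc_radius N[%classic t).
  apply: (le_trans (poisson_far (arc_radius_gt0 _) (out _ tN) tpi)).
  have i1 : \1_(`[theta - arc_radius N, theta + arc_radius N[%classic : set R) t = 1 :> R.
    by rewrite indicE mem_set.
  rewrite big_ord_recr/= i1 mulr1.
  have -> : 8 * b2 * delta / arc_radius N.+1 ^+ 2 = 32 * b2 * delta / arc_radius N ^+ 2.
    by rewrite (arc_radiusS N); field; rewrite gt_eqF// arc_radius_gt0.
  rewrite addrA addrAC lerDr; apply: addr_ge0; last by rewrite mulr_ge0.
  by apply: addr_ge0; [exact: coef_ge0|exact: s0].
by apply: (le_trans (IH tN')); rewrite lerDl mulr_ge0.
Qed.

Lemma sum_inv_radius N : \sum_(n < N.+1) (arc_radius n)^-1 <= 2 / arc_radius N.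
Proof.
elim: N => [|N IH]; first by rewrite big_ord1 ler_peMl ?invr_ge0 ?(ltW (arc_radius_gt0 _))// ler1n.
rewrite big_ord_recr/=; have -> : 2 / arc_radius N.+1 = 2 / arc_radius N + (arc_radius N.+1)^-1.
  by rewrite (arc_radiusS N); field; rewrite gt_eqF// arc_radius_gt0.
by rewrite lerD2r.
Qed.

(** Averages over the arcs about the vertex dominate Poisson integrals in its
    Stolz cone: each arc contributes its average times [delta / arc_radius n],
    and these coefficients form a geometric series. *)
Lemma poisson_maximal (f : R -> R) (A : R) : 0 <= A ->
  measurable_fun setT f -> (forall t, 0 <= f t) ->
  (forall n, (\int[mu]_(t in `[(theta - arc_radius n)%R, (theta + arc_radius n)%R[) (f t)%:E <=
     (2 * arc_radius n * A)%:E)%E) ->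
  (\int[mu]_(t in `[(theta - pi)%R, (theta + pi)%R[) (f t)%:E <= (2 * pi * A)%:E)%E ->
  (\int[mu]_(t in `[(theta - pi)%R, (theta + pi)%R[) (poisson a t * f t)%:E <=
    ((1 + beta) ^+ 2 * (16 * pi / arc_radius 0 ^+ 2 + 256) * A)%:E)%E.
Proof.
move=> A0 mf f0 fn fpi.
have [N [N1 N2]] := arc_radius_scale delta0 delta1.
pose c n := 32 * b2 * delta / arc_radius n ^+ 2.
pose c' := 8 * b2 * delta / arc_radius 0 ^+ 2.
pose J n := `[theta - arc_radius n, theta + arc_radius n[%classic : set R.
have c0 n : 0 <= c n.
  exact: coef_ge0.
have c'0 : 0 <= c'.
  exact: coef_ge0.
have mEf : measurable_fun setT (EFin \o f) by exact/measurable_EFinP.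
have mJs n : measurable (J n) by exact: measurable_itv.
have mJ n : measurable_fun setT (fun t => (\1_(J n) t * f t)%:E).
  by apply/measurable_EFinP; apply: measurable_funM => //; exact: measurable_indic.
have J0 n t : (0 <= (\1_(J n) t * f t)%:E)%E by rewrite lee_fin mulr_ge0.
apply: (@le_trans _ _ (\int[mu]_(t in `[(theta - pi)%R, (theta + pi)%R[)
    (c'%:E * (f t)%:E + \sum_(n < N.+1) (c n)%:E * (\1_(J n) t * f t)%:E))%E).
  apply: integral_mono => t; rewrite /= in_itv/= => tI.
    rewrite lee_fin mulr_ge0// /poisson divr_ge0 ?sqr_ge0// subr_ge0 expr_le1 ?normc_ge0//.
    by case: aS => /ltW.
  under eq_bigr do rewrite -EFinM.
  rewrite sumEFin -EFinM -EFinD lee_fin.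
  have -> : c' * f t + \sum_(n < N.+1) c n * (\1_(J n) t * f t) =
      (c' + \sum_(n < N.+1) c n * \1_(J n) t) * f t.
    by rewrite mulrDl mulr_suml; congr (_ + _); apply: eq_bigr => n _; rewrite mulrA.
  by rewrite ler_wpM2r//; exact: poisson_dyadic.
rewrite ge0_integralD//; last 4 first.
- by move=> t _; rewrite mule_ge0 ?lee_fin.
- by apply: measurable_funTS; exact: measurable_funeM.
- by move=> t _; apply: sume_ge0 => n _; apply: mule_ge0; [rewrite lee_fin; exact: c0|exact: J0].
- by apply: emeasurable_sum => n; apply: measurable_funTS; exact: (measurable_funeM _ (mJ n)).
rewrite ge0_integral_sum//; last 2 first.
- by move=> n; apply: measurable_funTS; exact: (measurable_funeM _ (mJ n)).
- by move=> n t _; apply: mule_ge0; [rewrite lee_fin; exact: c0|exact: J0].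
rewrite ge0_integralZl_EFin//; last 2 first.
- by move=> t _; rewrite lee_fin.
- exact: measurable_funTS.
have Jle (n : 'I_N.+1) : (\int[mu]_(t in `[(theta - pi)%R, (theta + pi)%R[)
    ((c n)%:E * (\1_(J n) t * f t)%:E)%E <= (64 * b2 * delta * A / arc_radius n)%:E)%E.
  rewrite ge0_integralZl_EFin; [|by []|by move=> t _; exact: J0|exact: (measurable_funTS (mJ n))|exact: c0].
  have -> : 64 * b2 * delta * A / arc_radius n = c n * (2 * arc_radius n * A).
    by rewrite /c; field; rewrite gt_eqF// arc_radius_gt0.
  rewrite [leRHS]EFinM; apply: lee_wpmul2l; first by rewrite lee_fin; exact: c0.
  apply: le_trans (fn n).
  rewrite -/(J n); have -> : (\int[mu]_(t in `[(theta - pi)%R, (theta + pi)%R[) (\1_(J n) t * f t)%:E =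
      \int[mu]_(t in `[(theta - pi)%R, (theta + pi)%R[) ((EFin \o f) \_ (J n)) t)%E.
    apply: eq_integral => t _; rewrite patchE indicE; case: ifP => h; rewrite /= ?mul1r ?mul0r//.
  rewrite -integral_mkcondr; apply: ge0_subset_integral.
  - by apply: measurableI; [exact: measurable_itv|exact: mJs].
  - exact: mJs.
  - exact: measurable_funTS.
  - by move=> t _; rewrite lee_fin.
  - exact: subIsetr.
have -> : (1 + beta) ^+ 2 * (16 * pi / arc_radius 0 ^+ 2 + 256) * A =
    8 * b2 / arc_radius 0 ^+ 2 * (2 * pi * A) + 256 * b2 * A by rewrite -/b2; ring.
rewrite EFinD leeD//.
  apply: (@le_trans _ _ (c'%:E * (2 * pi * A)%:E)%E).
    by rewrite lee_wpmul2l// lee_fin.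
  rewrite -EFinM lee_fin ler_wpM2r ?mulr_ge0 ?pi_ge0// /c'.
  by rewrite ler_wpM2r ?invr_ge0 ?sqr_ge0// ler_piMr// mulr_ge0.
apply: (@le_trans _ _ (\sum_(n < N.+1) (64 * b2 * delta * A / arc_radius n)%:E)%E).
  by apply: lee_sum => n _; exact: Jle.
rewrite sumEFin lee_fin -mulr_sumr.
apply: (@le_trans _ _ (64 * b2 * delta * A * (2 / arc_radius N))).
  apply: ler_wpM2l; last exact: sum_inv_radius.
  by apply: mulr_ge0 => //; apply: mulr_ge0; [exact: mulr_ge0|exact: ltW].
have -> : 64 * b2 * delta * A * (2 / arc_radius N) = (128 * b2 * A) * (delta / arc_radius N).
  by field; rewrite gt_eqF// arc_radius_gt0.
have -> : 256 * b2 * A = (128 * b2 * A) * 2 by ring.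
apply: ler_wpM2l; first by apply: mulr_ge0 => //; exact: mulr_ge0.
by rewrite ler_pdivrMr ?arc_radius_gt0// ltW.
Qed.

End Stolz.
End Kernel.

(** * Fatou's theorem *)

Section Fatou.
Context {R : realType}.
Local Notation C := R[i]^o.
Local Notation normc := (@Normc.normc R).
Local Notation mu := (@lebesgue_measure R).

Lemma measurable_norm_comp (h : R -> R) : measurable_fun setT h ->
  measurable_fun setT (fun t => `|h t|).
Proof. by move=> mh; exact: (measurableT_comp (@normr_measurable R setT) mh). Qed.

Lemma integral_itv_expi (H : R -> \bar R) (G : C -> \bar R) (theta : R) :
  (forall t, H t = G (expi t)) -> measurable_fun setT H -> (forall t, 0 <= H t)%E ->
  0 <= theta < 2 * pi ->
  (\int[mu]_(t in `[0%R, (2 * pi)%R]) H t =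
   \int[mu]_(t in `[(theta - pi)%R, (theta + pi)%R[) H t)%E.
Proof.
move=> HG mH H0 /andP[t0 t1]; have pi0 := pi_gt0 R.
have -> : H = (fun t => G (expi t)) by exact/funext.
have -> : theta + pi = theta - pi + 2 * pi by ring.
rewrite -/(circle_int G) -(@circle_int_periodic _ G (theta - pi)).
- by [].
- by move: mH; congr (measurable_fun _ _); exact/funext.
- by move=> t; rewrite -HG.
- by apply/andP; split; lra.
Qed.

Definition poisson_integral (u V : C -> R) : Prop :=
  [/\ measurable_fun setT (fun t : R => V (expi t)),
      mu.-integrable `[0, 2 * pi] (EFin \o (fun t => V (expi t))) &
      forall a, normc a < 1 ->
        \int[mu]_(t in `[0, 2 * pi]) (poisson a t * V (expi t)) = 2 * pi * u a].

Section PoissonIntegral.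
Variables (u V : C -> R) (beta theta : R).
Hypothesis uV : poisson_integral u V.
Hypothesis beta1 : 1 < beta.
Hypothesis thetaI : 0 <= theta < 2 * pi.

Let mV : measurable_fun setT (fun t : R => V (expi t)). Proof. by case: uV. Qed.

Let mVc c : measurable_fun setT (fun t : R => `|V (expi t) - c|).
Proof.
by apply: measurable_norm_comp; exact: measurable_funB.
Qed.

Let mP a : normc a < 1 -> measurable_fun setT (poisson a).
Proof. by move=> a1; apply: continuous_measurable_fun; exact: continuous_poisson. Qed.

Lemma integral_deviation c :
  (\int[mu]_(t in `[(theta - pi)%R, (theta + pi)%R[) `|V (expi t) - c|%:E < +oo)%E.
Proof.
rewrite -(@integral_itv_expi _ (fun z => `|V z - c|%:E))//.
- have ci : mu.-integrable `[0, 2 * pi] (EFin \o cst c).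
    exact/integrable_continuous/cst_continuous.
  have [_ Vi _] := uV.
  have : mu.-integrable `[0, 2 * pi] (EFin \o (fun t => V (expi t) - c)).
    by apply: (integrableB _ Vi ci); exact: measurable_itv.
  by move=> /integrableP[_].
by apply/measurable_EFinP; exact: mVc.
Qed.

(** The Poisson kernel has mean one, so a constant may be subtracted from both
    sides. *)
Lemma poisson_deviation (a : C) c : stolz beta (expi theta) a ->
  ((2 * pi * `|u a - c|)%:E <=
   \int[mu]_(t in `[(theta - pi)%R, (theta + pi)%R[) (poisson a t * `|V (expi t) - c|)%:E)%E.
Proof.
move=> aS; have [a1 _] := aS; have [_ Vi Hu] := uV.
have P0 t : 0 <= poisson a t by exact: poisson_ge0.
have d0 : 0 < 1 - normc a by rewrite subr_gt0.
have ci : mu.-integrable `[0, 2 * pi] (EFin \o cst c).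
  exact/integrable_continuous/cst_continuous.
have intP (k : R -> R) : measurable_fun setT k -> mu.-integrable `[0, 2 * pi] (EFin \o k) ->
    mu.-integrable `[0, 2 * pi] (EFin \o (fun t => poisson a t * k t)).
  move=> mk ki.
  have i2 : mu.-integrable `[0, 2 * pi] (fun t => ((2 / (1 - normc a))%:E * (EFin \o k) t)%E).
    exact: integrableZl.
  apply: (le_integrable _ _ _ i2); first exact: measurable_itv.
    apply/measurable_EFinP; apply: measurable_funTS; apply: measurable_funM => //.
    exact: mP.
  move=> t _; have h : `|poisson a t| <= `|2 / (1 - normc a)|.
    rewrite (ger0_norm (P0 t)); apply: le_trans (ler_norm _).
    exact: (poisson_near aS).
  rewrite lee_fin; apply: (@le_trans _ _ (`|poisson a t| * `|k t|)).
    by rewrite (normrM (poisson a t)).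
  by rewrite (normrM (2 / (1 - normc a))); exact: ler_wpM2r.
have pv := intP _ mV Vi.
have pc := intP _ (measurable_cst c) ci.
have cc : \int[mu]_(t in `[0, 2 * pi]) (poisson a t * c) = 2 * pi * c.
  have -> : \int[mu]_(t in `[0, 2 * pi]) (poisson a t * c) =
      \int[mu]_(t in `[0, 2 * pi]) (c * poisson a t).
    by apply: eq_Rintegral => t _; rewrite mulrC.
  rewrite RintegralZl_itv ?Rintegral_poisson 1?mulrC//.
  exact/integrable_continuous/continuous_poisson.
have E : 2 * pi * (u a - c) =
    \int[mu]_(t in `[0, 2 * pi]) (poisson a t * (V (expi t) - c)).
  rewrite mulrBr -Hu// -cc -RintegralB//.
  by apply: eq_Rintegral => t _; rewrite mulrBr.
have pvc : mu.-integrable `[0, 2 * pi] (EFin \o (fun t => poisson a t * (V (expi t) - c))).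
  apply: intP; first exact: measurable_funB.
  by apply: (integrableB _ Vi ci); exact: measurable_itv.
have -> : 2 * pi * `|u a - c| = `|2 * pi * (u a - c)|.
  by rewrite normrM (ger0_norm (_ : 0 <= 2 * pi))// mulr_ge0// pi_ge0.
rewrite E; apply: (@le_trans _ _ (\int[mu]_(t in `[0, 2 * pi])
    `|poisson a t * (V (expi t) - c)|)%:E).
  by rewrite lee_fin; exact: le_normr_Rintegral.
rewrite -integral_Rintegral; last first.
  exact: (integrable_norm pvc).
rewrite (@integral_itv_expi _ (fun z => `|(1 - normc a ^+ 2) / normc (z - a) ^+ 2 * (V z - c)|%:E) theta)//.
- apply: integral_mono => t _; first by rewrite lee_fin.
  by rewrite normrM ger0_norm.
- apply/measurable_EFinP; apply: measurable_norm_comp.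
  by apply: measurable_funM; [exact: mP|exact: measurable_funB].
Qed.

(** Fatou's theorem at Lebesgue points. Near the vertex the averages of the
    deviation are small at every scale, and [poisson_maximal] applies; away
    from it the kernel tends to zero uniformly by [poisson_far], being
    proportional to the distance from [a] to the circle. *)
Lemma fatou : lebesgue_pt (fun t => V (expi t)) theta ->
  forall e, 0 < e -> exists2 d, 0 < d & forall a, stolz beta (expi theta) a ->
    normc (a - expi theta) < d -> `|u a - V (expi theta)| < e.
Proof.
move=> lp e e0; have [c cE] : exists c, c = V (expi theta) by eexists.
rewrite -cE; have pi0 := pi_gt0 R.
have [K KE] : exists K, K = (1 + beta) ^+ 2 * (16 * pi / arc_radius 0 ^+ 2 + 256) :> R by eexists.
have K0 : 0 < K.
  rewrite KE mulr_gt0 ?exprn_gt0 ?addr_gt0 ?(lt_trans ltr01 beta1)//.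
  by rewrite divr_gt0 ?exprn_gt0 ?arc_radius_gt0// mulr_gt0.
have [e' e'0 Ke'] : exists2 e', 0 < e' & K * e' <= pi * e / 2.
  exists (pi * e / 2 / K); first by rewrite !divr_gt0// mulr_gt0.
  by rewrite mulrC divfK// gt_eqF.
have [rho [rho0 rhopi Hrho]] : exists rho, [/\ 0 < rho, rho <= pi &
    forall r, 0 < r -> r <= rho -> (\int[mu]_(t in `[(theta - r)%R, (theta + r)%R[)
      `|V (expi t) - c|%:E <= (2 * r * e')%:E)%E].
  have [d d0 Hd] : exists2 d, 0 < d & forall r, 0 < r -> r < d ->
      (davg (fun t => V (expi t)) theta r < e'%:E)%E.
    have := lp (fun x => x < e'%:E)%E; case.
      exact: (@nbhs_open_ereal_lt _ 0 (fun=> e') e'0).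
    move=> d /= d0 Hd; exists d => // r r0 rd; apply: Hd => //=.
    by rewrite sub0r normrN gtr0_norm.
  exists (Num.min (d / 2) pi); split.
  - by rewrite lt_min pi0 divr_gt0.
  - by rewrite ge_min lexx orbT.
  move=> r r0; rewrite le_min => /andP[rd _].
  have hd : d / 2 < d by rewrite ltr_pdivrMr// ltr_pMr// ltr1n.
  have := Hd r r0 (le_lt_trans rd hd).
  rewrite /davg /iavg lebesgue_measure_ball ?(ltW r0)//.
  rewrite inver mulrn_eq0/= gt_eqF// => /ltW; rewrite lee_pdivrMl ?pmulrn_lgt0//.
  rewrite (_ : 2 * r = r *+ 2) ?mulr_natl// EFinM; apply: le_trans.
  rewrite ball_itv -integral_itv_obnd_cbnd; last first.
    by apply: measurable_funTS; apply/measurable_EFinP; exact: mVc.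
  by apply: integral_mono => t _; rewrite ?lee_fin//= cE.
have [L LE] : exists L : R, (\int[mu]_(t in `[(theta - pi)%R, (theta + pi)%R[)
    `|V (expi t) - c|%:E = L%:E)%E.
  exists (fine (\int[mu]_(t in `[(theta - pi)%R, (theta + pi)%R[) `|V (expi t) - c|%:E)%E).
  rewrite fineK// ge0_fin_numE; first exact: integral_deviation.
  by apply: integral_ge0 => t _; rewrite lee_fin.
have L0 : 0 <= L by rewrite -lee_fin -LE; apply: integral_ge0 => t _; rewrite lee_fin.
pose J : set R := `[theta - rho, theta + rho[%classic.
have mJ : measurable J by exact: measurable_itv.
pose g t := `|V (expi t) - c|.
have mg : measurable_fun setT (EFin \o g) by apply/measurable_EFinP; exact: mVc.
(* The part of the deviation close to the vertex; truncation keeps its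
   averages over large arcs small as well. *)
pose f t := g t * \1_J t.
have g0 t : 0 <= g t by exact: normr_ge0.
have f0 t : 0 <= f t by apply: mulr_ge0.
have mf : measurable_fun setT f.
  by apply: measurable_funM; [exact: mVc|exact: measurable_indic].
have fg t : f t <= g t by rewrite ler_piMr// indicE; case: (_ \in _).
have farc r : 0 < r -> (\int[mu]_(t in `[(theta - r)%R, (theta + r)%R[) (f t)%:E <=
    (2 * r * e')%:E)%E.
  move=> r0; have [rrho|/ltW rrho] := leP r rho.
    apply: le_trans (Hrho r r0 rrho).
    by apply: integral_mono => t _; rewrite lee_fin.
  apply: (@le_trans _ _ (2 * rho * e')%:E); last first.
    by rewrite lee_fin ler_wpM2r ?(ltW e'0)// ler_wpM2l.
  apply: le_trans (Hrho rho rho0 (lexx _)).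
  have -> : (\int[mu]_(t in `[(theta - r)%R, (theta + r)%R[) (f t)%:E =
      \int[mu]_(t in `[(theta - r)%R, (theta + r)%R[) ((EFin \o g) \_ J) t)%E.
    by apply: eq_integral => t _; rewrite patchE /f indicE; case: ifP => h; rewrite /= ?mulr1 ?mulr0.
  rewrite -integral_mkcondr; apply: ge0_subset_integral.
  - by apply: measurableI; [exact: measurable_itv|exact: mJ].
  - exact: mJ.
  - exact: measurable_funTS.
  - by move=> t _; rewrite lee_fin.
  - exact: subIsetr.
have [b2 b2E] : exists b, b = (1 + beta) ^+ 2 :> R by eexists.
have b20 : 0 < b2 by rewrite b2E exprn_gt0// addr_gt0// (lt_trans ltr01).
(* The distance at which the part of the Poisson integral away from the vertex
   is at most [pi e / 2]. *)
have [d dE] : exists d, d = pi * e * rho ^+ 2 / (16 * b2 * (L + 1)) by eexists.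
have d0 : 0 < d.
  by rewrite dE divr_gt0 ?mulr_gt0 ?exprn_gt0// ltr_pwDr.
exists d => // a aS ad; have [a1 _] := aS.
have dl : 1 - normc a <= d.
  apply: le_trans (ltW ad); have := normc_tri (expi theta) a 0.
  by rewrite !subr0 normc_expi normcC; lra.
have dl0 : 0 <= 1 - normc a by rewrite subr_ge0 ltW.
have near := poisson_maximal beta1 aS (ltW e'0) mf f0 (fun n => farc _ (arc_radius_gt0 n)) (farc _ pi0).
rewrite -KE in near.
have [k kE] : exists k, k = 8 * b2 * (1 - normc a) / rho ^+ 2 by eexists.
have k0 : 0 <= k by rewrite kE divr_ge0 ?sqr_ge0// !mulr_ge0// ltW.
have kL : k * L <= pi * e / 2.
  apply: (@le_trans _ _ (8 * b2 * d / rho ^+ 2 * (L + 1))).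
    apply: ler_pM => //; last by rewrite lerDl.
    by rewrite kE ler_wpM2r ?invr_ge0 ?sqr_ge0// ler_wpM2l// mulr_ge0// ltW.
  rewrite le_eqVlt; apply/orP; left; apply/eqP; rewrite dE; field.
  by rewrite !gt_eqF//= ltr_pwDr.
have split : (\int[mu]_(t in `[(theta - pi)%R, (theta + pi)%R[) (poisson a t * g t)%:E <=
    (K * e' + k * L)%:E)%E.
  apply: (@le_trans _ _ (\int[mu]_(t in `[(theta - pi)%R, (theta + pi)%R[)
      ((poisson a t * f t)%:E + k%:E * (EFin \o g) t))%E).
    apply: integral_mono => t tI; have P0 := poisson_ge0 t a1.
      by rewrite lee_fin mulr_ge0.
    move: tI; rewrite /= in_itv/= => /andP[t1 t2].
    rewrite -EFinM -EFinD lee_fin /f indicE.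
    case: (boolP (t \in J)) => tJ; rewrite /= ?mulr1 ?mulr0 ?mulr0 ?add0r.
      by rewrite lerDl mulr_ge0.
    rewrite ler_wpM2r// kE b2E; apply: (poisson_far beta1 aS rho0).
      move: tJ; rewrite notin_setE /J/= in_itv/= => /negP; rewrite negb_and -ltNge -leNgt.
      case/orP => h; last by rewrite ler_normr; apply/orP; left; lra.
      by rewrite distrC ler_normr; apply/orP; left; lra.
    by rewrite ler_norml; apply/andP; split; lra.
  rewrite ge0_integralD//; last 4 first.
  - by move=> t _; rewrite lee_fin mulr_ge0// poisson_ge0.
  - apply: measurable_funTS; apply/measurable_EFinP; apply: measurable_funM => //.
    exact: mP.
  - by move=> t _; rewrite mule_ge0// lee_fin.
  - by apply: measurable_funTS; exact: measurable_funeM.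
  rewrite EFinD leeD// ge0_integralZl_EFin//; last 2 first.
  - by move=> t _; rewrite lee_fin.
  - exact: measurable_funTS.
  by rewrite [X in (_ * X)%E]LE -EFinM.
have := le_trans (poisson_deviation c aS) split; rewrite lee_fin => h.
have : 2 * pi * `|u a - c| <= pi * e by lra.
have -> : 2 * pi * `|u a - c| = pi * (2 * `|u a - c|) by ring.
by rewrite ler_pM2l//; lra.
Qed.

End PoissonIntegral.
End Fatou.

(** * Maximal functions on the circle *)

Section TwoGrids.
Context {R : realType}.

(** The one-third trick, with lengths measured in units of [arc_radius n]: the
    grid of mesh [6] and its translate by [2 * 2 ^ n], a third of the period,
    are at distance at least [2] from each other because [3] does not divide
    [2 ^ n]. So every point is at distance at least [1] from the endpoints of
    one of them. *)
Lemma one_third (n : nat) (X : R) : 0 <= X < 6 * (2 ^ n)%:R ->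
  (exists2 j : nat, (j < 2 ^ n)%N & 6 * j%:R + 1 <= X <= 6 * j%:R + 5) \/
  (exists2 j : nat, (j < 2 ^ n)%N &
     6 * j%:R + 1 <= X + (if X < 2 * (2 ^ n)%:R then 6 * (2 ^ n)%:R else 0) -
       2 * (2 ^ n)%:R <= 6 * j%:R + 5).
Proof.
have N3 : (2 ^ n %% 3 != 0)%N.
  by rewrite -/(dvdn 3 (2 ^ n)) Euclid_dvdX//.
have N0 : (0 < 2 ^ n)%N by rewrite expn_gt0.
move: (2 ^ n)%N N3 N0 => N N3 N0 /andP[X0 XN].
have cell (Y : R) : 0 <= Y < 6 * N%:R ->
    exists2 j : nat, (j < N)%N & 6 * j%:R <= Y < 6 * j%:R + 6.
  move=> /andP[Y0 YN]; have Y60 : 0 <= Y / 6 by rewrite divr_ge0.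
  have /andP[h1 h2] := Num.Theory.truncn_itv Y60.
  move: (Num.trunc (Y / 6)) h1 h2 => k h1 h2.
  have {}h1 : 6 * k%:R <= Y by rewrite mulrC -ler_pdivlMr.
  have {}h2 : Y < 6 * (k%:R + 1).
    by rewrite mulrC -ltr_pdivrMr// natr1.
  exists k; last by apply/andP; split; lra.
  by rewrite -(ltr_nat R); lra.
have [|j jN /andP[j1 j2]] := cell X; first by rewrite X0.
have [gj|[k [k1 k2]]] : 6 * j%:R + 1 <= X <= 6 * j%:R + 5 \/
    exists k : nat, X - 6 * k%:R <= 1 /\ - 1 <= X - 6 * k%:R.
- have [h|h] := ltP X (6 * j%:R + 1); first by right; exists j; split; lra.
  have [h'|h'] := ltP (6 * j%:R + 5) X.
    by right; exists j.+1; rewrite -(natr1 j); split; lra.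
  by left; apply/andP.
- by left; exists j.
right; pose c : nat := if X < 2 * N%:R then N else 0%N.
have cE : (if X < 2 * N%:R then 6 * N%:R else 0) = 6 * c%:R :> R.
  by rewrite /c; case: ifP => _; rewrite ?mulr0.
have [|j' jN' /andP[j1' j2']] := cell (X + 6 * c%:R - 2 * N%:R).
  have N0' : 0 < N%:R :> R by rewrite ltr0n.
  by rewrite /c; case: ltP => h; apply/andP; split; lra.
exists j' => //; rewrite cE.
(* Otherwise an endpoint of each of the two grids would be within [1] of [X],
   one of them strictly; their distance being an even integer, they would
   coincide, and [3] would divide [2 ^ n]. *)
pose A := (3 * k + 3 * c)%N; pose B := (N + 3 * j')%N.
have AE : A%:R = 3 * k%:R + 3 * c%:R :> R by rewrite /A natrD !natrM.
have BE : B%:R = N%:R + 3 * j'%:R :> R by rewrite /B natrD !natrM.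
apply/andP; split; rewrite leNgt; apply/negP => h.
  have h1 : (A < B.+1)%N by rewrite -(ltr_nat R) -(natr1 B); lra.
  have h2 : (B < A.+1)%N by rewrite -(ltr_nat R) -(natr1 A); lra.
  have e : A = B by apply/eqP; rewrite eqn_leq -ltnS h1 -ltnS h2.
  move/negP: N3; apply; rewrite -/(dvdn 3 N) -(@dvdn_addl (3 * j') 3 N) ?dvdn_mulr//.
  by rewrite -/B -e /A -mulnDr dvdn_mulr.
have h1 : (A <= B + 3)%N by rewrite -ltnS -addnS -(ltr_nat R) natrD; lra.
have h2 : (B + 3 <= A)%N by rewrite addnS -(ltr_nat R) natrD; lra.
have e : A = (B + 3)%N by apply/eqP; rewrite eqn_leq h1 h2.
move/negP: N3; apply; rewrite -/(dvdn 3 N) -(@dvdn_addl (3 * j') 3 N) ?dvdn_mulr//.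
by rewrite -/B -(@dvdn_addl 3 3 B)// -e /A -mulnDr dvdn_mulr.
Qed.

End TwoGrids.

Section BorelCircle.
Context {R : realType}.
Local Notation C := R[i]^o.
Local Notation Re := (@complex.Re R).
Local Notation Bor := (g_sigma_algebraType (@open C)).

Lemma open_borel (A : set C) : open A -> measurable (A : set Bor).
Proof. exact: sub_sigma_algebra. Qed.

Lemma borel_continuous (h : C -> R) : continuous h -> measurable_fun (setT : set Bor) h.
Proof.
move=> ch; apply: (measurability _ (RGenOInfty.measurableE R)).
move=> _ [_ [x ->] <-]; rewrite setTI; apply: open_borel.
by move/continuousP : ch; apply; exact: interval_open.
Qed.

Lemma borel_circle : measurable (circle : set Bor).
Proof.
have mn := @borel_continuous (@Normc.normc R) (@continuous_normc R).
have -> : circle = setT `&` (@Normc.normc R) @^-1` [set 1] by rewrite setTI.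
exact: (mn measurableT [set 1] (measurable_set1 1)).
Qed.

Lemma measurable_expi : measurable_fun setT (@expi R : R -> Bor).
Proof.
apply: (@measurability _ _ R Bor setT (@expi R) (@open C)) => //.
move=> _ [A oA <-]; rewrite setTI; apply: open_measurable.
by have /continuousP := @continuous_expi R; apply.
Qed.

Lemma borel_expi (H : C -> \bar R) : borel_on_circle H ->
  measurable_fun setT (fun t => H (expi t)).
Proof.
move=> mH; apply: (@measurable_comp _ _ _ _ Bor _ circle H _ (@expi R)) => //.
- exact: borel_circle.
- by move=> _ [t _ <-]; exact: circle_expi.
- exact: measurable_expi.
Qed.

Lemma measurable_acos : measurable_fun (`[(-1), 1] : set R) (@acos R).
Proof.
apply/measurable_fun_itv_bndo_bndcP/measurable_fun_itv_obnd_cbndP.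
apply: open_continuous_measurable_fun => // x.
by rewrite inE/= in_itv/= => xI; exact: continuous_acos.
Qed.

(** Borel sets of the circle correspond to Borel sets of angles, so that
    functions of the angle may be fed into the change of variables by the
    boundary map. *)
Lemma borel_arg : measurable_fun (circle : set Bor) (@arg R).
Proof.
have mC := borel_circle.
have mac : measurable_fun (circle : set Bor) (fun z => acos (Re z)).
  apply: (@measurable_comp _ _ _ Bor _ _ [set` `[(-1 : R), 1]] (@acos R) _ Re) => //.
  - by move=> _ [z cz <-]; rewrite /= in_itv/=; exact: circle_Re.
  - exact: measurable_acos.
  - by apply: measurable_funTS; apply: borel_continuous; exact: continuous_Re.
apply: measurable_fun_if => //.
- apply: measurable_fun_ler => //.
  by apply: measurable_funTS; apply: borel_continuous; exact: continuous_Im.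
- by apply: measurable_funS mac => //; exact: subIsetl.
- apply: measurable_funB => //.
  by apply: measurable_funS mac => //; exact: subIsetl.
Qed.

Lemma borel_arg_comp (h : R -> \bar R) : measurable_fun setT h ->
  borel_on_circle (fun z => h (arg z)).
Proof. by move=> mh; exact: (measurableT_comp mh borel_arg). Qed.

End BorelCircle.

Section CircleMaximal.
Context {R : realType}.
Local Notation C := R[i]^o.
Local Notation mu := (@lebesgue_measure R).

Definition second_origin : R := 2 * pi / 3.

(** The angle counted from the origin of the second grid. *)
Definition second_arg (t : R) : R := if t < second_origin then t + 2 * pi else t.

(** The maximal functions of the two dyadic grids: by [one_third] together
    they dominate the averages over all centred arcs. *)
Definition circle_max (f : C -> R) (n : nat) (z : C) : R :=
  let F := ival (fun t => (f (expi t))%:E) in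
  Num.max (dmax F n 0 (2 * pi) 0 (arg z))
    (dmax F n second_origin (second_origin + 2 * pi) 0 (second_arg (arg z))).

Lemma circle_max_ge0 f n z : 0 <= circle_max f n z.
Proof. by rewrite le_max dmax_ge. Qed.

Lemma circle_max_le f n k z : (n <= k)%N -> circle_max f n z <= circle_max f k z.
Proof.
by move=> nk; rewrite ge_max !le_max !(dmax_le _ _ _ _ _ nk) orbT.
Qed.

Lemma second_origin_gt0 : 0 < second_origin.
Proof. by rewrite /second_origin !mulr_gt0 ?pi_gt0// invr_gt0. Qed.

Lemma second_origin_lt : second_origin < 2 * pi.
Proof. by rewrite /second_origin ltr_pdivrMr// ltr_pMr ?mulr_gt0 ?pi_gt0// ltr1n. Qed.

Lemma measurable_second_arg : measurable_fun setT second_arg.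
Proof.
apply: measurable_fun_ifT => //; first exact: measurable_fun_ltr.
exact: measurable_funD.
Qed.

Lemma borel_circle_max f n p : borel_on_circle (fun z => (circle_max f n z `^ p)%:E).
Proof.
apply: (@borel_arg_comp _ (fun t => ((Num.max
  (dmax (ival (fun t => (f (expi t))%:E)) n 0 (2 * pi) 0 t)
  (dmax (ival (fun t => (f (expi t))%:E)) n second_origin (second_origin + 2 * pi) 0
     (second_arg t))) `^ p)%:E)).
apply/measurable_EFinP; apply: measurable_powR_comp; apply: measurable_maxr.
  exact: measurable_dmax.
exact: (measurableT_comp (measurable_dmax _ _ _ _ _) measurable_second_arg).
Qed.

Variable f : C -> R.
Hypothesis mf : measurable_fun setT (fun t => f (expi t)).
Hypothesis f0 : forall z, 0 <= f z.
Hypothesis fi : (circle_int (EFin \o f) < +oo)%E.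

Let g t := (f (expi t))%:E.
Let g0 t : (0 <= g t)%E. Proof. by rewrite lee_fin. Qed.
Let mg : measurable_fun setT g. Proof. exact/measurable_EFinP. Qed.
Let pi2 : 0 < 2 * pi :> R. Proof. by rewrite mulr_gt0// pi_gt0. Qed.

Let period x : - (2 * pi) <= x <= 2 * pi ->
  (\int[mu]_(t in `[x, (x + 2 * pi)%R[) g t = circle_int (EFin \o f))%E.
Proof. by move=> xI; exact: (@circle_int_periodic R (EFin \o f) x). Qed.

(** The constant [3] is the ratio of the length [6 h] of the dyadic arc to
    that of the centred arc. *)
Let cell_bound (a t h x : R) (j n : nat) : 0 <= a <= second_origin -> (j < 2 ^ n)%N ->
  x = a + j%:R * (6 * h) -> 6 * h = (a + 2 * pi - a) / 2 ^+ n -> 0 < h ->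
  x + h <= t -> t <= x + 5 * h ->
  (\int[mu]_(s in `[(t - h)%R, (t + h)%R[) g s <=
    (2 * h * (3 * dmax (ival g) n a (a + 2 * pi) 0 t))%:E)%E.
Proof.
move=> /andP[a0 a1] jn xE hE h0 xt tx.
have j1 : a + j.+1%:R * ((a + 2 * pi - a) / 2 ^+ n) = x + 6 * h.
  by rewrite -hE xE -natr1; ring.
have j0 : a + j%:R * ((a + 2 * pi - a) / 2 ^+ n) = x by rewrite -hE xE.
have ax : a <= x by rewrite xE lerDl mulr_ge0// mulr_ge0// ltW.
have xb : x + 6 * h <= a + 2 * pi.
  rewrite xE -addrA lerD2l; have -> : j%:R * (6 * h) + 6 * h = j.+1%:R * (6 * h).
    by rewrite -natr1; ring.
  apply: (@le_trans _ _ ((2 ^ n)%:R * (6 * h))).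
    by rewrite ler_wpM2r ?ler_nat// mulr_ge0// ltW.
  by rewrite hE natrX mulrC divfK ?expf_neq0// addrAC subrr add0r.
have gfin : (\int[mu]_(t in `[a, (a + 2 * pi)%R[) g t < +oo)%E.
  by rewrite period//; have := second_origin_lt; have := pi2; move=> *; apply/andP; split; lra.
have avg : ival g (x, x + 6 * h) / (6 * h) <= dmax (ival g) n a (a + 2 * pi) 0 t.
  have := @dmax_average R (ival g) n a (a + 2 * pi) 0 t j jn.
  rewrite j0 j1 -hE; apply; last by rewrite ltrDl.
  by apply/andP; split; lra.
apply: (@le_trans _ _ (\int[mu]_(s in `[x, (x + 6 * h)%R[) g s)%E).
  by apply: itv_co_sub => //; lra.
rewrite (ivalE ax xb mg g0 gfin) lee_fin.
rewrite ler_pdivrMr in avg; last by rewrite mulr_gt0.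
by apply: (le_trans avg); rewrite le_eqVlt; apply/orP; left; apply/eqP; ring.
Qed.

Lemma arc_average (theta : R) (n : nat) : 0 <= theta < 2 * pi ->
  (\int[mu]_(t in `[(theta - arc_radius n)%R, (theta + arc_radius n)%R[) (f (expi t))%:E <=
   (2 * arc_radius n * (3 * circle_max f n (expi theta)))%:E)%E.
Proof.
move=> /andP[t0 t1]; have [h hE] : exists h, h = arc_radius n :> R by eexists.
rewrite -hE; have h0 : 0 < h by rewrite hE arc_radius_gt0.
have N0 : (2 ^ n)%:R != 0 :> R by rewrite pnatr_eq0 expn_eq0.
have h6 : 2 * pi = 6 * (2 ^ n)%:R * h.
  by rewrite hE /arc_radius -natrX; field.
have h6' a : 6 * h = (a + 2 * pi - a) / 2 ^+ n.
  by rewrite addrAC subrr add0r h6 -natrX; field.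
have so : second_origin = 2 * (2 ^ n)%:R * h by rewrite /second_origin h6; field.
have [X XE] : exists X, X = theta / h by eexists.
have tE : theta = X * h by rewrite XE divfK// gt_eqF.
have X0 : 0 <= X < 6 * (2 ^ n)%:R.
  by rewrite XE divr_ge0 ?(ltW h0)//= ltr_pdivrMr// -h6.
have argE : arg (expi theta) = theta by rewrite arg_expi// t0.
case: (one_third X0) => -[j jn /andP[j1 j2]].
  apply: (@le_trans _ _ (2 * h * (3 * dmax (ival g) n 0 (0 + 2 * pi) 0 theta))%:E).
    apply: (@cell_bound 0 theta h (j%:R * (6 * h)) j n) => //.
    - by rewrite lexx/= ltW// second_origin_gt0.
    - by rewrite add0r.
    - by rewrite tE (_ : j%:R * (6 * h) + h = (6 * j%:R + 1) * h) ?ler_wpM2r ?(ltW h0)//; ring.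
    - by rewrite tE (_ : j%:R * (6 * h) + 5 * h = (6 * j%:R + 5) * h) ?ler_wpM2r ?(ltW h0)//; ring.
  rewrite lee_fin ler_wpM2l ?mulr_ge0 ?(ltW h0)// ler_wpM2l//.
  by rewrite add0r le_max argE lexx.
have [s sE] : exists s, s = second_arg theta by eexists.
have sX : s = (X + (if X < 2 * (2 ^ n)%:R then 6 * (2 ^ n)%:R else 0)) * h.
  rewrite sE /second_arg so {1}tE ltr_pM2r//; case: ifP => _.
    by rewrite tE h6; ring.
  by rewrite tE addr0.
have -> : (\int[mu]_(t in `[(theta - h)%R, (theta + h)%R[) (f (expi t))%:E =
    \int[mu]_(t in `[(s - h)%R, (s + h)%R[) (f (expi t))%:E)%E.
  rewrite sE /second_arg; case: ifP => // _.
  rewrite (addrAC theta) (addrAC theta (2 * pi) h) integral_shift//.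
  by apply: eq_integral => t _; rewrite expi_2pi.
apply: (@le_trans _ _ (2 * h * (3 * dmax (ival g) n second_origin (second_origin + 2 * pi) 0 s))%:E).
  apply: (@cell_bound second_origin s h (second_origin + j%:R * (6 * h)) j n) => //.
  - by rewrite lexx andbT ltW// second_origin_gt0.
  - rewrite sX so (_ : _ + h = (6 * j%:R + 1 + 2 * (2 ^ n)%:R) * h); last by ring.
    by rewrite ler_wpM2r ?(ltW h0)//; lra.
  - rewrite sX so (_ : _ + 5 * h = (6 * j%:R + 5 + 2 * (2 ^ n)%:R) * h); last by ring.
    by rewrite ler_wpM2r ?(ltW h0)//; lra.
rewrite lee_fin ler_wpM2l ?mulr_ge0 ?(ltW h0)// ler_wpM2l//.
by rewrite le_max argE -sE lexx orbT.
Qed.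

Lemma circle_average (theta : R) : 0 <= theta < 2 * pi ->
  (\int[mu]_(t in `[(theta - pi)%R, (theta + pi)%R[) (f (expi t))%:E <=
   (2 * pi * circle_max f 0 (expi theta))%:E)%E.
Proof.
move=> /andP[t0 t1]; have pi0 := pi_gt0 R.
have E x : - (2 * pi) <= x <= 2 * pi -> (\int[mu]_(t in `[x, (x + 2 * pi)%R[) g t =
    (ival g (0, 2 * pi))%:E)%E.
  move=> xI; rewrite period// -(@period 0); last by apply/andP; split; lra.
  rewrite add0r (@ivalE R g 0 (2 * pi))//.
  by rewrite -[X in `[0%R, X[]add0r period//; apply/andP; split; lra.
have -> : theta + pi = theta - pi + 2 * pi by ring.
rewrite (E (theta - pi)); last by apply/andP; split; lra.
rewrite lee_fin -ler_pdivrMl// mulrC.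
have := @dmax_average R (ival g) 0 0 (2 * pi) 0 theta 0 isT.
rewrite expr0 divr1 subr0 mul0r mul1r !add0r t0 t1 => /(_ isT pi2) h.
by rewrite le_max arg_expi ?t0 ?t1// h.
Qed.

Section Weighted.
Variables (w : C -> R) (sg : C -> \bar R) (p Q : R).
Hypothesis p1 : 1 < p.
Hypothesis Q0 : 0 <= Q.
Hypothesis mw : measurable_fun setT (fun t => w (expi t)).
Hypothesis w0 : forall t, 0 <= w (expi t).
Hypothesis msg : measurable_fun setT (fun t => sg (expi t)).
Hypothesis sgE : forall t, sg (expi t) =
  if w (expi t) == 0 then +oo%E else (w (expi t) `^ (- (p - 1)^-1))%:E.
Hypothesis wi : (circle_int (EFin \o w) < +oo)%E.
Hypothesis sgi : (circle_int sg < +oo)%E.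
Hypothesis fwi : (circle_int (fun z => (f z `^ p * w z)%:E) < +oo)%E.
Hypothesis wpos : forall x y, x < y -> y <= x + 2 * pi ->
  0 < ival (fun t => (w (expi t))%:E) (x, y).
Hypothesis Ap : forall x y, x < y -> y <= x + 2 * pi ->
  ival (fun t => (w (expi t))%:E) (x, y) * ival (fun t => sg (expi t)) (x, y) `^ (p - 1) <=
  Q * (y - x) `^ p.

Definition muckenhoupt_const : R :=
  Q `^ (p / (p - 1)) * ((2 * (p / (p - 1) / (p / (p - 1) - 1))) `^ (p / (p - 1)) *
    ((2 `^ p) `^ (p / (p - 1) - 1) * ((2 * (p / (p - 1))) `^ p * 2 `^ p))).

Let sg0 t : (0 <= sg (expi t))%E.
Proof. by rewrite sgE; case: ifP => // _; rewrite lee_fin powR_ge0. Qed.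

Let mfw : measurable_fun setT (fun t => (f (expi t) `^ p * w (expi t))%:E).
Proof.
by apply/measurable_EFinP; apply: measurable_funM => //; exact: measurable_powR_comp.
Qed.

Let grid_muckenhoupt a n : 0 <= a <= 2 * pi ->
  (\int[mu]_(t in `[a, (a + 2 * pi)%R[)
      (dmax (ival g) n a (a + 2 * pi) 0 t `^ p * w (expi t))%:E <=
   muckenhoupt_const%:E * circle_int (fun z => (f z `^ p * w z)%:E))%E.
Proof.
move=> /andP[a0 a2].
have aI : - (2 * pi) <= a <= 2 * pi by rewrite a2 andbT (le_trans _ a0)// oppr_le0 ltW.
have per (H : C -> \bar R) : measurable_fun setT (fun t => H (expi t)) ->
    (forall t, 0 <= H (expi t))%E -> (circle_int H < +oo)%E ->
    (\int[mu]_(t in `[a, (a + 2 * pi)%R[) H (expi t) < +oo)%E.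
  by move=> mH H0; rewrite circle_int_periodic.
have ab : a < a + 2 * pi by rewrite ltrDl.
have fw0 t : (0 <= (f (expi t) `^ p * w (expi t))%:E)%E by rewrite lee_fin mulr_ge0 ?powR_ge0.
have yx x y : a <= x -> y <= a + 2 * pi -> y <= x + 2 * pi.
  by move=> ax yb; rewrite (le_trans yb)// lerD2r.
have mEw : measurable_fun setT (fun t => (w (expi t))%:E) by exact/measurable_EFinP.
have wE0 t : (0 <= (w (expi t))%:E)%E by rewrite lee_fin.
have := @dyadic_muckenhoupt R a (a + 2 * pi) (fun t => f (expi t)) (fun t => w (expi t))
  (fun t => sg (expi t)) p Q ab p1 Q0 mf mw msg (fun t => f0 _) w0 sgE
  (per (EFin \o f) mg g0 fi) (per (EFin \o w) mEw wE0 wi) (per sg msg sg0 sgi)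
  (per (fun z => (f z `^ p * w z)%:E) mfw fw0 fwi)
  (fun x y ax xy yb => wpos xy (yx _ _ ax yb)) (fun x y ax xy yb => Ap xy (yx _ _ ax yb)) n.
move/le_trans; apply.
rewrite -(@circle_int_periodic _ (fun z => (f z `^ p * w z)%:E) a)//.
have NE := @ivalE R (fun t => (f (expi t) `^ p * w (expi t))%:E) a (a + 2 * pi) a (a + 2 * pi)
  (lexx _) (lexx _) mfw fw0 (per (fun z => (f z `^ p * w z)%:E) mfw fw0 fwi).
by rewrite NE -EFinM lee_fin /muckenhoupt_const !mulrA.
Qed.

(** The dyadic theorem on each of the two grids, over the corresponding
    fundamental interval of the circle. *)
Lemma circle_max_weighted n :
  (circle_int (fun z => ((circle_max f n z `^ p)%:E * (w z)%:E)%E) <=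
   (2 * muckenhoupt_const)%:E * circle_int (fun z => (f z `^ p * w z)%:E))%E.
Proof.
have [T TE] : exists T, T = 2 * pi :> R by eexists.
have so0 := second_origin_gt0; have so1 := second_origin_lt; rewrite -TE in so1.
pose d0 t := (dmax (ival g) n 0 (0 + 2 * pi) 0 t `^ p * w (expi t))%:E.
pose d1 t := (dmax (ival g) n second_origin (second_origin + 2 * pi) 0 t `^ p * w (expi t))%:E.
have md a b : measurable_fun setT (fun t => (dmax (ival g) n a b 0 t `^ p * w (expi t))%:E).
  apply/measurable_EFinP; apply: measurable_funM => //; apply: measurable_powR_comp.
  exact: measurable_dmax.
have dge0 a b t : (0 <= (dmax (ival g) n a b 0 t `^ p * w (expi t))%:E)%E.
  by rewrite lee_fin mulr_ge0 ?powR_ge0.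
have ms1 : measurable_fun setT (fun t => d1 (second_arg t)).
  exact: (measurableT_comp (md _ _) measurable_second_arg).
have p0 : 0 <= p by rewrite (le_trans ler01)// ltW.
have wper t : w (expi (second_arg t)) = w (expi t).
  by rewrite /second_arg; case: ifP => // _; rewrite expi_2pi.
rewrite /circle_int integral_itv_cc; last 2 first.
- have /borel_expi := borel_circle_max f n p => mc.
  by apply: emeasurable_funM => //; exact/measurable_EFinP.
- by move=> t; rewrite mule_ge0 ?lee_fin ?powR_ge0.
apply: (@le_trans _ _ (\int[mu]_(t in `[0%R, (2 * pi)%R[) (d0 t + d1 (second_arg t)))%E).
  apply: integral_mono => t; rewrite /= in_itv/= => tI.
    by rewrite mule_ge0 ?lee_fin ?powR_ge0.
  rewrite -EFinM -EFinD lee_fin wper -mulrDl ler_wpM2r// /circle_max arg_expi// add0r.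
  have [h|h] := leP (dmax (ival g) n 0 (2 * pi) 0 t)
    (dmax (ival g) n second_origin (second_origin + 2 * pi) 0 (second_arg t)).
    by rewrite lerDr powR_ge0.
  by rewrite lerDl powR_ge0.
rewrite ge0_integralD//; last 4 first.
- by move=> t _; exact: dge0.
- by apply: measurable_funTS; exact: md.
- by move=> t _; exact: dge0.
- exact: measurable_funTS.
have -> : (2 * muckenhoupt_const = muckenhoupt_const + muckenhoupt_const)%R by ring.
have K0 : 0 <= muckenhoupt_const by rewrite /muckenhoupt_const !mulr_ge0 ?powR_ge0.
rewrite EFinD ge0_muleDl ?lee_fin//; apply: leeD.
  have := @grid_muckenhoupt 0 n; rewrite lexx (ltW pi2) => /(_ isT).
  by rewrite [X in `[0%R, X[]add0r.
apply: (@le_trans _ _ (\int[mu]_(t in `[second_origin, (second_origin + 2 * pi)%R[) d1 t)%E); last first.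
  by apply: grid_muckenhoupt; rewrite (ltW so0) -TE ltW.
have i1 : 0 <= second_origin <= T by rewrite (ltW so0) (ltW so1).
have i2 : second_origin <= T <= second_origin + T by rewrite (ltW so1) lerDr ltW.
rewrite -TE (itv_co_split i1 ms1 (fun t => dge0 _ _ _)).
rewrite (itv_co_split i2 (md _ _) (fun t => dge0 _ _ _)).
rewrite addeC; apply: leeD.
  rewrite le_eqVlt; apply/orP; left; apply/eqP; apply: eq_integral => t /set_mem tI.
  have /andP[h _] : second_origin <= t < T by move: tI; rewrite /= in_itv.
  by rewrite /second_arg ltNge h.
have := integral_shift T 0 second_origin (md second_origin (second_origin + 2 * pi))
  (fun t => dge0 second_origin (second_origin + 2 * pi) t).
rewrite add0r => ->.
rewrite le_eqVlt; apply/orP; left; apply/eqP; apply: eq_integral => t /set_mem tI.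
have /andP[_ h] : 0 <= t < second_origin by move: tI; rewrite /= in_itv.
by rewrite /second_arg h TE.
Qed.

End Weighted.
End CircleMaximal.

(** * Muckenhoupt weights on the circle *)

Section CircleFunctions.
Context {R : realType}.
Local Notation C := R[i]^o.
Local Notation mu := (@lebesgue_measure R).

Lemma expi_subn (t : R) (n : nat) : expi (t - n%:R * (2 * pi)) = expi t.
Proof. by rewrite -(expi_periodic_int _ n) subrK. Qed.

Lemma circle_int_window (H : C -> \bar R) (x : R) :
  measurable_fun setT (fun t => H (expi t)) -> (forall t, 0 <= H (expi t))%E ->
  (\int[mu]_(t in `[x, (x + 2 * pi)%R[) H (expi t) = circle_int H)%E.
Proof.
move=> mH H0; have T0 : 0 < 2 * pi :> R by rewrite mulr_gt0// pi_gt0.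
have shift (y c : R) : - (2 * pi) <= y <= 2 * pi -> (forall t, expi (t + c) = expi t) ->
    (\int[mu]_(t in `[(y + c)%R, (y + c + 2 * pi)%R[) H (expi t) = circle_int H)%E.
  move=> yI ec; rewrite (addrAC y) integral_shift// -(@circle_int_periodic _ H y)//.
  by apply: eq_integral => t _; rewrite ec.
have [x0|x0] := leP 0 x.
  have /andP[h1 h2] := Num.Theory.truncn_itv (divr_ge0 x0 (ltW T0)).
  move: (Num.trunc _) h1 h2 => k h1 h2.
  have {}h1 : k%:R * (2 * pi) <= x by rewrite -ler_pdivlMr.
  have {}h2 : x < (k%:R + 1) * (2 * pi) by rewrite -ltr_pdivrMr// natr1.
  have -> : x = (x - k%:R * (2 * pi)) + k%:R * (2 * pi) by rewrite subrK.
  apply: shift; last by move=> t; rewrite expi_periodic_int.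
  by move: h2; rewrite mulrDl mul1r => h2; apply/andP; split; lra.
have x0' : 0 <= - x by lra.
have /andP[h1 h2] := Num.Theory.truncn_itv (divr_ge0 x0' (ltW T0)).
move: (Num.trunc _) h1 h2 => k h1 h2.
have {}h1 : k%:R * (2 * pi) <= - x by rewrite -ler_pdivlMr.
have {}h2 : - x < (k%:R + 1) * (2 * pi) by rewrite -ltr_pdivrMr// natr1.
have -> : x = (x + k%:R * (2 * pi)) - k%:R * (2 * pi) by rewrite addrK.
apply: shift; last by move=> t; rewrite expi_subn.
by move: h2; rewrite mulrDl mul1r => h2; apply/andP; split; lra.
Qed.

Lemma integral_windows_fin (H : C -> \bar R) (x : R) (k : nat) :
  measurable_fun setT (fun t => H (expi t)) -> (forall t, 0 <= H (expi t))%E ->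
  (circle_int H < +oo)%E ->
  (\int[mu]_(t in `[x, (x + k%:R * (2 * pi))%R[) H (expi t) < +oo)%E.
Proof.
move=> mH H0 Hi; have T0 : 0 <= 2 * pi :> R by rewrite mulr_ge0// pi_ge0.
elim: k => [|k IH]; first by rewrite mul0r addr0 set_itvco0 integral_set0.
have i1 : x <= x + k%:R * (2 * pi) <= x + k.+1%:R * (2 * pi).
  by rewrite lerDl mulr_ge0//= lerD2l ler_wpM2r// ler_nat.
rewrite (itv_co_split i1 mH H0).
have -> : x + k.+1%:R * (2 * pi) = x + k%:R * (2 * pi) + 2 * pi by rewrite -natr1; ring.
by rewrite circle_int_window// lte_add_pinfty.
Qed.

(** A bounded interval is covered by finitely many periods. *)
Lemma locally_integrable_circle (V : C -> R) :
  measurable_fun setT (fun t : R => V (expi t)) ->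
  mu.-integrable `[0, 2 * pi] (EFin \o (fun t => V (expi t))) ->
  locally_integrable setT (fun t : R => V (expi t)).
Proof.
move=> mV /integrableP[_ Vi]; split => //; first exact: openT.
move=> K _ cK.
have mN : measurable_fun setT (fun t : R => `|V (expi t)|%:E).
  by apply/measurable_EFinP; exact: measurable_norm_comp.
have [M [_ HM]] := compact_bounded cK.
have T0 : 0 < 2 * pi :> R by rewrite mulr_gt0// pi_gt0.
have [k kM] : exists k : nat, `|M| + 1 < k%:R * (2 * pi).
  have M0 : 0 <= (`|M| + 1) / (2 * pi) by rewrite divr_ge0 ?(ltW T0)// addr_ge0.
  have /andP[_ h] := Num.Theory.truncn_itv M0.
  by exists (Num.trunc ((`|M| + 1) / (2 * pi))).+1; rewrite -ltr_pdivrMr.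
have KI : K `<=` `[- (k%:R * (2 * pi)), - (k%:R * (2 * pi)) + (k + k)%:R * (2 * pi)[%classic.
  move=> t Kt; have M1 : M < `|M| + 1 by rewrite (le_lt_trans (ler_norm _))// ltrDl.
  have := HM _ M1 t Kt; rewrite /= in_itv/= natrD ler_norml => /andP[h1 h2].
  by apply/andP; split; lra.
apply: (@le_lt_trans _ _ (\int[mu]_(t in
    `[(- (k%:R * (2 * pi)))%R, (- (k%:R * (2 * pi)) + (k + k)%:R * (2 * pi))%R[) `|V (expi t)|%:E)%E).
  apply: ge0_subset_integral => //; first exact: compact_measurable.
  exact: measurable_funTS.
by apply: (@integral_windows_fin (fun z => `|V z|%:E)).
Qed.

Lemma ae_lebesgue_circle (V : C -> R) :
  measurable_fun setT (fun t : R => V (expi t)) ->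
  mu.-integrable `[0, 2 * pi] (EFin \o (fun t => V (expi t))) ->
  {ae mu, forall t, lebesgue_pt (fun t : R => V (expi t)) t}.
Proof. by move=> mV Vi; apply: lebesgue_differentiation; exact: locally_integrable_circle. Qed.

(** The larger function will be built from limits that exist only almost
    everywhere; discarding the null set from the integral of the smaller one
    leaves a comparison that holds pointwise. *)
Lemma ae_le_integral (D N : set (measurableTypeR R)) (X Y : R -> \bar R) :
  measurable D -> measurable N ->
  mu N = 0%E -> measurable_fun D X -> (forall t, D t -> 0 <= X t)%E ->
  (forall t, D t -> 0 <= Y t)%E -> (forall t, D t -> ~ N t -> (X t <= Y t)%E) ->
  (\int[mu]_(t in D) X t <= \int[mu]_(t in D) Y t)%E.
Proof.
move=> mD mN N0 mX X0 Y0 XY.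
rewrite (ge0_negligible_integral mN)// integral_mkcondr.
apply: integral_mono => t Dt; rewrite patchE; case: ifPn => //.
  by move=> _; exact: X0.
  by move=> /set_mem nN; exact: XY.
by move=> _; exact: Y0.
Qed.

Section Weight.
Variables (p : R) (w : C -> R).
Hypothesis p1 : 1 < p.
Hypothesis bw : borel_on_circle (EFin \o w).
Hypothesis w0 : forall z, circle z -> 0 <= w z.
Hypothesis w_mass : circle_int (EFin \o w) = (2 * pi)%:E.
Hypothesis ApF : (Ap_char p w < +oo)%E.

Let p10 : 0 < p - 1. Proof. by rewrite subr_gt0. Qed.
Let T0 : 0 < 2 * pi :> R. Proof. by rewrite mulr_gt0// pi_gt0. Qed.

Lemma weight_ge0 t : 0 <= w (expi t). Proof. exact/w0/circle_expi. Qed.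

Let mEw : measurable_fun setT (fun t => (w (expi t))%:E). Proof. exact: borel_expi bw. Qed.

Lemma measurable_weight : measurable_fun setT (fun t => w (expi t)).
Proof. exact/measurable_EFinP. Qed.

Lemma dual_weightE t : dual_weight p w (expi t) =
  if w (expi t) == 0 then +oo%E else (w (expi t) `^ (- (p - 1)^-1))%:E.
Proof. by []. Qed.

Lemma dual_weight_ge0 t : (0 <= dual_weight p w (expi t))%E.
Proof. by rewrite dual_weightE; case: ifP => // _; rewrite lee_fin powR_ge0. Qed.

Lemma measurable_dual_weight : measurable_fun setT (fun t => dual_weight p w (expi t)).
Proof.
apply: measurable_fun_ifT => //.
  by apply: measurable_fun_eqr => //; exact: measurable_weight.
by apply/measurable_EFinP; apply: measurable_powR_comp; exact: measurable_weight.
Qed.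

Let W := ival (fun t => (w (expi t))%:E).
Let S := ival (fun t => dual_weight p w (expi t)).

Lemma Ap_char_ge0 : (0 <= Ap_char p w)%E.
Proof.
apply: le_trans (ereal_sup_ubound _); last first.
  by exists (0, 2 * pi) => //=; rewrite T0 add0r lexx.
rewrite mule_ge0// ?poweR_ge0// /arc_mean mule_ge0 ?lee_fin ?invr_ge0 ?subr0 ?(ltW T0)//.
by apply: integral_ge0 => t _; rewrite lee_fin; exact: weight_ge0.
Qed.

(** The weight has positive mass, so an infinite dual mass would make the
    characteristic infinite. *)
Lemma dual_weight_fin : (circle_int (dual_weight p w) < +oo)%E.
Proof.
rewrite ltey; apply/eqP => sgoo; move: ApF; apply/negP; rewrite -leNgt.
apply: le_trans (ereal_sup_ubound _); last first.
  by exists (0, 2 * pi) => //=; rewrite T0 add0r lexx.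
rewrite /= /arc_mean subr0 -/(circle_int (EFin \o w)) -/(circle_int (dual_weight p w)).
rewrite w_mass sgoo -EFinM mulVf ?gt_eqF// mul1e gt0_muley ?lte_fin ?invr_gt0//.
by rewrite /poweR gt_eqF.
Qed.

Lemma window_fin (H : C -> \bar R) x y : measurable_fun setT (fun t => H (expi t)) ->
  (forall t, 0 <= H (expi t))%E -> (circle_int H < +oo)%E ->
  y <= x + 2 * pi ->
  (\int[mu]_(t in `[x, y[) H (expi t) = (ival (fun t => H (expi t)) (x, y))%:E)%E.
Proof.
move=> mH H0 Hi yx.
apply: (@ivalE R (fun t => H (expi t)) x (x + 2 * pi)) => //.
by rewrite circle_int_window.
Qed.

(** Where the weight vanishes its dual is infinite; the dual weight being
    integrable, the weight cannot vanish on an arc. *)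
Lemma weight_arc_gt0 x y : x < y -> y <= x + 2 * pi -> 0 < W (x, y).
Proof.
move=> xy yx; rewrite lt0r ival_ge0 ?andbT; last by move=> t; rewrite lee_fin weight_ge0.
apply/eqP => W00.
have we : (\int[mu]_(t in `[x, y[) (w (expi t))%:E = 0)%E.
  rewrite (@window_fin (EFin \o w))// ?w_mass ?ltry//.
    by rewrite -/W W00.
  by move=> t; rewrite lee_fin weight_ge0.
have [A [mA A0 sub]] : ae_eq mu [set` `[x, y[] (fun t => (w (expi t))%:E) (cst 0%E).
  apply/ae_eq_integral_abs => //; first exact: measurable_funTS.
  rewrite -we; apply: eq_integral => t _; rewrite gee0_abs// lee_fin.
  exact: weight_ge0.
have : (\int[mu]_(t in `[x, y[) dual_weight p w (expi t) = +oo)%E.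
  apply/eqP; rewrite -leye_eq.
  apply: (@le_trans _ _ (\int[mu]_(t in `[x, y[) (cst +oo%E t))%E).
    rewrite integral_cst//= lebesgue_measure_itv/= lte_fin xy -EFinD.
    by rewrite gt0_mulye// lte_fin subr_gt0.
  apply: (ae_le_integral _ mA A0) => //.
  - by move=> t _; exact: leey.
  - by move=> t _; exact: dual_weight_ge0.
  - move=> t tI nA; rewrite dual_weightE.
    have [//|wn0] := eqVneq (w (expi t)) 0.
    exfalso; apply: nA; apply: sub => /= H; have := H tI => -[/eqP].
    by rewrite (negbTE wn0).
have := @window_fin (dual_weight p w) x y measurable_dual_weight dual_weight_ge0 dual_weight_fin yx.
by move=> ->.
Qed.

Lemma weight_arc_Ap x y : x < y -> y <= x + 2 * pi ->
  W (x, y) * S (x, y) `^ (p - 1) <= fine (Ap_char p w) * (y - x) `^ p.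
Proof.
move=> xy yx; have yx0 : 0 < y - x by rewrite subr_gt0.
have S0 : 0 <= S (x, y) by apply: ival_ge0 => t; exact: dual_weight_ge0.
have W0 : 0 <= W (x, y) by apply: ival_ge0 => t; rewrite lee_fin weight_ge0.
have : ((((y - x)^-1 * W (x, y)) * ((y - x)^-1 * S (x, y)) `^ (p - 1))%:E <= Ap_char p w)%E.
  apply: ereal_sup_ubound; exists (x, y) => /=; first by rewrite xy.
  have eW : (\int[mu]_(t in `[x, y]) (w (expi t))%:E = (W (x, y))%:E)%E.
    have wE0 t : (0 <= (w (expi t))%:E)%E by rewrite lee_fin weight_ge0.
    by rewrite integral_itv_cc// (@window_fin (EFin \o w))// w_mass ltry.
  have eS : (\int[mu]_(t in `[x, y]) dual_weight p w (expi t) = (S (x, y))%:E)%E.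
    rewrite integral_itv_cc; [|exact: measurable_dual_weight|exact: dual_weight_ge0].
    apply: window_fin => //; [exact: measurable_dual_weight|exact: dual_weight_ge0|].
    exact: dual_weight_fin.
  have -> : arc_mean (EFin \o w) x y = ((y - x)^-1 * W (x, y))%:E by rewrite /arc_mean eW EFinM.
  have -> : arc_mean (dual_weight p w) x y = ((y - x)^-1 * S (x, y))%:E by rewrite /arc_mean eS EFinM.
  by rewrite poweR_EFin EFinM.
rewrite -{1}(@fineK _ (Ap_char p w)); last by rewrite ge0_fin_numE ?Ap_char_ge0.
rewrite lee_fin powRM ?invr_ge0 ?(ltW yx0)// => h.
have e : (y - x)^-1 * W (x, y) * ((y - x)^-1 `^ (p - 1) * S (x, y) `^ (p - 1)) *
    (y - x) `^ p = W (x, y) * S (x, y) `^ (p - 1).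
  rewrite -(powR_mulrB1 (ltW yx0) p1).
  have -> : (y - x)^-1 `^ (p - 1) = ((y - x) `^ (p - 1))^-1.
    by rewrite -(powR_inv1 (ltW yx0)) -powRrM mulN1r powRN.
  by field; rewrite !gt_eqF// powR_gt0.
by rewrite -e ler_wpM2r ?powR_ge0.
Qed.

End Weight.
End CircleFunctions.

(** * Boundary values of Hardy functions *)

Section HardyBoundary.
Context {R : realType}.
Local Notation C := R[i]^o.
Local Notation normc := (@Normc.normc R).
Local Notation Re := (@complex.Re R).
Local Notation Im := (@complex.Im R).
Local Notation mu := (@lebesgue_measure R).

Definition boundary_values (g gs : C -> C) : Prop :=
  poisson_integral (Re \o g) (Re \o gs) /\ poisson_integral (Im \o g) (Im \o gs).

(** The real and imaginary parts of [g] are harmonic, with bounded means of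
    order [p]. *)
Lemma hardy_boundary (p : R) (g : C -> C) : 1 < p -> hardy p g ->
  exists gs, boundary_values g gs.
Proof.
move=> p1 [ag]; set s := ereal_sup _ => sF.
have p0 : 0 <= p by rewrite (le_trans ler01)// ltW.
have [M sM] : exists M : R, (s <= M%:E)%E.
  by case: s sF => [M|//|] _; [exists M|exists 0; rewrite leNye].
have bound (h : C -> R) : (forall z, `|h z| <= normc z) -> forall r : R, 0 < r < 1 ->
    (\int[mu]_(t in `[0%R, (2 * pi)%R]) (`|(h \o g) (r%:C * expi t)| `^ p)%:E <= M%:E)%E.
  move=> hn r r01; apply: le_trans sM.
  apply: (@le_trans _ _ (circle_int (fun zeta => (normc (g (r%:C * zeta)) `^ p)%:E))).
    apply: integral_mono => t _; rewrite lee_fin ?powR_ge0//.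
    by apply: powR_mono => //; exact: hn.
  by apply: ereal_sup_ubound; exists r; rewrite /= ?in_itv.
have [U HU] := boundary_function (poisson_harmonic_Re ag) p1 (bound Re (@ler_Re R)).
have [V HV] := boundary_function (poisson_harmonic_Im ag) p1 (bound Im (@ler_Im R)).
by exists (fun z => U z +i* V z).
Qed.

Section BoundaryValues.
Variables (g gs : C -> C).
Hypothesis bg : boundary_values g gs.

Let mRe : measurable_fun setT (fun t => Re (gs (expi t))). Proof. by case: bg => -[]. Qed.
Let mIm : measurable_fun setT (fun t => Im (gs (expi t))). Proof. by case: bg => _ []. Qed.

Lemma measurable_boundary_normc : measurable_fun setT (fun t => normc (gs (expi t))).
Proof.
have -> : (fun t => normc (gs (expi t))) =
    (fun t => Num.sqrt (Re (gs (expi t)) ^+ 2 + Im (gs (expi t)) ^+ 2)).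
  by apply/funext => t; rewrite -normc_sqr sqrtr_sqr ger0_norm ?normc_ge0.
have mq : measurable_fun setT (fun t => Re (gs (expi t)) ^+ 2 + Im (gs (expi t)) ^+ 2).
  by apply: measurable_funD; exact: measurable_funX.
have ms : measurable_fun setT (@Num.sqrt R).
  by apply: continuous_measurable_fun; exact: sqrt_continuous.
exact: (measurableT_comp ms mq).
Qed.

Definition regular_pt (theta : R) : Prop :=
  lebesgue_pt (fun t => Re (gs (expi t))) theta /\
  lebesgue_pt (fun t => Im (gs (expi t))) theta.

Lemma ae_regular : exists N : set (measurableTypeR R),
  [/\ measurable N, mu N = 0%E & forall t, ~ N t -> regular_pt t].
Proof.
have [[_ iRe _] [_ iIm _]] := bg.
have [A [mA A0 sA]] := ae_lebesgue_circle mRe iRe.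
have [B [mB B0 sB]] := ae_lebesgue_circle mIm iIm.
exists (A `|` B); split; first exact: measurableU.
  by apply/eqP; rewrite eq_le measure_ge0 andbT -(adde0 0%E) -{1}A0 -B0; exact: measureU2.
move=> t /= nAB; split; apply: contrapT => nl; apply: nAB.
  by left; exact: sA.
by right; exact: sB.
Qed.

Lemma nontangential_near (beta theta e : R) : 1 < beta -> 0 <= theta < 2 * pi ->
  regular_pt theta -> 0 < e ->
  exists2 d, 0 < d & forall a, stolz beta (expi theta) a ->
    normc (a - expi theta) < d -> normc (g a - gs (expi theta)) < e.
Proof.
move=> b1 tI [lR lI] e0; have e20 : 0 < e / 2 by rewrite divr_gt0.
have [d1 d10 H1] := fatou bg.1 b1 tI lR e20.
have [d2 d20 H2] := fatou bg.2 b1 tI lI e20.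
exists (Num.min d1 d2); first by rewrite lt_min d10.
move=> a aS; rewrite lt_min => /andP[h1 h2].
apply: (le_lt_trans (normc_le_ReIm _)); rewrite ReB ImB.
by have := H1 a aS h1; have := H2 a aS h2; rewrite /=; lra.
Qed.

Lemma radial_stolz (beta r theta : R) : 1 < beta -> 0 < r < 1 ->
  stolz beta (expi theta) (r%:C * expi theta) /\
  normc (r%:C * expi theta - expi theta) = 1 - r.
Proof.
move=> b1 /andP[r0 r1].
have e : normc (r%:C * expi theta - expi theta) = 1 - r.
  have -> : r%:C * expi theta - expi theta = (r - 1)%:C * expi theta.
    by rewrite rmorphB/= mulrBl mul1r.
  by rewrite Normc.normcM normc_real normc_expi mulr1 distrC ger0_norm// subr_ge0 ltW.
split => //; split; first by rewrite /disk/mkset normc_polar// ltW.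
by rewrite e normc_polar ?(ltW r0)// ltr_pMl// subr_gt0.
Qed.

Lemma radial_cvg (theta : R) : 0 <= theta < 2 * pi -> regular_pt theta ->
  g @ radial (expi theta) --> gs (expi theta).
Proof.
move=> tI rt; rewrite /radial.
have : (fun r : R => g (r%:C * expi theta)) @ 1^'- --> gs (expi theta).
  apply/cvg_normcP => e e0.
  have b1 : 1 < 2 :> R by rewrite ltr1n.
  have [d d0 Hd] := nontangential_near b1 tI rt e0.
  have r1 : \forall r \near 1^'-, r < 1 :> R by exact: nbhs_left_lt.
  have r2 : \forall r \near 1^'-, 1 - d < r :> R by apply: nbhs_left_gt; rewrite ltrBlDr ltrDl.
  have r3 : \forall r \near 1^'-, 0 < r :> R by exact: nbhs_left_gt.
  near=> r; have r01 : 0 < r < 1 by apply/andP; split; near: r.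
  have [rS rE] := radial_stolz theta b1 r01.
  apply: Hd => //; rewrite rE.
  have : 1 - d < r by near: r.
  by rewrite ltrBlDl ltrBlDr.
exact.
Unshelve. all: by end_near. Qed.

Lemma radial_limE (theta : R) : 0 <= theta < 2 * pi -> regular_pt theta ->
  radial_lim g (expi theta) = gs (expi theta).
Proof.
move=> tI rt; apply: cvg_lim; first exact: norm_hausdorff.
exact: radial_cvg.
Qed.

(** Comparable to the modulus of the boundary function, and dominating both of
    its coordinates. *)
Definition boundary_sum (z : C) : R := `|Re (gs z)| + `|Im (gs z)|.

Lemma boundary_sum_ge0 z : 0 <= boundary_sum z. Proof. exact: addr_ge0. Qed.

Lemma boundary_sum_le z : boundary_sum z <= 2 * normc (gs z).
Proof. by rewrite mulr_natl mulr2n lerD ?ler_Re ?ler_Im. Qed.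

Lemma measurable_boundary_sum : measurable_fun setT (fun t => boundary_sum (expi t)).
Proof. by apply: measurable_funD; exact: measurable_norm_comp. Qed.

Lemma boundary_sum_fin : (circle_int (EFin \o boundary_sum) < +oo)%E.
Proof.
have [[_ /integrableP[_ iRe] _] [_ /integrableP[_ iIm] _]] := bg.
have -> : circle_int (EFin \o boundary_sum) =
    (\int[mu]_(t in `[0%R, (2 * pi)%R]) (`|(Re (gs (expi t)))%:E| + `|(Im (gs (expi t)))%:E|))%E.
  by [].
rewrite ge0_integralD//; first exact: lte_add_pinfty.
- by apply: measurable_funTS; apply/measurable_EFinP; exact: measurable_norm_comp.
- by apply: measurable_funTS; apply/measurable_EFinP; exact: measurable_norm_comp.
Qed.

(** The constant of [poisson_maximal], with the factor [3] of the one-third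
    trick; the normalization of the Poisson integral divides by [2 pi], and
    the two coordinates add up. *)
Definition stolz_const (beta : R) : R :=
  (1 + beta) ^+ 2 * (16 * pi / arc_radius 0 ^+ 2 + 256) * 3 / pi.

Lemma stolz_const_gt0 beta : 1 < beta -> 0 < stolz_const beta.
Proof.
move=> b1; rewrite /stolz_const divr_gt0 ?pi_gt0// mulr_gt0// mulr_gt0//.
  by rewrite exprn_gt0// addr_gt0// (lt_trans ltr01).
by rewrite addr_gt0// divr_gt0 ?exprn_gt0 ?arc_radius_gt0// mulr_gt0// pi_gt0.
Qed.

(** Poisson integrals in a Stolz cone are dominated by the averages over the
    arcs about its vertex, and these by the two dyadic maximal functions. *)
Lemma nontangential_maximal (beta theta A : R) (a : C) : 1 < beta -> 0 <= theta < 2 * pi ->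
  stolz beta (expi theta) a -> 0 <= A ->
  (forall n, circle_max boundary_sum n (expi theta) <= A) ->
  normc (g a) <= stolz_const beta * A.
Proof.
move=> b1 tI aS A0 HA.
have A30 : 0 <= 3 * A by rewrite mulr_ge0.
have PM := poisson_maximal b1 aS A30 measurable_boundary_sum (fun t => boundary_sum_ge0 _).
have {}PM := PM _ _.
have [a1 _] := aS.
have near : (\int[mu]_(t in `[(theta - pi)%R, (theta + pi)%R[) (poisson a t * boundary_sum (expi t))%:E <=
    ((1 + beta) ^+ 2 * (16 * pi / arc_radius 0 ^+ 2 + 256) * (3 * A))%:E)%E.
  apply: PM => [n|].
    apply: (le_trans (arc_average measurable_boundary_sum boundary_sum_ge0 boundary_sum_fin n tI)).
    rewrite lee_fin ler_wpM2l//; last by rewrite ler_wpM2l.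
    by rewrite mulr_ge0// ltW// arc_radius_gt0.
  apply: (le_trans (circle_average measurable_boundary_sum boundary_sum_ge0 boundary_sum_fin tI)).
  rewrite lee_fin ler_wpM2l// ?mulr_ge0 ?pi_ge0//.
  by apply: (le_trans (HA 0%N)); rewrite ler_peMl// ler1n.
have part (u V : C -> R) : poisson_integral u V -> (forall z, `|V z| <= boundary_sum z) ->
    `|u a| <= stolz_const beta * A / 2.
  move=> uV Vb; have := poisson_deviation uV tI 0 aS; rewrite subr0 => h.
  have : ((2 * pi * `|u a|)%:E <= ((1 + beta) ^+ 2 * (16 * pi / arc_radius 0 ^+ 2 + 256) * (3 * A))%:E)%E.
    apply: le_trans near; apply: (le_trans h); apply: integral_mono => t _.
      by rewrite lee_fin mulr_ge0// poisson_ge0.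
    by rewrite lee_fin subr0 ler_wpM2l// poisson_ge0.
  rewrite lee_fin -ler_pdivlMl ?mulr_gt0 ?pi_gt0// => /le_trans; apply.
  rewrite le_eqVlt; apply/orP; left; apply/eqP; rewrite /stolz_const.
  have e (b x y : R) : x != 0 -> y != 0 ->
      (2 * x)^-1 * ((1 + b) ^+ 2 * (16 * x / y ^+ 2 + 256) * (3 * A)) =
      (1 + b) ^+ 2 * (16 * x / y ^+ 2 + 256) * 3 / x * A / 2.
    by move=> x0 y0; field; rewrite x0 y0.
  by apply: e; rewrite gt_eqF ?pi_gt0 ?arc_radius_gt0.
apply: (le_trans (normc_le_ReIm _)).
have b1' z : `|(Re \o gs) z| <= boundary_sum z by rewrite lerDl.
have b2' z : `|(Im \o gs) z| <= boundary_sum z by rewrite lerDr.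
have h1 := part _ _ bg.1 b1'; have h2 := part _ _ bg.2 b2'.
by move: h1 h2 => /=; lra.
Qed.

End BoundaryValues.
End HardyBoundary.

(** * Boundary maps and compositions *)

Section Assembly.
Context {R : realType}.
Local Notation C := R[i]^o.
Local Notation normc := (@Normc.normc R).
Local Notation Re := (@complex.Re R).
Local Notation Im := (@complex.Im R).
Local Notation mu := (@lebesgue_measure R).

Lemma nontangential_proper (alpha s : R) : 1 < alpha ->
  ProperFilter (nontangential alpha (expi s)).
Proof.
move=> a1; apply: within_nbhs_proper => B /nbhs_normcP[e e0 eB].
have [r r01 re] : exists2 r : R, 0 < r < 1 & 1 - r < e.
  exists (Num.max (1 / 2) (1 - e / 2)).
    by rewrite lt_max gt_max; apply/andP; split; [apply/orP; left; lra|apply/andP; split; lra].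
  have : 1 - e / 2 <= Num.max (1 / 2) (1 - e / 2) by rewrite le_max lexx orbT.
  by lra.
have [rS rE] := radial_stolz s a1 r01.
by exists (r%:C * expi s); split => //; apply: eB; rewrite rE.
Qed.

Lemma analytic_continuous (g : C -> C) (z : C) : analytic_disk g -> disk z ->
  {for z, continuous g}.
Proof.
move=> ag dz; apply: (@cvg_ReIm R C (nbhs z) _ g (g z)).
  by have [+ _] := poisson_harmonic_Re ag; apply.
by have [+ _] := poisson_harmonic_Im ag; apply.
Qed.

Lemma within_comp (gam : R -> C) (phi : C -> C) (a b : R) (D : set C) :
  {within `[a, b], continuous gam} -> {within D, continuous phi} ->
  (forall t, t \in `[a, b] -> D (gam t)) -> {within `[a, b], continuous (phi \o gam)}.
Proof.
move=> cg cp gD; apply/subspace_continuousP => t tab.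
have gt : gam x @[x --> within `[a, b] (nbhs t)] --> gam t by move/subspace_continuousP : cg; apply.
have pt : phi x @[x --> within D (nbhs (gam t))] --> phi (gam t).
  by move/subspace_continuousP : cp; apply; exact: gD.
apply: cvg_comp pt => B /= nB.
have := gt _ nB; rewrite /= !near_simpl !near_withinE => H.
by apply: filterS H => x Bx xab; apply: Bx => //; exact: gD.
Qed.

Section Boundary.
Variables (psi : C -> C) (w : C -> R).
Hypothesis hpsi : circle_homeo_op psi.
Hypothesis bpsi : boundary_weight psi w.

Let T0 : 0 < 2 * pi :> R. Proof. by rewrite mulr_gt0// pi_gt0. Qed.

Lemma circle_psi xi : circle xi -> circle (psi xi).
Proof. by have [[g [h _ _ _]] _] := hpsi => /h[]. Qed.

Lemma measurable_comp_psi (H : C -> \bar R) : borel_on_circle H ->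
  measurable_fun setT (fun t => H (psi (expi t))).
Proof.
move=> bH; have [_ [h [ch _ hE]]] := hpsi.
have -> : (fun t => H (psi (expi t))) = (fun t => H (expi (h t))) by apply/funext => t; rewrite hE.
exact: (measurableT_comp (borel_expi bH) (continuous_measurable_fun ch)).
Qed.

Lemma weight_mass : circle_int (EFin \o w) = (2 * pi)%:E.
Proof.
have [_ _ cv] := bpsi.
have b1 : borel_on_circle (cst 1%E : C -> \bar R) by exact: measurable_cst.
have := cv _ b1 (fun _ _ => lee01).
rewrite {2}/circle_int /= integral_cst//= mul1e lebesgue_measure_itv/= lte_fin T0 -EFinD subr0 => <-.
by apply: eq_integral => t _; rewrite /= mul1e.
Qed.

(** The image of arclength by the boundary map has a density, so it does not
    charge null sets. *)
Lemma null_preimage (N : set (measurableTypeR R)) : measurable N -> mu N = 0%E ->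
  exists N' : set (measurableTypeR R), [/\ measurable N', mu N' = 0%E &
    forall t, 0 <= t <= 2 * pi -> ~ N' t -> ~ N (arg (psi (expi t)))].
Proof.
move=> mN N0; have [bw w0 cv] := bpsi.
pose H (z : C) : \bar R := (\1_N (arg z))%:E.
have bH : borel_on_circle H.
  apply: (@borel_arg_comp _ (fun t => (\1_N t)%:E)); apply/measurable_EFinP.
  exact: measurable_indic.
have H0 z : (0 <= H z)%E by rewrite lee_fin.
have w0' t : 0 <= w (expi t) by exact/w0/circle_expi.
have mX : measurable_fun setT (fun t => (H (expi t) * (w (expi t))%:E)%E).
  by apply: emeasurable_funM; [exact: borel_expi|exact: (borel_expi bw)].
have X0 t : (0 <= H (expi t) * (w (expi t))%:E)%E by rewrite mule_ge0// lee_fin.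
have int0 : circle_int (H \o psi) = 0%E.
  rewrite -cv// /circle_int integral_itv_cc//.
  apply/eqP; rewrite eq_le integral_ge0 ?andbT//.
  rewrite -[leRHS](@integral0 _ _ _ mu `[0%R, (2 * pi)%R[).
  apply: (ae_le_integral _ mN N0) => //; first exact: measurable_funTS.
  move=> t; rewrite /= in_itv/= => tI nN.
  by rewrite /H arg_expi// indicE memNset// mul0e.
have : ae_eq mu [set` `[0%R, (2 * pi)%R]] (fun t => H (psi (expi t))) (cst 0%E).
  apply/ae_eq_integral_abs; [exact: measurable_itv|exact: (measurable_funTS (measurable_comp_psi bH))|].
  rewrite -int0; apply: eq_integral => t _; rewrite gee0_abs//.
move=> [N' [mN' N'0 sub]]; exists N'; split => // t tI nN' Nt; apply: nN'; apply: sub => /= E.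
have := E; rewrite in_itv/= => /(_ tI); rewrite /H indicE mem_set// => -[/eqP].
by rewrite oner_eq0.
Qed.

End Boundary.

Section Main.
Variables (p alpha beta : R) (f g phi psi : C -> C) (w : C -> R) (gs : C -> C).
Hypothesis p1 : 1 < p.
Hypothesis a1 : 1 < alpha.
Hypothesis b1 : 1 < beta.
Hypothesis hg : hardy p g.
Hypothesis hphi : quasiconformal_disk phi.
Hypothesis fE : forall z, disk z -> f z = g (phi z).
Hypothesis hpsi : circle_homeo_op psi.
Hypothesis bphi : boundary_map phi psi.
Hypothesis bpsi : boundary_weight psi w.
Hypothesis ApF : (Ap_char p w < +oo)%E.
Hypothesis gw : (circle_int (fun zeta =>
  (normc (radial_lim g zeta) `^ p * w zeta)%:E) < +oo)%E.
Hypothesis cone : forall xi, circle xi ->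
  phi @` stolz alpha xi `<=` stolz beta (psi xi).
Hypothesis bg : boundary_values g gs.

Let T0 : 0 < 2 * pi :> R. Proof. by rewrite mulr_gt0// pi_gt0. Qed.
Let p0 : 0 < p. Proof. exact: lt_trans p1. Qed.
Let bw : borel_on_circle (EFin \o w). Proof. by case: bpsi. Qed.
Let w0 z : circle z -> 0 <= w z. Proof. by case: bpsi => _ + _; exact. Qed.
Let cpsi t : circle (psi (expi t)). Proof. exact/(circle_psi hpsi)/circle_expi. Qed.
Let argI t : 0 <= arg (psi (expi t)) < 2 * pi. Proof. exact: arg_ge0_lt2pi. Qed.
Let argE t : expi (arg (psi (expi t))) = psi (expi t). Proof. exact: expi_arg. Qed.

(** Cones are mapped into cones, and [phi] tends to [psi] at the vertex, so
    Fatou's theorem for [g] at [psi xi] applies. *)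
Lemma nontangential_cvg s : regular_pt gs (arg (psi (expi s))) ->
  f @ nontangential alpha (expi s) --> gs (psi (expi s)).
Proof.
move=> reg; have PF := nontangential_proper s a1.
apply/cvg_normcP => e e0.
have [d d0 Hd] := nontangential_near bg b1 (argI s) reg e0; rewrite argE in Hd.
have := bphi (circle_expi s); move=> /cvg_normcP/(_ d d0).
rewrite /nontangential !near_withinE; apply: filterS => z Hz zS.
have [dz _] := zS; rewrite fE//; apply: Hd; last exact: Hz.
by apply: (cone (circle_expi s)); exists z.
Qed.

Lemma nontangential_limE s : regular_pt gs (arg (psi (expi s))) ->
  nontangential_lim alpha f (expi s) = gs (psi (expi s)).
Proof.
move=> reg; have PF := nontangential_proper s a1.
by apply: cvg_lim; [exact: norm_hausdorff|exact: nontangential_cvg].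
Qed.

Let J : \bar R := circle_int (fun z => (normc (gs z) `^ p * w z)%:E).

Let mgs : measurable_fun setT (fun t => normc (gs (expi t)) `^ p).
Proof. by apply: measurable_powR_comp; exact: (measurable_boundary_normc bg). Qed.
Let mw : measurable_fun setT (fun t => w (expi t)).
Proof. exact: measurable_weight. Qed.

Let fJ0 t : (0 <= (normc (gs (expi t)) `^ p * w (expi t))%:E)%E.
Proof. by rewrite lee_fin mulr_ge0 ?powR_ge0//; exact/w0/circle_expi. Qed.

(** Radial limits are boundary values at regular points, hence almost
    everywhere. *)
Lemma boundary_norm_fin : (J < +oo)%E.
Proof.
apply: le_lt_trans gw; rewrite /J /circle_int.
have [N [mN N0 HN]] := ae_regular bg.
have mX : measurable_fun setT (fun t => (normc (gs (expi t)) `^ p * w (expi t))%:E).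
  by apply/measurable_EFinP; exact: measurable_funM.
have mN1 : measurable (N `|` [set 2 * pi] : set (measurableTypeR R)).
  by apply: measurableU => //; exact: measurable_set1.
have N10 : mu (N `|` [set 2 * pi]) = 0%E.
  have e1 : mu [set 2 * pi] = 0%E by exact: lebesgue_measure_set1.
  apply/eqP; rewrite eq_le measure_ge0 andbT -(adde0 0%E) -{1}N0 -e1.
  by apply: measureU2 => //; exact: measurable_set1.
apply: (ae_le_integral _ mN1 N10) => //; first exact: measurable_funTS.
  by move=> t _; rewrite lee_fin mulr_ge0 ?powR_ge0//; exact/w0/circle_expi.
move=> t; rewrite /= in_itv/= => /andP[t0 t1] nN.
have t2 : t < 2 * pi.
  by rewrite lt_neqAle t1 andbT; apply/eqP => tE; apply: nN; right.
rewrite (radial_limE bg)//; first by rewrite t0.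
by apply: HN => Nt; apply: nN; left.
Qed.

(** Change of variables by [psi], and [f^* = gs o psi] almost everywhere. In
    the change of variables the boundary function is replaced by a Borel
    function of the angle, which agrees with it on the circle. *)
Lemma boundary_norm_le :
  (J <= circle_int (fun xi => (normc (nontangential_lim alpha f xi) `^ p)%:E))%E.
Proof.
have [N [mN N0 HN]] := ae_regular bg.
have [N' [mN' N'0 HN']] := null_preimage hpsi bpsi mN N0.
pose H (z : C) : \bar R := (normc (gs (expi (arg z))) `^ p)%:E.
have bH : borel_on_circle H.
  by apply: (@borel_arg_comp _ (fun t => (normc (gs (expi t)) `^ p)%:E)); exact/measurable_EFinP.
have HE z : circle z -> H z = (normc (gs z) `^ p)%:E by move=> cz; rewrite /H expi_arg.
have -> : J = circle_int (H \o psi).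
  have [_ _ cv] := bpsi.
  have Hge0 eta : circle eta -> (0 <= H eta)%E by move=> _; rewrite lee_fin powR_ge0.
  rewrite -(cv H bH Hge0); apply: eq_integral => t _.
  by rewrite (HE _ (circle_expi t)) -EFinM.
apply: (ae_le_integral _ mN' N'0) => //.
- exact: (measurable_funTS (measurable_comp_psi hpsi bH)).
- by move=> t _; rewrite lee_fin powR_ge0.
- by move=> t _; rewrite lee_fin powR_ge0.
move=> t; rewrite /= in_itv/= => tI nN'.
rewrite HE; last exact: cpsi.
by rewrite nontangential_limE//; exact/HN/HN'.
Qed.

Let bs := boundary_sum gs.

Let bs_norm : (circle_int (fun z => (bs z `^ p * w z)%:E) <= (2 `^ p)%:E * J)%E.
Proof.
rewrite /J /circle_int -ge0_integralZl_EFin ?powR_ge0//; last first.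
  by apply: measurable_funTS; apply/measurable_EFinP; exact: measurable_funM.
apply: integral_mono => t _.
  by rewrite lee_fin mulr_ge0 ?powR_ge0//; exact/w0/circle_expi.
rewrite -EFinM lee_fin mulrA -powRM ?normc_ge0// ler_wpM2r//; first exact/w0/circle_expi.
by apply: powR_mono; [exact: ltW|exact: boundary_sum_ge0|exact: boundary_sum_le].
Qed.

Let Q := fine (Ap_char p w).

Let Q0 : 0 <= Q.
Proof. by apply: fine_ge0; exact: Ap_char_ge0. Qed.

(** Change of variables by [psi] turns the integral into one with the weight
    [w], to which the maximal theorem applies. *)
Lemma maximal_norm n :
  (circle_int (fun z => (circle_max bs n (psi z) `^ p)%:E) <=
   (2 * muckenhoupt_const p Q * 2 `^ p)%:E * J)%E.
Proof.
have mass := weight_mass bpsi.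
have cv : circle_int (fun z => (circle_max bs n (psi z) `^ p)%:E) =
    circle_int (fun z => (circle_max bs n z `^ p)%:E * (w z)%:E)%E.
  have [_ _ ->//] := bpsi; first exact: borel_circle_max.
  by move=> z _; rewrite lee_fin powR_ge0.
rewrite cv.
have bsfin : (circle_int (fun z => (bs z `^ p * w z)%:E) < +oo)%E.
  have h : ((2 `^ p)%:E * J < +oo)%E.
    have h2 : (0 <= (2 `^ p)%:E :> \bar R)%E by rewrite lee_fin powR_ge0.
    exact: (lte_mul_pinfty h2 isT boundary_norm_fin).
  exact: (le_lt_trans bs_norm h).
apply: (le_trans (circle_max_weighted (measurable_boundary_sum bg) (boundary_sum_ge0 gs)
  (boundary_sum_fin bg) p1 Q0 mw (fun t => w0 (circle_expi t)) (measurable_dual_weight p bw)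
  (dual_weightE p w) _ _ bsfin _ _ n)).
- by rewrite mass ltry.
- exact: dual_weight_fin.
- by move=> x y; exact: (weight_arc_gt0 p1 bw w0 mass ApF).
- by move=> x y; exact: (weight_arc_Ap p1 bw w0 mass ApF).
have -> : (2 * muckenhoupt_const p Q * 2 `^ p)%:E =
    ((2 * muckenhoupt_const p Q)%:E * (2 `^ p)%:E)%E by rewrite EFinM.
rewrite -muleA; apply: lee_wpmul2l.
  by rewrite lee_fin /muckenhoupt_const !mulr_ge0 ?powR_ge0.
exact: bs_norm.
Qed.

(** The supremum over all depths; the maximal functions increase with the
    depth, so monotone convergence carries the bound over. *)
Let Mx (z : C) : \bar R := ereal_sup (range (fun n => (circle_max bs n z `^ p)%:E)).

Let Mx_homo z : {homo (fun n => (circle_max bs n z `^ p)%:E) : n m / (n <= m)%N >-> (n <= m)%E}.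
Proof.
move=> n m nm; rewrite lee_fin; apply: powR_mono; [exact: ltW|exact: circle_max_ge0|].
exact: circle_max_le.
Qed.

Let Mx_cvg z : (circle_max bs n z `^ p)%:E @[n --> \oo] --> Mx z.
Proof. exact: ereal_nondecreasing_cvgn. Qed.

Let Mx_ge z n : ((circle_max bs n z `^ p)%:E <= Mx z)%E.
Proof. by apply: ereal_sup_ubound; exists n. Qed.

Let measurable_term n : measurable_fun setT (fun t => (circle_max bs n (psi (expi t)) `^ p)%:E).
Proof. exact: (measurable_comp_psi hpsi (borel_circle_max bs n p)). Qed.

Let measurable_Mx : measurable_fun setT (fun t => Mx (psi (expi t))).
Proof.
apply: (emeasurable_fun_cvg (fun n t => (circle_max bs n (psi (expi t)) `^ p)%:E)).
  exact: measurable_term.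
by move=> t _; exact: Mx_cvg.
Qed.

Let Mx_ge0 z : (0 <= Mx z)%E.
Proof. by apply: le_trans (Mx_ge z 0); rewrite lee_fin powR_ge0. Qed.

Let Mx_norm : (circle_int (Mx \o psi) <= (2 * muckenhoupt_const p Q * 2 `^ p)%:E * J)%E.
Proof.
rewrite /circle_int; have -> : (\int[mu]_(t in `[0%R, (2 * pi)%R]) (Mx \o psi) (expi t) =
    \int[mu]_(t in `[0%R, (2 * pi)%R]) limn (fun n => (circle_max bs n (psi (expi t)) `^ p)%:E))%E.
  by apply: eq_integral => t _; apply/esym/cvg_lim => //; exact: Mx_cvg.
rewrite monotone_convergence; [|by []
  |by move=> n; exact: (measurable_funTS (measurable_term n))
  |by move=> n t _; rewrite lee_fin powR_ge0|by move=> t _; exact: Mx_homo].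
apply: lime_le; last by apply: nearW => n; exact: maximal_norm.
apply: ereal_nondecreasing_is_cvgn => n m nm.
by apply: integral_mono => t _; [rewrite lee_fin powR_ge0|exact: Mx_homo].
Qed.

(** The value of [f] at a point of the cone at [xi] is a value of [g] in the
    cone at [psi xi]. *)
Lemma cone_bound s z : stolz alpha (expi s) z ->
  ((normc (f z) `^ p)%:E <= (stolz_const beta `^ p)%:E * Mx (psi (expi s)))%E.
Proof.
move=> zS; have [dz _] := zS; rewrite fE//.
have aS : stolz beta (expi (arg (psi (expi s)))) (phi z).
  by rewrite argE; apply: (cone (circle_expi s)); exists z.
have c0 := stolz_const_gt0 b1.
have := Mx_ge (psi (expi s)); have := Mx_ge0 (psi (expi s)).
case: (Mx _) => [L L0 HL|_ _|//]; last by rewrite gt0_muley ?leey// lte_fin powR_gt0.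
rewrite lee_fin in L0.
have pinv (x : R) : 0 <= x -> (x `^ p^-1) `^ p = x.
  by move=> x0; rewrite -powRrM mulVf ?gt_eqF// powRr1.
have pinv' (x : R) : 0 <= x -> (x `^ p) `^ p^-1 = x.
  by move=> x0; rewrite -powRrM mulfV ?gt_eqF// powRr1.
have := nontangential_maximal bg b1 (argI s) aS (powR_ge0 L p^-1).
rewrite argE => H.
have {}H : normc (g (phi z)) <= stolz_const beta * L `^ p^-1.
  apply: H => n; rewrite -(pinv' _ (circle_max_ge0 _ _ _)).
  by apply: powR_mono; [rewrite invr_ge0 ltW|exact: powR_ge0|have := HL n; rewrite lee_fin].
rewrite -EFinM lee_fin -(pinv L L0) -powRM ?(ltW c0) ?powR_ge0//.
by apply: powR_mono => //; [exact: ltW|exact: normc_ge0].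
Qed.

(** Crofton's inequality with [H] the maximal function at [psi xi]. *)
Lemma curve_bound (B : R) (gam : R -> C) (a b : R) : 0 <= B ->
  crofton_constant alpha B ->
  convex_curve gam a b -> (forall t, t \in `[a, b] -> disk (gam t)) ->
  (curve_int gam a b (fun z => (normc (f z) `^ p)%:E) <=
   (B * (stolz_const beta `^ p * (2 * muckenhoupt_const p Q * 2 `^ p)))%:E *
   circle_int (fun xi => (normc (nontangential_lim alpha f xi) `^ p)%:E))%E.
Proof.
move=> B0 HB cc gd; have [_ cg _ _ _] := cc.
have [[phi' [phiD _ cphi _]] _] := hphi.
have cF : {within `[a, b], continuous ((fun z => normc (f z) `^ p) \o gam)}.
  have cpg := within_comp cg cphi gd.
  have ck : {within `[a, b], continuous (fun t => normc (g (phi (gam t))) `^ p)}.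
    apply/subspace_continuousP => t tab.
    have dz : disk (phi (gam t)) by have [] := phiD _ (gd t tab).
    have cz : {for phi (gam t), continuous (fun z => `|normc (g z)| `^ p)}.
      apply: (@continuous_comp _ _ _ (fun z => normc (g z)) (fun x => `|x| `^ p)).
        apply: (@continuous_comp _ _ _ g normc); last exact: continuous_normc.
        by apply: analytic_continuous => //; case: hg.
      exact: continuous_normr_powR.
    have pt : (phi \o gam) x @[x --> within `[a, b] (nbhs t)] --> phi (gam t).
      by move/subspace_continuousP : cpg; apply.
    have kE : (fun t => normc (g (phi (gam t))) `^ p) =
        (fun z => `|normc (g z)| `^ p) \o (phi \o gam).
      by apply/funext => x /=; rewrite ger0_norm ?normc_ge0.
    by rewrite kE; exact: cvg_comp pt cz.
  apply: subspace_eq_continuous ck => t; rewrite inE => tab.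
  change (normc (g (phi (gam t))) `^ p = normc (f (gam t)) `^ p).
  by rewrite fE//; exact: gd.
have K0 : 0 <= stolz_const beta `^ p by exact: powR_ge0.
apply: (le_trans (HB gam a b (fun z => normc (f z) `^ p)
  (fun xi => ((stolz_const beta `^ p)%:E * Mx (psi xi))%E) cc gd _ cF _ _ _)).
- by move=> z; exact: powR_ge0.
- exact: measurable_funeM.
- by move=> t; rewrite mule_ge0.
- by move=> t s _ tS; exact: cone_bound.
rewrite [in leRHS]EFinM -muleA; apply: lee_wpmul2l; first by rewrite lee_fin.
rewrite {1}/circle_int ge0_integralZl_EFin//; last exact: measurable_funTS.
rewrite [in leRHS]EFinM -muleA; apply: lee_wpmul2l; first by rewrite lee_fin.
apply: (le_trans Mx_norm); apply: lee_wpmul2l; last exact: boundary_norm_le.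
by rewrite lee_fin /muckenhoupt_const !mulr_ge0 ?powR_ge0.
Qed.

End Main.

End Assembly.

(** * The embedding theorem for convex curves *)

Theorem theorem6p2 (R : realType) :
  exists (B : R -> R) (C : R -> R -> R -> R),
  forall (p alpha beta : R) (f g phi psi : R[i]^o -> R[i]^o) (w : R[i]^o -> R),
    1 < p -> 1 < alpha -> 1 < beta ->
    hardy p g ->
    quasiconformal_disk phi ->
    (forall z, disk z -> f z = g (phi z)) ->
    circle_homeo_op psi ->
    boundary_map phi psi ->
    boundary_weight psi w ->
    (Ap_char p w < +oo)%E ->
    (circle_int (fun zeta =>
       (Normc.normc (radial_lim g zeta) `^ p * w zeta)%:E) < +oo)%E ->
    (forall xi, circle xi ->
       phi @` stolz alpha xi `<=` stolz beta (psi xi)) ->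
    circle_ae (fun xi =>
      [/\ cvg (f @ nontangential alpha xi),
          cvg (g @ radial (psi xi)) &
          nontangential_lim alpha f xi = radial_lim g (psi xi)]) /\
    (forall (gam : R -> R[i]^o) (a b : R),
       convex_curve gam a b ->
       (forall t, t \in `[a, b] -> disk (gam t)) ->
       (curve_int gam a b (fun z => (Normc.normc (f z) `^ p)%:E) <=
        (B alpha * C p beta (fine (Ap_char p w)))%:E *
        circle_int (fun xi =>
          (Normc.normc (nontangential_lim alpha f xi) `^ p)%:E))%E).
Proof.
have ex alpha : exists B, 1 < alpha -> 0 <= B /\ @crofton_constant R alpha B.
  have [a1|a1] := pselect (1 < alpha); last by exists 0.
  by have [B B0 HB] := crofton a1; exists B.
have [B HB] := boolp.choice ex.
exists B; exists (fun p beta A =>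
  stolz_const beta `^ p * (2 * muckenhoupt_const p A * 2 `^ p)).
move=> p alpha beta f g phi psi w p1 a1 b1 hg hphi fE hpsi bphi bpsi ApF gw cone.
have [gs bg] := hardy_boundary p1 hg.
have [B0 {}HB] := HB _ a1.
split; last by move=> gam a b cc gd; exact: (curve_bound p1 a1 b1 hg hphi fE hpsi bphi bpsi ApF gw cone bg).
have [N [mN N0 HN]] := ae_regular bg.
have [N' [mN' N'0 HN']] := null_preimage hpsi bpsi mN N0.
exists N'; split => // t /= nP; apply: contrapT => nN'; apply: nP.
rewrite in_itv/= => tI; have reg := HN _ (HN' _ tI nN').
have cpsi : circle (psi (expi t)) by exact/(circle_psi hpsi)/circle_expi.
have fc := nontangential_cvg a1 b1 fE hpsi bphi cone bg (s := t).
have aI := arg_ge0_lt2pi cpsi.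
have rc := radial_cvg bg aI reg; have rl := radial_limE bg aI reg.
rewrite (expi_arg cpsi) in rc rl.
split.
- by apply/cvg_ex; exists (gs (psi (expi t))); apply: fc.
- by apply/cvg_ex; exists (gs (psi (expi t))).
- by rewrite rl (nontangential_limE a1 b1 fE hpsi bphi cone bg reg).
Qed.
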